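(* Let $\alpha=\frac12$ and $\sigma\ge2$. Let $v$ be a solution on $[0,T]$ of $$\partial_t v+W_\varepsilon(v)\,\partial_x v+\frac{i}{\varepsilon}|D|^{1/2} v+\frac1\varepsilon\chi_\omega v=0,\qquad v(t=0)=v_0\in H^\sigma(\mathbb T),$$ and let $$\mathcal E_{\mathrm{grav}}(t)=\sum_{k=0}^{4}\|Z^k v(t)\|_{L^2}^2,\qquad Z=i|D|^{1/2}+\chi_\omega .$$ Then $$\frac{d\mathcal E_{\mathrm{grav}}}{dt}\lesssim\mathcal E_{\mathrm{grav}} ,$$ with an implicit constant that is uniform in $\varepsilon$.
   Context: $\mathbb T=\mathbb R/2\pi\mathbb Z$; $H^s=H^s(\mathbb T)$ are the $L^2$-based Sobolev spaces of complex-valued functions; $|D|^\alpha$ is the Fourier multiplier with symbol $|\xi|^\alpha$. $\chi_\omega\in C^\infty(\mathbb T)$ is a fixed non-negative cut-off function supported on an interval $\omega\subset[0,2\pi)$; it also denotes the operator of multiplication by $\chi_\omega$. $\varepsilon\in(0,1)$ is a small parameter. The map $W$ is fixed and satisfies: for some large integer $N$, $W$ is continuous from $H^{s-N}$ to $H^s$ with $\|W(U)\|_{H^s}\lesssim\|\langle D\rangle^{-N}U\|_{H^s}$ for all $s$; $W(U)$ is a real-valued function; $W(U)=W(U^* )$, where $U^*$ is the complex conjugate of $U$; $W$ scales linearly, $W(\lambda U)=\lambda W(U)$ for $\lambda\in\mathbb R$; and $\partial_tW(U)=W(\partial_tU)$ for time-dependent $U$. One sets $W_\varepsilon(v):=\varepsilon^{-1}W(\varepsilon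 v)$. Conventions. A solution on $[0,T]$ is $v\in C([0,T];H^\sigma)$ satisfying the equation in the sense of distributions. Solutions are a priori bounded, so that $\|W_\varepsilon(v)\|_{L^\infty}\lesssim1$ and $\|\partial_xW_\varepsilon(v)\|_{L^\infty}\lesssim1$ uniformly in $\varepsilon$. Accordingly, $\frac{d\mathcal E}{dt}\lesssim\mathcal E$ means: for every $M>0$ there is a constant $C$, depending only on $M$, $\sigma$, $W$, $\chi_\omega$ (not on $\varepsilon$, $t$, $T$ or $v$), such that $\frac{d\mathcal E}{dt}\le C\mathcal E$ on $(0,T)$ for every solution with $\sup_{[0,T]}\|v(t)\|_{H^\sigma}\le M$. The time derivative is taken classically where it exists and otherwise in the sense of distributions. *)

(* Defs.v *)
From HB Require Import structures.
From mathcomp Require Import all_boot all_order all_algebra.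
From mathcomp Require Import complex.
From mathcomp Require Import all_classical all_reals all_analysis.

Set Implicit Arguments.
Unset Strict Implicit.
Unset Printing Implicit Defensive.

Import Order.TTheory GRing.Theory Num.Theory.
Import numFieldNormedType.Exports.
Local Open Scope classical_set_scope.
Local Open Scope ring_scope.
Local Open Scope complex_scope.

(* A distribution u on T = R/2piZ is given by its Fourier coefficients
     u n = (2 pi)^-1 <u, e^(-inx)>,   u = \sum_n u n e^(inx).
   Sequences that belong to no H^s are not distributions; every hypothesis and
   conclusion below is about elements of some H^s. *)
Definition pdist (R : realType) : Type := int -> R[i].

Section Distributions.
Variable R : realType.
Implicit Types (u w : pdist R) (s : R).

Definition sqmod (z : R[i]) : R := complex.Re z ^+ 2 + complex.Im z ^+ 2.

(* Sum of an absolutely summable family (a junk value otherwise). *)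
Definition zsum (f : int -> R) : R :=
  fine (\esum_(n in setT) (Num.max (f n) 0)%:E)
  - fine (\esum_(n in setT) (Num.max (- f n) 0)%:E).

Definition czsum (f : int -> R[i]) : R[i] :=
  zsum (fun n => complex.Re (f n)) +i* zsum (fun n => complex.Im (f n)).

Definition cintegral (D : set R) (f : R -> R[i]) : R[i] :=
  (\int[lebesgue_measure]_(x in D) complex.Re (f x))
  +i* (\int[lebesgue_measure]_(x in D) complex.Im (f x)).

Definition fourier_coef (f : R -> R[i]) : pdist R := fun n =>
  ((2 * pi)^-1)%:C *
  cintegral `[0, 2 * pi] (fun x => f x * (cos (n%:~R * x) -i* sin (n%:~R * x))).

Definition padd u w : pdist R := fun n => u n + w n.
Definition pscale (c : R[i]) u : pdist R := fun n => c * u n.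
Definition psub u w : pdist R := fun n => u n - w n.

(* Pointwise product: convolution of the Fourier coefficients. It is used only
   when one factor is in some H^s with s > 1/2 and the other in L^2, or when one
   factor is smooth, so that the sums converge absolutely. *)
Definition pmul u w : pdist R := fun n => czsum (fun m => u (n - m) * w m).

(* The distribution x |-> (u x)^* . *)
Definition pconj u : pdist R := fun n => (u (- n))^*.

Definition preal u : Prop := pconj u = u.

Definition fmultiplier (m : int -> R[i]) u : pdist R := fun n => m n * u n.

Definition absD s : pdist R -> pdist R :=
  fmultiplier (fun n => (`|n%:~R : R| `^ s)%:C).

Definition bracketD s : pdist R -> pdist R :=
  fmultiplier (fun n => ((1 + (n%:~R : R) ^+ 2) `^ (s / 2))%:C).

Definition Dx : pdist R -> pdist R :=
  fmultiplier (fun n => 'i%C * (n%:~R : R)%:C).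

(* ||u||_(L^2(T)), by Parseval; +oo when u is not in L^2. *)
Definition L2norm u : \bar R :=
  (((2 * pi)%:E * \esum_(n in setT) (sqmod (u n))%:E) `^ 2^-1)%E.

Definition Hnorm s u : \bar R := L2norm (bracketD s u).

Definition inH s u : Prop := (Hnorm s u < +oo)%E.

Definition H_derive s (U : R -> pdist R) (t : R) (dU : pdist R) : Prop :=
  Hnorm s (psub (pscale (h^-1)%:C (psub (U (t + h)) (U t))) dU) @[h --> 0^']
    --> 0%E.

Definition H_continuous_on s (T : R) (v : R -> pdist R) : Prop :=
  forall t, t \in `[0, T] ->
    inH s (v t) /\
    Hnorm s (psub (v r) (v t)) @[r --> within `[0, T] (nbhs t)] --> 0%E.

Definition smooth (f : R -> R) : Prop :=
  forall (n : nat) (x : R), derivable f^`(n)%classic x 1.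

Definition test_function (T : R) (phi : R -> R) : Prop :=
  smooth phi /\
  exists a b, [/\ 0 < a, b < T & forall t, t \notin `[a, b] -> phi t = 0].

End Distributions.

(* Standing assumptions on chi_omega; T is represented by [0, 2 pi[. *)
Record cutoff (R : realType) (omega : set R) (chi : R -> R) : Prop := Cutoff {
  cutoff_interval : is_interval omega;
  cutoff_omega : omega `<=` `[0, 2 * pi[;
  cutoff_smooth : smooth chi;
  cutoff_periodic : forall x, chi (x + 2 * pi) = chi x;
  cutoff_ge0 : forall x, 0 <= chi x;
  cutoff_supp : forall x, x \in `[0, 2 * pi[ -> ~ omega x -> chi x = 0 }.

Definition pmul_fun (R : realType) (chi : R -> R) (u : pdist R) : pdist R :=
  pmul (fourier_coef (fun x => (chi x)%:C)) u.

(* Standing assumptions on W, with smoothing index N. The conditions concern the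
   values of W on distributions, that is on the union of the spaces H^s. *)
Record smoothing_map (R : realType) (N : nat) (W : pdist R -> pdist R) : Prop :=
  SmoothingMap {
  smoothing_continuous : forall (s : R) (U : pdist R), inH (s - N%:R) U ->
    inH s (W U) /\
    (forall e : R, 0 < e -> exists2 d : R, 0 < d &
      forall V, inH (s - N%:R) V ->
        (Hnorm (s - N%:R) (psub V U) < d%:E)%E ->
        (Hnorm s (psub (W V) (W U)) < e%:E)%E);
  smoothing_bound : forall s : R, exists2 c : R, 0 < c &
    forall U, inH (s - N%:R) U ->
      (Hnorm s (W U) <= c%:E * Hnorm s (bracketD (- N%:R) U))%E;
  smoothing_real : forall (s : R) U, inH s U -> preal (W U);
  smoothing_conj : forall (s : R) U, inH s U -> W U = W (pconj U);
  smoothing_scale : forall (s lambda : R) U, inH s U ->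
    W (pscale lambda%:C U) = pscale lambda%:C (W U);
  smoothing_dt : forall (s a b : R) (U dU : R -> pdist R),
    (forall t, t \in `]a, b[ ->
      [/\ inH (s - N%:R) (U t), inH (s - N%:R) (dU t)
        & H_derive (s - N%:R) U t (dU t)]) ->
    forall t, t \in `]a, b[ ->
      H_derive s (fun r => W (U r)) t (W (dU t)) }.

Section Equation.
Variables (R : realType) (W : pdist R -> pdist R) (chi : R -> R).

Definition Weps (eps : R) (v : pdist R) : pdist R :=
  pscale (eps^-1)%:C (W (pscale eps%:C v)).

(* W_eps(v) d_x v + (i/eps) |D|^(1/2) v + (1/eps) chi v *)
Definition grav_rhs (eps : R) (v : pdist R) : pdist R :=
  padd (padd (pmul (Weps eps v) (Dx v))
             (pscale ('i%C * (eps^-1)%:C) (absD 2^-1 v)))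
       (pscale (eps^-1)%:C (pmul_fun chi v)).

(* v in C([0,T]; H^sigma), d_t v + grav_rhs v = 0 in D'((0,T) x T), v(0) = v0.
   D'((0,T) x T) is identified with D'((0,T); D'(T)): a distribution there
   vanishes iff it vanishes on all phi(t) e^(-inx). *)
Definition grav_solution (eps sigma T : R) (v0 : pdist R) (v : R -> pdist R)
    : Prop :=
  [/\ H_continuous_on sigma T v,
      v 0 = v0
    & forall phi, test_function T phi -> forall n : int,
        cintegral `[0, T] (fun t =>
          - (phi^`()%classic t)%:C * v t n + (phi t)%:C * grav_rhs eps (v t) n) = 0].

Definition Zop (u : pdist R) : pdist R :=
  padd (pscale 'i%C (absD 2^-1 u)) (pmul_fun chi u).

Definition Egrav (v : R -> pdist R) (t : R) : \bar R :=
  (\sum_(k < 5) L2norm (iter k Zop (v t)) ^+ 2)%E.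

End Equation.

(* dE/dt <= C E on (0,T), classically at every point of differentiability and
   in D'((0,T)); the first two clauses make this inequality meaningful. *)
Definition derivative_le (R : realType) (T C : R) (E : R -> \bar R) : Prop :=
  let e := fun t => fine (E t) in
  [/\ forall t, t \in `]0, T[ -> E t \is a fin_num,
      locally_integrable `]0, T[ e,
      forall t, t \in `]0, T[ -> derivable e t 1 -> e^`()%classic t <= C * e t
    & forall phi, test_function T phi -> (forall t, 0 <= phi t) ->
        - (\int[lebesgue_measure]_(t in `]0, T[) (e t * phi^`()%classic t))
        <= C * (\int[lebesgue_measure]_(t in `]0, T[) (e t * phi t))].

(* Main.v *)
(* Since W is linear on real scalars, W_eps(v) = W(v) =: w, a real function
   bounded in H^(sigma+N), hence in H^3. With X = w d_x the equation reads
   d_t v = - X v - Z v / eps. For f = Z^k v the singular term contributes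
   - 2 Re <Z f, f> / eps = - 2 <chi f, f> / eps <= 0; X is skew-symmetric up to
   multiplication by w'; and [Z, X] = i [|D|^(1/2), w] d_x - w chi' has order
   1/2, so that [X, Z^k] v is in L^2 with norm at most that of v in H^2. As Z is
   elliptic of order 1/2, the H^2 norm of v is controlled by the energy.

   At the regularity sigma = 2 the energy cannot be differentiated directly.
   It is approximated by sum_k ||J_L Z^k v||^2, where J_L is the Fourier
   multiplier max(0, 1 - |n|/(L+1)). It has finite support; [J_L, X] is bounded
   on L^2 uniformly in L because |rho(n) - rho(m)| |m| <= 2 |n - m|; and
   [J_L, chi] = O(1/L), so that the error O(1/(eps L)) in the singular term
   vanishes as L tends to infinity with eps fixed. *)
Require Import Defs.
From mathcomp Require Import all_boot all_order all_algebra.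
From mathcomp Require Import complex.
From mathcomp Require Import all_classical all_reals all_analysis.
From mathcomp Require Import ring lra zify.
Import Order.TTheory GRing.Theory Num.Theory.
Import numFieldNormedType.Exports.
Set Implicit Arguments.
Unset Strict Implicit.
Unset Printing Implicit Defensive.
Local Open Scope classical_set_scope.
Local Open Scope ring_scope.
Local Open Scope complex_scope.

(** * Sums over the integers *)

Section Sums.
Variable R : realType.
Implicit Types (f g : int -> R) (A B : R).

(** All operators act on Fourier coefficients. Divergent sums have junk values, so each operator
    identity carries bounds [sob] and [wl1] that certify absolute convergence; this is why orders
    and constants accompany even algebraic lemmas. For sigma = 2 the function d_t v is only in H^1,
    so Z^4 d_t v lies in H^(-1) while Z^4 v is only in L^2, and the two cannot be paired. The
    truncated energies involve finitely many modes. The equation holds weakly in time, and the du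
    Bois-Reymond lemma makes each mode of v differentiable. As Z^k mixes all modes, the modes of Z^k
    v are reached through differentiability of v in L^2. J_L is the Fejer mean. A sharp cut-off
    would fail: its symbol jumps by 1 between neighbours near L, so its commutator with X is not
    bounded uniformly in L. In the limit the energy is known to be continuous only. The inequality
    therefore passes to the limit twice: along finite increments for the classical clause, and
    against test functions for the distributional one. *)

Definition nnsum f : \bar R := \esum_(n in setT) (f n)%:E.

(** For nonnegative families this is at once a certificate of convergence and an explicit bound. *)
Definition sum_le f B : Prop := (nnsum f <= B%:E)%E.

Lemma nnsum_ge0 f : (forall n, 0 <= f n) -> (0 <= nnsum f)%E.
Proof. by move=> f0; apply: esum_ge0 => n _; rewrite lee_fin. Qed.

Lemma le_nnsum f g : (forall n, f n <= g n) -> (nnsum f <= nnsum g)%E.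
Proof. by move=> fg; apply: le_esum => n _; rewrite lee_fin. Qed.

(** The extended sum is a supremum over finite sets, so estimates reduce to the algebra of finite
    sums. *)
Lemma sum_leP f B : sum_le f B <->
  (forall s : seq int, uniq s -> \sum_(n <- s) f n <= B).
Proof.
split=> [fB s us|fB].
  rewrite -lee_fin; apply: le_trans fB; apply: ereal_sup_ubound.
  exists [set` s]; first by split=> //; exact: finite_seq.
  by rewrite -fsbig_seq// sumEFin.
apply: ge_ereal_sup => _ [X [finX _] <-].
by rewrite fsbig_finite// sumEFin lee_fin; exact/fB/finmap.fset_uniq.
Qed.

Lemma sum_leW f g A B : (forall n, f n <= g n) -> A <= B -> sum_le g A ->
  sum_le f B.
Proof.
move=> fg AB gA; rewrite /sum_le (le_trans (le_nnsum fg))//.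
by rewrite (le_trans gA)// lee_fin.
Qed.

Lemma sum_le_ge0 f B : (forall n, 0 <= f n) -> sum_le f B -> 0 <= B.
Proof. by move=> f0 fB; rewrite -lee_fin (le_trans _ fB)// nnsum_ge0. Qed.

Lemma sum_leD f g A B : sum_le f A -> sum_le g B ->
  sum_le (fun n => f n + g n) (A + B).
Proof.
move=> /sum_leP fA /sum_leP gB; apply/sum_leP => s us.
by rewrite big_split lerD ?fA ?gB.
Qed.

Lemma sum_leZ f c B : 0 <= c -> sum_le f B -> sum_le (fun n => c * f n) (c * B).
Proof.
move=> c0 /sum_leP fB; apply/sum_leP => s us.
by rewrite -mulr_sumr ler_wpM2l// fB.
Qed.

Lemma sum_leZr f c B : 0 <= c -> sum_le f B -> sum_le (fun n => f n * c) (B * c).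
Proof.
move=> c0 /sum_leP fB; apply/sum_leP => s us.
by rewrite -mulr_suml ler_wpM2r// fB.
Qed.

Lemma nnsum_reindex (e : int -> int) f : bijective e ->
  nnsum (fun n => f (e n)) = nnsum f.
Proof.
move=> be; rewrite /nnsum [RHS](@reindex_esum _ _ _ setT setT e)//.
by split=> // [x y _ _ /(bij_inj be)//|y _]; case: be => h eh he; exists (h y).
Qed.

Lemma bij_addz (k : int) : bijective (fun n => n + k).
Proof. by exists (fun n => n - k) => n; rewrite ?addrK ?subrK. Qed.

Lemma bij_subz (k : int) : bijective (fun n => k - n).
Proof. by exists (fun n => k - n) => n; rewrite opprB addrCA subrr addr0. Qed.

Lemma nnsum_term f n : ((f n)%:E <= nnsum f)%E.
Proof.
apply: ereal_sup_ubound; exists [set n]; first by split.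
by rewrite fsbig_set1.
Qed.

Lemma sum_le_term f n B : sum_le f B -> f n <= B.
Proof. by move=> fB; rewrite -lee_fin (le_trans _ fB)// nnsum_term. Qed.

Lemma nnsum_exchange (F : int -> int -> R) : (forall n m, 0 <= F n m) ->
  (\esum_(n in setT) nnsum (F n) = \esum_(m in setT) nnsum (F^~ m))%E.
Proof.
move=> F0; rewrite /nnsum esum_esum; last by move=> n m _ _; rewrite lee_fin.
rewrite esum_esum; last by move=> n m _ _; rewrite lee_fin.
rewrite (reindex_esum (setT `*`` fun=> setT) _ (fun x => (x.2, x.1)))//.
split=> // [[i j] [i' j'] _ _ [-> ->]//|[i j] _].
by exists (j, i).
Qed.

(** Weighted Cauchy-Schwarz: the quadratic Q - 2 l p + l^2 P in l is a sum of nonnegative terms, and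
    it is evaluated at its minimum. *)
Lemma sum_sqr_le (I : Type) (s : seq I) (a b : I -> R) :
  (forall i, 0 <= a i) ->
  (\sum_(i <- s) a i * b i) ^+ 2
    <= (\sum_(i <- s) a i) * \sum_(i <- s) a i * b i ^+ 2.
Proof.
move=> a0.
set p := \sum_(i <- s) a i * b i; set P := \sum_(i <- s) a i.
set Q := \sum_(i <- s) _ * _ ^+ 2.
have q0 l : 0 <= Q - 2 * l * p + l ^+ 2 * P.
  have -> : Q - 2 * l * p + l ^+ 2 * P = \sum_(i <- s) a i * (b i - l) ^+ 2.
    rewrite /Q /p /P !mulr_sumr -sumrB -big_split/=.
    by apply: eq_bigr => i _; ring.
  by apply: sumr_ge0 => i _; rewrite mulr_ge0// sqr_ge0.
have P0 : 0 <= P by exact: sumr_ge0.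
have Q0 : 0 <= Q by apply: sumr_ge0 => i _; rewrite mulr_ge0 ?sqr_ge0.
have [Pe|Pn] := eqVneq P 0.
  have [->|pn] := eqVneq p 0; first by rewrite expr0n/= mulr_ge0.
  (* When P = 0 the quadratic is affine in l; with p nonzero it would take the value -1 at this
     l. *)
  have := q0 ((Q + 1) / (2 * p)).
  rewrite Pe mulr0 addr0 => /le_trans/(_ (_ : _ <= -1)).
  have -> : Q - 2 * ((Q + 1) / (2 * p)) * p = -1 by field.
  by move=> /(_ (lexx _)); rewrite oppr_ge0 ler10.
have := q0 (p / P).
have -> : Q - 2 * (p / P) * p + (p / P) ^+ 2 * P = Q - p ^+ 2 / P by field.
by rewrite subr_ge0 ler_pdivrMr ?lt0r ?Pn// mulrC.
Qed.

Lemma esum_fin_num (f : int -> \bar R) (B : R) : (forall n, 0 <= f n)%E ->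
  (\esum_(n in setT) f n <= B%:E)%E -> forall n, f n \is a fin_num.
Proof.
move=> f0 fB n; rewrite ge0_fin_numE//.
apply: le_lt_trans (ltry B); apply: le_trans fB.
apply: ereal_sup_ubound; exists [set n]; first by split.
by rewrite fsbig_set1.
Qed.

Lemma double_nnsum_le (F : int -> int -> R) (g : int -> R) (B c : R) :
  (forall n m, 0 <= F n m) -> 0 <= c ->
  (forall m, sum_le (F^~ m) (c * g m)) -> sum_le g B ->
  (\esum_(n in setT) nnsum (F n) <= (c * B)%:E)%E.
Proof.
move=> F0 c0 Fg gB; rewrite nnsum_exchange//.
apply: le_trans (sum_leZ c0 gB).
by apply: le_esum => m _; exact: Fg.
Qed.

(** Convolution of l^1 with l^2: Cauchy-Schwarz with weight a (n - m), then Tonelli for the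
    convolution of a with b^2. The domination of u is stated in the extended reals, so that it can
    be used before convergence is known. *)
Lemma young (a b u : int -> R) (A B : R) :
  (forall n, 0 <= a n) -> (forall n, 0 <= b n) -> (forall n, 0 <= u n) ->
  sum_le a A -> sum_le (fun n => b n ^+ 2) B ->
  (forall n, ((u n)%:E <= nnsum (fun m => (a (n - m) * b m)%R))%E) ->
  sum_le (fun n => u n ^+ 2) (A ^+ 2 * B).
Proof.
move=> a0 b0 u0 aA bB uab.
have A0 : 0 <= A by exact: sum_le_ge0 aA.
have dbl : (\esum_(n in setT) nnsum (fun m => (a (n - m) * b m ^+ 2)%R)
    <= (A * B)%:E)%E.
  apply: (@double_nnsum_le _ (fun m => b m ^+ 2)) => //.
  - by move=> n m; rewrite mulr_ge0 ?sqr_ge0.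
  - move=> m; apply: sum_leZr => //; rewrite ?sqr_ge0//.
    by rewrite /sum_le (nnsum_reindex a (bij_addz (- m))).
have T0 n : (0 <= nnsum (fun m => (a (n - m) * b m ^+ 2)%R))%E.
  by apply: nnsum_ge0 => m; rewrite mulr_ge0 ?sqr_ge0.
have Tfin := esum_fin_num T0 dbl.
pose T n := fine (nnsum (fun m => a (n - m) * b m ^+ 2)).
have TE n : nnsum (fun m => a (n - m) * b m ^+ 2) = (T n)%:E.
  by rewrite fineK.
have uT n : u n ^+ 2 <= A * T n.
  have T0' : 0 <= A * T n by rewrite mulr_ge0// fine_ge0.
  rewrite -ler_sqrt// sqrtr_sqr ger0_norm// -lee_fin.
  apply: le_trans (uab n) _; apply/sum_leP => s us.
  rewrite -[leLHS]ger0_norm; last by apply: sumr_ge0 => i _; rewrite mulr_ge0.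
  rewrite -sqrtr_sqr ler_sqrt//.
  apply: le_trans (sum_sqr_le _ _ (fun i => a0 (n - i))) _.
  apply: ler_pM.
  - exact: sumr_ge0.
  - by apply: sumr_ge0 => i _; rewrite mulr_ge0 ?sqr_ge0.
  - move: s us; apply/sum_leP.
    by rewrite /sum_le (nnsum_reindex a (bij_subz n)).
  - by move: s us; apply/sum_leP; rewrite /sum_le TE.
apply: (sum_leW uT (lexx _)); rewrite expr2 -mulrA; apply: sum_leZ => //.
rewrite /sum_le /nnsum.
by rewrite (eq_esum (b := fun n => nnsum (fun m => a (n - m) * b m ^+ 2))).
Qed.

End Sums.

(** * Signed sums as differences of nonnegative sums *)

Section SignedSums.
Variable R : realType.
Implicit Types (f g a b : int -> R) (A B : R).

Definition nsum f : R := fine (nnsum f).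

Lemma nnsumE f B : (forall n, 0 <= f n) -> sum_le f B -> nnsum f = (nsum f)%:E.
Proof.
move=> f0 fB; rewrite fineK// ge0_fin_numE ?nnsum_ge0//.
exact: le_lt_trans fB (ltry B).
Qed.

Lemma nsum_le f B : (forall n, 0 <= f n) -> sum_le f B -> nsum f <= B.
Proof. by move=> f0 fB; rewrite -lee_fin -(nnsumE f0 fB). Qed.

Lemma nsum_ge0 f : (forall n, 0 <= f n) -> 0 <= nsum f.
Proof. by move=> f0; rewrite fine_ge0// nnsum_ge0. Qed.

Lemma sum_le_nsum f B : (forall n, 0 <= f n) -> sum_le f B -> sum_le f (nsum f).
Proof. by move=> f0 fB; rewrite /sum_le (nnsumE f0 fB). Qed.

Lemma nsumD a b A B : (forall n, 0 <= a n) -> (forall n, 0 <= b n) ->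
  sum_le a A -> sum_le b B -> nsum (fun n => a n + b n) = nsum a + nsum b.
Proof.
move=> a0 b0 aA bB; apply: EFin_inj.
have ab0 n : 0 <= a n + b n by rewrite addr_ge0.
rewrite -(nnsumE ab0 (sum_leD aA bB)) EFinD -(nnsumE a0 aA) -(nnsumE b0 bB).
by rewrite /nnsum -esumD// => n _; rewrite lee_fin.
Qed.

Lemma nsumZ a c A : 0 <= c -> (forall n, 0 <= a n) -> sum_le a A ->
  nsum (fun n => c * a n) = c * nsum a.
Proof.
move=> c0 a0 aA; have := c0; rewrite le_eqVlt => /predU1P[<-|cp].
  rewrite mul0r; apply/eqP; rewrite eq_le nsum_ge0 ?andbT; last first.
    by move=> n; rewrite mul0r.
  apply: nsum_le => [n|]; rewrite ?mul0r//.
  by apply/sum_leP => s _; rewrite big1// => n _; rewrite mul0r.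
have ca0 n : 0 <= c * a n by rewrite mulr_ge0.
apply/eqP; rewrite eq_le; apply/andP; split.
  by apply: nsum_le => //; apply: sum_leZ => //; exact: sum_le_nsum aA.
rewrite mulrC -ler_pdivlMr//; apply: nsum_le => //.
rewrite mulrC; have ci0 : 0 <= c^-1 by rewrite invr_ge0.
apply: (sum_leW _ (lexx _) (sum_leZ ci0 (sum_le_nsum ca0 (sum_leZ c0 aA)))) => n.
by rewrite mulKf// gt_eqF.
Qed.

(** The value does not depend on the decomposition: with p and q the positive and negative parts of
    f one has p + b = q + a, and nonnegative sums are additive. Linearity and exchange of signed
    sums all rest on this. *)
Lemma zsum_sub f a b A B : (forall n, f n = a n - b n) ->
  (forall n, 0 <= a n) -> (forall n, 0 <= b n) ->
  sum_le a A -> sum_le b B -> zsum f = nsum a - nsum b.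
Proof.
move=> fab a0 b0 aA bB; rewrite /zsum -/(nnsum _) -/(nnsum _).
pose p n := Num.max (f n) 0; pose q n := Num.max (- f n) 0.
rewrite -/p -/q -/(nsum p) -/(nsum q).
have p0 n : 0 <= p n by rewrite le_max lexx orbT.
have q0 n : 0 <= q n by rewrite le_max lexx orbT.
have pA : sum_le p A.
  by apply: (sum_leW _ (lexx _) aA) => n; rewrite /p fab ge_max a0 lerBlDr lerDl b0.
have qB : sum_le q B.
  apply: (sum_leW _ (lexx _) bB) => n.
  by rewrite /q fab opprB ge_max b0 lerBlDr lerDl a0.
have := nsumD p0 b0 pA bB; have := nsumD q0 a0 qB aA.
have -> : (fun n => p n + b n) = (fun n => q n + a n).
  by apply/funext => n; rewrite /p /q fab; case: (lerP (a n) (b n)) => h;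
    case: (lerP (- (a n - b n)) 0) => h1; case: (lerP (a n - b n) 0) => h2; lra.
by move=> -> e; lra.
Qed.

Definition posp f n : R := Num.max (f n) 0.
Definition negp f n : R := Num.max (- f n) 0.

Lemma posp_ge0 f n : 0 <= posp f n. Proof. by rewrite le_max lexx orbT. Qed.
Lemma negp_ge0 f n : 0 <= negp f n. Proof. by rewrite le_max lexx orbT. Qed.
Lemma posp_negp f n : f n = posp f n - negp f n.
Proof. by rewrite /posp /negp; case: lerP => h1; case: lerP => h2; lra. Qed.
Lemma normr_posneg f n : `|f n| = posp f n + negp f n.
Proof.
rewrite /posp /negp; have [h|h] := lerP (f n) 0.
  by rewrite max_l ?oppr_ge0// add0r ler0_norm.
by rewrite max_r ?oppr_le0 ?ltW// addr0 gtr0_norm.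
Qed.

Lemma sum_le_posp f B : sum_le (fun n => `|f n|) B -> sum_le (posp f) B.
Proof. by apply: sum_leW => // n; rewrite normr_posneg lerDl negp_ge0. Qed.
Lemma sum_le_negp f B : sum_le (fun n => `|f n|) B -> sum_le (negp f) B.
Proof. by apply: sum_leW => // n; rewrite normr_posneg lerDr posp_ge0. Qed.

Lemma zsumE f : zsum f = nsum (posp f) - nsum (negp f).
Proof. by []. Qed.

Lemma zsumD f g A B :
  sum_le (fun n => `|f n|) A -> sum_le (fun n => `|g n|) B ->
  zsum (fun n => f n + g n) = zsum f + zsum g.
Proof.
move=> fA gB; rewrite (zsum_sub (a := fun n => posp f n + posp g n)
  (b := fun n => negp f n + negp g n) (A := A + B) (B := A + B)).
- rewrite (nsumD _ _ (sum_le_posp fA) (sum_le_posp gB));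
    try by move=> n; exact: posp_ge0.
  rewrite (nsumD _ _ (sum_le_negp fA) (sum_le_negp gB));
    try by move=> n; exact: negp_ge0.
  by rewrite !zsumE; lra.
- by move=> n; rewrite {1}(posp_negp f) {1}(posp_negp g); lra.
- by move=> n; rewrite addr_ge0 ?posp_ge0.
- by move=> n; rewrite addr_ge0 ?negp_ge0.
- exact: sum_leD (sum_le_posp fA) (sum_le_posp gB).
- exact: sum_leD (sum_le_negp fA) (sum_le_negp gB).
Qed.

Lemma zsumZ f c B : sum_le (fun n => `|f n|) B ->
  zsum (fun n => c * f n) = c * zsum f.
Proof.
move=> fB.
have [c0|c0] := lerP 0 c.
  rewrite (zsum_sub (a := fun n => c * posp f n) (b := fun n => c * negp f n)
    (A := c * B) (B := c * B)).
  - rewrite (nsumZ c0 _ (sum_le_posp fB)); last by move=> n; exact: posp_ge0.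
    rewrite (nsumZ c0 _ (sum_le_negp fB)); last by move=> n; exact: negp_ge0.
    by rewrite -mulrBr.
  - by move=> n; rewrite {1}(posp_negp f) mulrBr.
  - by move=> n; rewrite mulr_ge0 ?posp_ge0.
  - by move=> n; rewrite mulr_ge0 ?negp_ge0.
  - exact: sum_leZ (sum_le_posp fB).
  - exact: sum_leZ (sum_le_negp fB).
have c0' : 0 <= - c by rewrite oppr_ge0 ltW.
rewrite (zsum_sub (a := fun n => - c * negp f n) (b := fun n => - c * posp f n)
  (A := - c * B) (B := - c * B)).
- rewrite (nsumZ c0' _ (sum_le_posp fB)); last by move=> n; exact: posp_ge0.
  rewrite (nsumZ c0' _ (sum_le_negp fB)); last by move=> n; exact: negp_ge0.
  by rewrite zsumE; ring.
- by move=> n; rewrite {1}(posp_negp f); ring.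
- by move=> n; rewrite mulr_ge0 ?negp_ge0.
- by move=> n; rewrite mulr_ge0 ?posp_ge0.
- exact: sum_leZ (sum_le_negp fB).
- exact: sum_leZ (sum_le_posp fB).
Qed.

Lemma nsum_reindex (e : int -> int) f : bijective e ->
  nsum (fun n => f (e n)) = nsum f.
Proof. by move=> be; rewrite /nsum nnsum_reindex. Qed.

Lemma zsum_reindex (e : int -> int) f : bijective e ->
  zsum (fun n => f (e n)) = zsum f.
Proof.
move=> be; rewrite !zsumE.
by rewrite -(nsum_reindex (posp f) be) -(nsum_reindex (negp f) be).
Qed.

Lemma normr_zsum f B : sum_le (fun n => `|f n|) B -> `|zsum f| <= nsum (fun n => `|f n|).
Proof.
move=> fB; rewrite zsumE.
have -> : (fun n => `|f n|) = (fun n => posp f n + negp f n).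
  by apply/funext => n; rewrite normr_posneg.
rewrite (nsumD _ _ (sum_le_posp fB) (sum_le_negp fB));
  [|by move=> n; exact: posp_ge0|by move=> n; exact: negp_ge0].
have p0 := nsum_ge0 (posp_ge0 f); have n0 := nsum_ge0 (negp_ge0 f).
by apply: le_trans (ler_normB _ _) _; rewrite !ger0_norm.
Qed.

Definition dsum_le (F : int -> int -> R) B : Prop :=
  (\esum_(n in setT) nnsum (F n) <= B%:E)%E.

Lemma dsum_le_row F B n : (forall n m, 0 <= F n m) -> dsum_le F B ->
  sum_le (F n) (nsum (F n)).
Proof.
move=> F0 FB; rewrite /sum_le /nsum fineK//; apply: esum_fin_num FB n => n.
exact: nnsum_ge0.
Qed.

Lemma dsum_le_nsum F B : (forall n m, 0 <= F n m) -> dsum_le F B ->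
  nnsum (fun n => nsum (F n)) = (\esum_(n in setT) nnsum (F n))%E.
Proof.
move=> F0 FB; apply: eq_esum => n _.
by rewrite -(nnsumE _ (dsum_le_row n F0 FB)).
Qed.

Lemma dsum_le_sum F B : (forall n m, 0 <= F n m) -> dsum_le F B ->
  sum_le (fun n => nsum (F n)) B.
Proof. by move=> F0 FB; rewrite /sum_le (dsum_le_nsum F0 FB). Qed.

Lemma dsum_leW F G B : (forall n m, F n m <= G n m) -> dsum_le G B ->
  dsum_le F B.
Proof.
move=> FG; apply: le_trans; apply: le_esum => n _; exact: le_nnsum.
Qed.

Lemma dsum_le_flip F B : (forall n m, 0 <= F n m) -> dsum_le F B ->
  dsum_le (fun m n => F n m) B.
Proof. by move=> F0; rewrite /dsum_le nnsum_exchange. Qed.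

Lemma nsum_exchange F B : (forall n m, 0 <= F n m) -> dsum_le F B ->
  nsum (fun n => nsum (F n)) = nsum (fun m => nsum (F^~ m)).
Proof.
move=> F0 FB; rewrite /nsum (dsum_le_nsum F0 FB).
have F0' m n : 0 <= F^~ m n by [].
by rewrite (dsum_le_nsum F0' (dsum_le_flip F0 FB)) nnsum_exchange.
Qed.

(** Fubini: Tonelli is applied to the positive and the negative parts, and [zsum_sub] recombines
    them in both orders. *)
Lemma zsum_exchange (F : int -> int -> R) B :
  dsum_le (fun n m => `|F n m|) B ->
  zsum (fun n => zsum (F n)) = zsum (fun m => zsum (F^~ m)).
Proof.
move=> FB.
pose P n m := posp (F n) m; pose Q n m := negp (F n) m.
have P0 n m : 0 <= P n m by exact: posp_ge0.
have Q0 n m : 0 <= Q n m by exact: negp_ge0.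
have PB : dsum_le P B.
  by apply: dsum_leW FB => n m; rewrite normr_posneg lerDl negp_ge0.
have QB : dsum_le Q B.
  by apply: dsum_leW FB => n m; rewrite normr_posneg lerDr posp_ge0.
have P0' n m : 0 <= P^~ n m by []. have Q0' n m : 0 <= Q^~ n m by [].
rewrite (zsum_sub (f := fun n => zsum (F n)) (a := fun n => nsum (P n))
  (b := fun n => nsum (Q n)) (A := B) (B := B))//.
- rewrite (zsum_sub (f := fun m => zsum (F^~ m)) (a := fun m => nsum (P^~ m))
    (b := fun m => nsum (Q^~ m)) (A := B) (B := B))//.
  + by rewrite (nsum_exchange P0 PB) (nsum_exchange Q0 QB).
  + by move=> m; rewrite nsum_ge0.
  + by move=> m; rewrite nsum_ge0.
  + exact: dsum_le_sum (dsum_le_flip P0 PB).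
  + exact: dsum_le_sum (dsum_le_flip Q0 QB).
- by move=> m; rewrite nsum_ge0.
- by move=> m; rewrite nsum_ge0.
- exact: dsum_le_sum PB.
- exact: dsum_le_sum QB.
Qed.

Lemma nsum_finite a (s : seq int) : uniq s -> (forall n, 0 <= a n) ->
  (forall n, n \notin s -> a n = 0) -> nsum a = \sum_(n <- s) a n.
Proof.
move=> us a0 as0; apply: EFin_inj.
transitivity (\esum_(n in [set` s]) (a n)%:E)%E; last first.
  rewrite -[[set` s]]set_mem_set esum_fset; first by rewrite set_mem_set -fsbig_seq// sumEFin.
    by rewrite set_mem_set; exact: finite_seq.
  by move=> i _; rewrite lee_fin.
have -> : (\esum_(n in [set` s]) (a n)%:E)%E = nnsum a.
  rewrite esum_mkcond; apply: eq_esum => n _.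
  case: ifPn => //; rewrite notin_setE/= => /negP ns.
  by rewrite as0.
rewrite -(nnsumE a0 (B := \sum_(n <- s) a n))//.
apply/sum_leP => s' us'.
rewrite (bigID (fun n => n \in s))/= [X in _ + X]big1 ?addr0; last first.
  by move=> n /as0.
rewrite -big_filter [leRHS](bigID (fun n => n \in s'))/=.
rewrite -[X in _ <= X + _]big_filter.
rewrite (perm_big [seq n <- s | n \in s']) ?lerDl ?sumr_ge0//.
apply: uniq_perm; rewrite ?filter_uniq// => n.
by rewrite !mem_filter andbC.
Qed.

Lemma zsum_finite f (s : seq int) : uniq s -> 
  (forall n, n \notin s -> f n = 0) -> zsum f = \sum_(n <- s) f n.
Proof.
move=> us fs; rewrite zsumE (nsum_finite us (posp_ge0 f)); last first.
  by move=> n /fs fn; rewrite /posp fn maxxx.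
rewrite (nsum_finite us (negp_ge0 f)); last first.
  by move=> n /fs fn; rewrite /negp fn oppr0 maxxx.
by rewrite -sumrB; apply: eq_bigr => n _; rewrite -posp_negp.
Qed.

End SignedSums.

(** * Complex sums *)

Section ComplexSums.
Variable R : realType.
Implicit Types (z w : R[i]) (F G : int -> R[i]) (A B : R).

(* The l^1 norm of R^2 instead of the modulus: it is submultiplicative as well,
   and bounding the real and imaginary parts of a sum separately loses nothing. *)
Definition cabs z : R := `|complex.Re z| + `|complex.Im z|.

Lemma cabs_ge0 z : 0 <= cabs z.
Proof. by rewrite addr_ge0. Qed.

Lemma cabs0 : cabs 0 = 0.
Proof. by rewrite /cabs !normr0 addr0. Qed.

Lemma cabsD z w : cabs (z + w) <= cabs z + cabs w.
Proof.
case: z w => [a b] [c d]; rewrite /cabs/= addrACA.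
by rewrite lerD ?ler_normD.
Qed.

Lemma cabsN z : cabs (- z) = cabs z.
Proof. by case: z => a b; rewrite /cabs/= !normrN. Qed.

Lemma cabsB z w : cabs (z - w) <= cabs z + cabs w.
Proof. by rewrite -[cabs w]cabsN cabsD. Qed.

Lemma cabsM z w : cabs (z * w) <= cabs z * cabs w.
Proof.
case: z w => [a b] [c d]; rewrite /cabs/=.
apply: le_trans (lerD (ler_normB _ _) (ler_normD _ _)) _.
by rewrite !normrM le_eqVlt; apply/orP; left; apply/eqP; ring.
Qed.

Lemma cabs_conj z : cabs z^* = cabs z.
Proof. by case: z => a b; rewrite /cabs/= normrN. Qed.

Lemma cabsZ (c : R) z : cabs (c%:C * z) = `|c| * cabs z.
Proof.
by case: z => a b; rewrite /cabs/= !mul0r oppr0 !addr0 !normrM mulrDr.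
Qed.

Lemma cabs_real (c : R) : cabs c%:C = `|c|.
Proof. by rewrite /cabs/= normr0 addr0. Qed.

Lemma cabs_iM z : cabs ('i%C * z) = cabs z.
Proof.
by case: z => a b; rewrite /cabs/= !mul0r !mul1r !add0r normrN addrC.
Qed.

Lemma sqmod_le_cabs z : sqmod z <= cabs z ^+ 2.
Proof.
rewrite /sqmod /cabs sqrrD !real_normK ?num_real//.
by rewrite lerD2r lerDl mulrn_wge0// mulr_ge0.
Qed.

Lemma cabs_le_sqmod z : cabs z ^+ 2 <= 2 * sqmod z.
Proof.
rewrite /sqmod -[complex.Re z ^+ 2]real_normK ?num_real//.
rewrite -[complex.Im z ^+ 2]real_normK ?num_real// /cabs.
have := sqr_ge0 (`|complex.Re z| - `|complex.Im z|).
by rewrite sqrrB sqrrD => h; lra.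
Qed.

Lemma sqmod_ge0 z : 0 <= sqmod z.
Proof. by rewrite addr_ge0 ?sqr_ge0. Qed.

Definition csum_le F B := sum_le (fun n => cabs (F n)) B.

Lemma csum_le_Re F B : csum_le F B -> sum_le (fun n => `|complex.Re (F n)|) B.
Proof. by apply: sum_leW => // n; rewrite lerDl. Qed.

Lemma csum_le_Im F B : csum_le F B -> sum_le (fun n => `|complex.Im (F n)|) B.
Proof. by apply: sum_leW => // n; rewrite lerDr. Qed.

Lemma czsumD F G A B : csum_le F A -> csum_le G B ->
  czsum (fun n => F n + G n) = czsum F + czsum G.
Proof.
move=> FA GB; rewrite /czsum.
rewrite -[RHS]/(_ +i* _); congr (_ +i* _).
  rewrite -(zsumD (csum_le_Re FA) (csum_le_Re GB)); congr zsum.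
  by apply/funext => n; case: (F n) (G n) => [a b] [c d].
rewrite -(zsumD (csum_le_Im FA) (csum_le_Im GB)); congr zsum.
by apply/funext => n; case: (F n) (G n) => [a b] [c d].
Qed.

Lemma czsumZ F c B : csum_le F B -> czsum (fun n => c * F n) = c * czsum F.
Proof.
move=> FB; case: c => a b.
have rb := csum_le_Re FB; have ib := csum_le_Im FB.
have Zb c f : sum_le (fun n => `|f n|) B -> sum_le (fun n => `|c * f n|) (`|c| * B).
  by move=> fB; apply: (sum_leW _ (lexx _) (sum_leZ (normr_ge0 c) fB)) => n;
    rewrite normrM.
rewrite /czsum -[RHS]/(_ +i* _); congr (_ +i* _).
  transitivity (zsum (fun n => a * complex.Re (F n) + - b * complex.Im (F n))).
    by congr zsum; apply/funext => n; case: (F n) => [c d]/=; rewrite mulNr.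
  by rewrite (zsumD (Zb _ _ rb) (Zb _ _ ib)) (zsumZ _ rb) (zsumZ _ ib) mulNr.
transitivity (zsum (fun n => a * complex.Im (F n) + b * complex.Re (F n))).
  by congr zsum; apply/funext => n; case: (F n) => [c d].
by rewrite (zsumD (Zb _ _ ib) (Zb _ _ rb)) (zsumZ _ rb) (zsumZ _ ib).
Qed.

Lemma czsum_reindex (e : int -> int) F : bijective e ->
  czsum (fun n => F (e n)) = czsum F.
Proof.
move=> be; rewrite /czsum.
by rewrite (zsum_reindex (fun n => complex.Re (F n)) be)
  (zsum_reindex (fun n => complex.Im (F n)) be).
Qed.

Lemma czsum_exchange (F : int -> int -> R[i]) B :
  dsum_le (fun n m => cabs (F n m)) B ->
  czsum (fun n => czsum (F n)) = czsum (fun m => czsum (F^~ m)).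
Proof.
move=> FB; rewrite /czsum/=.
rewrite (zsum_exchange (F := fun n m => complex.Re (F n m)) (B := B)); last first.
  by apply: dsum_leW FB => n m; rewrite lerDl.
rewrite (zsum_exchange (F := fun n m => complex.Im (F n m)) (B := B))//.
by apply: dsum_leW FB => n m; rewrite lerDr.
Qed.

(** The triangle inequality; when the right-hand side diverges it is +oo and the claim is trivial.
    As [cabs] adds the real and imaginary parts, the constant is 1. *)
Lemma cabs_czsum F : ((cabs (czsum F))%:E <= nnsum (fun n => cabs (F n)))%E.
Proof.
have c0 n : 0 <= cabs (F n) by exact: cabs_ge0.
have [fin|] := boolP (nnsum (fun n => cabs (F n)) \is a fin_num); last first.
  by rewrite ge0_fin_numE ?nnsum_ge0// -leNgt leye_eq => /eqP ->; rewrite leey.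
have FB : csum_le F (nsum (fun n => cabs (F n))) by rewrite /csum_le /sum_le fineK.
rewrite (nnsumE c0 FB) lee_fin {2}/cabs.
rewrite (nsumD _ _ (csum_le_Re FB) (csum_le_Im FB))//.
by rewrite lerD// (normr_zsum (csum_le_Re FB), normr_zsum (csum_le_Im FB)).
Qed.

Lemma czsum_finite F (s : seq int) : uniq s -> 
  (forall n, n \notin s -> F n = 0) -> czsum F = \sum_(n <- s) F n.
Proof.
move=> us Fs; rewrite /czsum (zsum_finite us); last by move=> n /Fs ->.
rewrite (zsum_finite us); last by move=> n /Fs ->.
elim: s {us Fs} => [|n s IH]; first by rewrite !big_nil.
by rewrite !big_cons -IH; case: (F n).
Qed.

End ComplexSums.

(** * Sobolev weights and convolution operators *)

Section Weights.
Variable R : realType.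
Implicit Types (n m : int) (k : int).

Definition br n : R := 1 + `|n%:~R : R|.
Definition rt n : R := Num.sqrt `|n%:~R : R|.
(* [hw k n] is (1 + |n|)^(k/2): only integral powers of one square root occur. *)
Definition jw n : R := Num.sqrt (br n).
Definition hw k n : R := jw n ^ k.

Lemma br_ge1 n : 1 <= br n. Proof. by rewrite lerDl. Qed.
Lemma br_gt0 n : 0 < br n. Proof. by rewrite (lt_le_trans _ (br_ge1 n)). Qed.
Lemma br_ge0 n : 0 <= br n. Proof. exact/ltW/br_gt0. Qed.
Lemma jw_ge1 n : 1 <= jw n.
Proof. by rewrite -sqrtr1 ler_sqrt ?br_ge1// ltW ?br_gt0. Qed.
Lemma jw_gt0 n : 0 < jw n. Proof. by rewrite (lt_le_trans _ (jw_ge1 n)). Qed.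
Lemma jw_ge0 n : 0 <= jw n. Proof. exact/ltW/jw_gt0. Qed.
Lemma jw_sqr n : jw n ^+ 2 = br n. Proof. by rewrite sqr_sqrtr// br_ge0. Qed.
Lemma rt_ge0 n : 0 <= rt n. Proof. exact: sqrtr_ge0. Qed.
Lemma rt_sqr n : rt n ^+ 2 = `|n%:~R|. Proof. by rewrite sqr_sqrtr. Qed.
Lemma rt_le_jw n : rt n <= jw n.
Proof. by rewrite ler_sqrt ?br_ge0// lerDr. Qed.
Lemma jw_le_rt n : jw n <= 1 + rt n.
Proof.
have h : 0 <= 1 + rt n by rewrite addr_ge0 ?rt_ge0.
rewrite -ler_sqr ?nnegrE ?jw_ge0// jw_sqr sqrrD expr1n mul1r rt_sqr /br.
by rewrite lerD2r lerDl mulrn_wge0// rt_ge0.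
Qed.
Lemma hw_gt0 k n : 0 < hw k n. Proof. by rewrite exprz_gt0 ?jw_gt0. Qed.
Lemma hw_ge0 k n : 0 <= hw k n. Proof. exact/ltW/hw_gt0. Qed.
Lemma hw0 n : hw 0 n = 1. Proof. by rewrite /hw expr0z. Qed.
Lemma hw2 n : hw 2 n = br n. Proof. by rewrite -jw_sqr /hw -exprnP. Qed.
Lemma hwD k k' n : hw (k + k') n = hw k n * hw k' n.
Proof. by rewrite /hw expfzDr// gt_eqF ?jw_gt0. Qed.
Lemma hw1 n : hw 1 n = jw n. Proof. by rewrite /hw expr1z. Qed.

Lemma hw_mono k k' n : k <= k' -> hw k n <= hw k' n.
Proof.
move=> kk; rewrite -(subrK k k') hwD ler_peMl ?hw_ge0//.
have : 0 <= k' - k by rewrite subr_ge0.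
case: (k' - k) => // p _; rewrite /hw -exprnP exprn_ege1 ?jw_ge1//.
Qed.

(** Peetre's inequality, from 1 + a + b <= (1 + a)(1 + b). *)
Lemma br_sub n m : br n <= br (n - m) * br m.
Proof.
rewrite /br; set l := n - m.
have -> : n = l + m by rewrite subrK.
have h := ler_normD (l%:~R : R) m%:~R.
rewrite -rmorphD/= in h.
have h2 : 0 <= `|l%:~R : R| * `|m%:~R : R| by [].
by lra.
Qed.

Lemma br_opp n : br (- n) = br n.
Proof. by rewrite /br rmorphN/= normrN. Qed.

Lemma jw_sub n m : jw n <= jw (n - m) * jw m.
Proof.
rewrite -sqrtrM ?br_ge0// ler_sqrt; first exact: br_sub.
by rewrite mulr_ge0 ?br_ge0.
Qed.

Lemma jw_sub' n m : jw m <= jw (n - m) * jw n.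
Proof. by have := jw_sub m n; rewrite {2}/jw -opprB br_opp. Qed.

Lemma hw_sub_nat (p : nat) n m : hw p n <= jw (n - m) ^+ p * hw p m.
Proof.
by rewrite /hw -!exprnP -exprMn lerXn2r ?nnegrE ?mulr_ge0 ?jw_ge0 ?jw_sub.
Qed.

(** Peetre's inequality at half-integral orders of either sign. For a negative order the weights are
    inverted, which exchanges the roles of n and m. *)
Lemma hw_sub k (p : nat) n m : `|k| <= p%:Z -> hw k n <= jw (n - m) ^+ p * hw k m.
Proof.
move=> kp; have h (q : nat) : (q <= p)%N -> jw (n - m) ^+ q <= jw (n - m) ^+ p.
  by move=> qp; rewrite ler_weXn2l ?jw_ge1.
case: k kp => q kp.
  have qp : (q <= p)%N by move: kp; lia.
  apply: le_trans (hw_sub_nat _ _ m) _; rewrite ler_wpM2r ?hw_ge0// h//.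
have qp : (q.+1 <= p)%N by move: kp; lia.
have -> : hw (Negz q) n = (jw n ^+ q.+1)^-1 by [].
have -> : hw (Negz q) m = (jw m ^+ q.+1)^-1 by [].
rewrite ler_pdivlMr ?exprn_gt0 ?jw_gt0// mulrC ler_pdivrMr ?exprn_gt0 ?jw_gt0//.
apply: le_trans (_ : (jw (n - m) * jw n) ^+ q.+1 <= _).
  by rewrite lerXn2r ?nnegrE ?mulr_ge0 ?jw_ge0 ?jw_sub'.
by rewrite exprMn ler_wpM2r ?exprn_ge0 ?jw_ge0// h.
Qed.

Lemma hw_sub4 k n m : `|k| <= 4 -> hw k n <= br (n - m) ^+ 2 * hw k m.
Proof.
by move=> /hw_sub h; rewrite -jw_sqr -exprM; exact: h.
Qed.

Lemma hw_sub2 k n m : `|k| <= 2 -> hw k n <= br (n - m) * hw k m.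
Proof. by move=> /hw_sub h; rewrite -jw_sqr; exact: h. Qed.

(** A fact about integers. It allows the natural bound |n - m|^(1/2) for a difference of square
    roots to be replaced by |n - m|. *)
Lemma normz_intr_sqr (l : int) : `|l%:~R : R| <= `|l%:~R| ^+ 2.
Proof.
rewrite -intr_norm -rmorphXn/= ler_int.
case: (`|l|) (normr_ge0 l) => // p _; nia.
Qed.

Lemma rt_sub n m : `|rt n - rt m| <= `|(n - m)%:~R|.
Proof.
rewrite -ler_sqr ?nnegrE//.
apply: le_trans (normz_intr_sqr _).
rewrite expr2.
apply: (@le_trans _ _ (`|rt n - rt m| * (rt n + rt m))).
  rewrite ler_wpM2l// (le_trans (ler_normB _ _))//.
  by rewrite !ger0_norm ?rt_ge0.
rewrite -[X in _ * X]ger0_norm ?addr_ge0 ?rt_ge0// -normrM -subr_sqr !rt_sqr.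
by rewrite rmorphB/= ler_dist_dist.
Qed.

(** The product of rt n - rt m with rt n + rt m is |n| - |m|, and [jw m] is at most 1 plus that sum
    of roots. This is the half derivative gained by commuting with |D|^(1/2). *)
Lemma rt_sub_jw n m : `|rt n - rt m| * jw m <= 2 * `|(n - m)%:~R|.
Proof.
apply: (@le_trans _ _ (`|rt n - rt m| * (1 + (rt n + rt m)))).
  rewrite ler_wpM2l// (le_trans (jw_le_rt _))// lerD2l lerDr rt_ge0//.
rewrite mulrDr mulr1 mulr_natl mulr2n lerD ?rt_sub//.
rewrite -[X in _ * X]ger0_norm ?addr_ge0 ?rt_ge0// -normrM -subr_sqr !rt_sqr.
by rewrite rmorphB/= ler_dist_dist.
Qed.

Lemma norm_le_br n : `|n%:~R : R| <= br n.
Proof. by rewrite lerDr. Qed.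

(* [rt_sub_jw] gains half a derivative at [m], and by symmetry at [n]; the
   latter is used as soon as a weight at [n] is available. *)
Lemma hw_rt_sub (p : nat) n m : (p <= 3)%N ->
  hw p n * (`|rt n - rt m| * `|m%:~R|) <= 2 * br (n - m) ^+ 2 * hw (p%:Z + 1) m.
Proof.
move=> p3; have l0 := norm_le_br (n - m).
have b1 := br_ge1 (n - m); have m0 := norm_le_br m.
case: p p3 => [|p] p3.
  rewrite hw0 mul1r add0r hw1.
  apply: (@le_trans _ _ (`|rt n - rt m| * (jw m * jw m))).
    by rewrite ler_wpM2l// -expr2 jw_sqr.
  rewrite mulrA ler_wpM2r ?jw_ge0//.
  apply: le_trans (rt_sub_jw _ _) _; rewrite ler_wpM2l//.
  by rewrite (le_trans l0)// expr2 ler_peMl// br_ge0.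
have -> : p.+1%:Z + 1 = p%:Z + Posz 2 by lia.
have -> : p.+1%:Z = p%:Z + 1 by lia.
rewrite !hwD hw1 hw2.
rewrite -mulrA [X in _ * X <= _]mulrA.
have -> : 2 * br (n - m) ^+ 2 * (hw p m * br m) =
  (br (n - m) * hw p m) * ((2 * br (n - m)) * br m) by ring.
apply: ler_pM; rewrite ?hw_ge0 ?mulr_ge0 ?jw_ge0//.
  by apply: hw_sub2; lia.
apply: ler_pM; rewrite ?mulr_ge0 ?jw_ge0//.
rewrite distrC mulrC; apply: le_trans (rt_sub_jw _ _) _.
by rewrite ler_wpM2l// -normrN -rmorphN opprB.
Qed.

End Weights.

(** * Operators given by kernels, and ellipticity of Z *)

Section Sobolev.
Variable R : realType.
Implicit Types (n m : int) (k : int) (u w f c : pdist R) (A B : R).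

(* The square of the norm of u in H^(k/2) is at most B. *)
Definition sob k u B := sum_le (fun n => (hw R k n * cabs (u n)) ^+ 2) B.

(** A weighted Wiener algebra. With exponent 2 it multiplies H^(k/2) for |k| <= 4, by Peetre's
    inequality. *)
Definition wl1 (p : nat) c A := sum_le (fun l => br R l ^+ p * cabs (c l)) A.

Lemma sob_ge0 k u B : sob k u B -> 0 <= B.
Proof. by apply: sum_le_ge0 => n; rewrite sqr_ge0. Qed.

Lemma wl1_ge0 p c A : wl1 p c A -> 0 <= A.
Proof.
by apply: sum_le_ge0 => n; rewrite mulr_ge0 ?exprn_ge0 ?br_ge0 ?cabs_ge0.
Qed.

Lemma wl1W p q c A : (p <= q)%N -> wl1 q c A -> wl1 p c A.
Proof.
move=> pq; apply: sum_leW => // n.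
by rewrite ler_wpM2r ?cabs_ge0// ler_weXn2l ?br_ge1.
Qed.

Lemma wl1_csum p c A : wl1 p c A -> csum_le c A.
Proof.
move=> /(wl1W (leq0n p)); apply: sum_leW => // n.
by rewrite expr0 mul1r.
Qed.

Lemma sobW k k' u B B' : k <= k' -> B <= B' -> sob k' u B -> sob k u B'.
Proof.
move=> kk BB; apply: sum_leW => // n.
by rewrite lerXn2r ?nnegrE ?mulr_ge0 ?hw_ge0 ?cabs_ge0// ler_wpM2r ?cabs_ge0// hw_mono.
Qed.

Lemma sob_dom k k' (K : R) u w B : (forall n, hw R k n * cabs (u n) <=
    K * (hw R k' n * cabs (w n))) -> sob k' w B -> sob k u (K ^+ 2 * B).
Proof.
move=> uw wB; apply: (sum_leW _ (lexx _) (sum_leZ (sqr_ge0 K) wB)) => n.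
have u0 : 0 <= hw R k n * cabs (u n) by rewrite mulr_ge0 ?hw_ge0 ?cabs_ge0.
by rewrite -exprMn lerXn2r ?nnegrE// (le_trans u0).
Qed.

Lemma sqrD_le (a b : R) : (a + b) ^+ 2 <= 2 * a ^+ 2 + 2 * b ^+ 2.
Proof. by have := sqr_ge0 (a - b); rewrite sqrrB sqrrD; lra. Qed.

Lemma sob_le2 k u v w A B : (forall n, cabs (w n) <= cabs (u n) + cabs (v n)) ->
  sob k u A -> sob k v B -> sob k w (2 * A + 2 * B).
Proof.
move=> uvw uA vB.
have := sum_leD (sum_leZ (ler0n R 2) uA) (sum_leZ (ler0n R 2) vB).
apply: sum_leW => // n /=; apply: (le_trans _ (sqrD_le _ _)).
rewrite lerXn2r ?nnegrE ?addr_ge0 ?mulr_ge0 ?hw_ge0 ?cabs_ge0//.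
by rewrite -mulrDr ler_wpM2l ?hw_ge0.
Qed.

Lemma sobD k u w A B : sob k u A -> sob k w B -> sob k (padd u w) (2 * A + 2 * B).
Proof. by apply: sob_le2 => n; exact: cabsD. Qed.

Lemma sobB k u w A B : sob k u A -> sob k w B -> sob k (psub u w) (2 * A + 2 * B).
Proof. by apply: sob_le2 => n; exact: cabsB. Qed.

Lemma sobZ k (c : R[i]) u B : sob k u B -> sob k (pscale c u) (cabs c ^+ 2 * B).
Proof.
apply: sob_dom => n; rewrite mulrCA ler_wpM2l ?hw_ge0//; exact: cabsM.
Qed.

Lemma sob_cabs k u B n : sob k u B -> (hw R k n * cabs (u n)) ^+ 2 <= B.
Proof. by move=> /(@sum_le_term _ _ n). Qed.

(* ab <= (a^2 + b^2)/2 with a^2 <= A a. *)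
Lemma conv_summable (a b : int -> R) A B n :
  (forall n, 0 <= a n) -> (forall n, 0 <= b n) ->
  sum_le a A -> sum_le (fun n => b n ^+ 2) B ->
  sum_le (fun m => a (n - m) * b m) (A ^+ 2 + B).
Proof.
move=> a0 b0 aA bB; have A0 := sum_le_ge0 a0 aA.
have aA' : sum_le (fun m => a (n - m)) A.
  by rewrite /sum_le (nnsum_reindex a (bij_subz n)).
have := sum_leD (sum_leZ A0 aA') bB; rewrite -expr2; apply: sum_leW => // m.
have aAm : a (n - m) ^+ 2 <= A * a (n - m).
  by rewrite expr2 ler_wpM2r// (sum_le_term (n - m) aA).
have h1 := sqr_ge0 (a (n - m) - b m); have h2 := sqr_ge0 (b m).
rewrite sqrrB in h1; have h3 : 0 <= a (n - m) * b m by rewrite mulr_ge0.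
by lra.
Qed.

(* The operator with kernel K; it maps H^(p/2) to H^(k/2) when [kdom k p K a]
   holds with a summable a. *)
Definition kop (K : int -> int -> R[i]) u : pdist R :=
  fun n => czsum (fun m => K n m * u m).

Definition kdom k p (K : int -> int -> R[i]) (a : int -> R) :=
  forall n m, hw R k n * cabs (K n m) <= a (n - m) * hw R p m.

Lemma kop_summable k p K a u A B n : (forall l, 0 <= a l) -> sum_le a A ->
  kdom k p K a -> sob p u B -> exists C, csum_le (fun m => K n m * u m) C.
Proof.
move=> a0 aA Ka uB.
have b0 m : 0 <= hw R p m * cabs (u m) by rewrite mulr_ge0 ?hw_ge0 ?cabs_ge0.
have h := conv_summable n a0 b0 aA uB.
have i0 : 0 <= (hw R k n)^-1 by rewrite invr_ge0 hw_ge0.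
exists ((hw R k n)^-1 * (A ^+ 2 + B)).
apply: (sum_leW _ (lexx _) (sum_leZ i0 h)) => m.
apply: le_trans (cabsM _ _) _.
by rewrite ler_pdivlMl ?hw_gt0// !mulrA ler_wpM2r ?cabs_ge0.
Qed.

(** Under [kdom] the weighted moduli of the image are dominated by the convolution of a with those
    of u, and Young's inequality applies. *)
Lemma kop_sob k p K a u A B : (forall l, 0 <= a l) -> sum_le a A ->
  kdom k p K a -> sob p u B -> sob k (kop K u) (A ^+ 2 * B).
Proof.
move=> a0 aA Ka uB.
have b0 m : 0 <= hw R p m * cabs (u m) by rewrite mulr_ge0 ?hw_ge0 ?cabs_ge0.
apply: (young a0 b0 _ aA uB) => n; first by rewrite mulr_ge0 ?hw_ge0 ?cabs_ge0.
have [C h] := kop_summable n a0 aA Ka uB.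
have h' : sum_le (fun m => cabs (K n m) * cabs (u m))
    ((hw R k n)^-1 * (A ^+ 2 + B)).
  have i0 : 0 <= (hw R k n)^-1 by rewrite invr_ge0 hw_ge0.
  apply: (sum_leW _ (lexx _) (sum_leZ i0 (conv_summable n a0 b0 aA uB))) => m.
  by rewrite ler_pdivlMl ?hw_gt0// !mulrA ler_wpM2r ?cabs_ge0.
have c0 m : 0 <= cabs (K n m) * cabs (u m) by rewrite mulr_ge0 ?cabs_ge0.
have le1 : cabs (kop K u n) <= nsum (fun m => cabs (K n m) * cabs (u m)).
  rewrite -lee_fin -(nnsumE c0 h'); apply: le_trans (cabs_czsum _) _.
  by apply: le_nnsum => m; exact: cabsM.
apply: (@le_trans _ _ (hw R k n * nsum (fun m => cabs (K n m) * cabs (u m)))%:E).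
  by rewrite lee_fin ler_wpM2l ?hw_ge0.
rewrite -(nsumZ _ c0 h') ?hw_ge0//.
rewrite -(nnsumE (B := hw R k n * ((hw R k n)^-1 * (A ^+ 2 + B)))); last 2 first.
- by move=> m; rewrite mulr_ge0// hw_ge0.
- by apply: sum_leZ => //; rewrite hw_ge0.
apply: le_nnsum => m.
by rewrite !mulrA ler_wpM2r ?cabs_ge0.
Qed.

Lemma kdom_wl1 k c : `|k| <= 4 ->
  kdom k k (fun n m => c (n - m)) (fun l => br R l ^+ 2 * cabs (c l)).
Proof.
move=> k4 n m; rewrite mulrAC ler_wpM2r ?cabs_ge0//; exact: hw_sub4.
Qed.

Lemma wl1_pmul_summable k p c u A B n : `|k| <= 4 -> (1 < p)%N ->
  wl1 p c A -> sob k u B -> exists C, csum_le (fun m => c (n - m) * u m) C.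
Proof.
move=> k4 p1 /(wl1W p1) cA; apply: (kop_summable n _ cA (kdom_wl1 c k4)) => l.
by rewrite mulr_ge0 ?exprn_ge0 ?br_ge0 ?cabs_ge0.
Qed.

Lemma sob_pmul k p c u A B : `|k| <= 4 -> (1 < p)%N -> wl1 p c A -> sob k u B ->
  sob k (pmul c u) (A ^+ 2 * B).
Proof.
move=> k4 p1 /(wl1W p1) cA; apply: (kop_sob _ cA (kdom_wl1 c k4)) => l.
by rewrite mulr_ge0 ?exprn_ge0 ?br_ge0 ?cabs_ge0.
Qed.

(** At order 0 no weight has to be moved from n to m, so plain summability of c suffices. It will be
    applied to the derivative of w, whose weight exponent has dropped to 1. *)
Lemma sob_pmul0 c u A B : csum_le c A -> sob 0 u B ->
  sob 0 (pmul c u) (A ^+ 2 * B).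
Proof.
move=> cA; apply: (kop_sob (a := fun l => cabs (c l)) _ cA) => [l|n m].
  exact: cabs_ge0.
by rewrite !hw0 mul1r mulr1.
Qed.

Lemma absD_half u n : absD 2^-1 u n = (rt R n)%:C * u n.
Proof. by rewrite /absD /fmultiplier powR12_sqrt. Qed.

Lemma sob_absD k u B : sob k u B -> sob (k - 1) (absD 2^-1 u) B.
Proof.
move=> uB; rewrite -[B]mul1r -[X in X * _](expr1n _ 2).
apply: sob_dom uB => n; rewrite absD_half cabsZ ger0_norm ?rt_ge0// mul1r.
rewrite mulrA ler_wpM2r ?cabs_ge0//.
rewrite -{2}(subrK 1 k) [in leRHS]hwD hw1 ler_wpM2l ?hw_ge0 ?rt_le_jw//.
Qed.

Lemma sob_Dx k u B : sob k u B -> sob (k - 2) (Dx u) B.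
Proof.
move=> uB; rewrite -[B]mul1r -[X in X * _](expr1n _ 2).
apply: sob_dom uB => n; rewrite mul1r /Dx /fmultiplier -mulrA cabs_iM cabsZ.
rewrite mulrA ler_wpM2r ?cabs_ge0//.
by rewrite -{2}(subrK 2 k) [in leRHS]hwD hw2 ler_wpM2l ?hw_ge0 ?norm_le_br.
Qed.

(* The operator Z, with c the Fourier coefficients of chi. *)
Definition Zc c u : pdist R := padd (pscale 'i%C (absD 2^-1 u)) (pmul c u).

Lemma sob_Z k c u A B : `|k - 1| <= 4 -> wl1 2 c A -> sob k u B ->
  sob (k - 1) (Zc c u) (2 * B + 2 * (A ^+ 2 * B)).
Proof.
move=> k4 cA uB; apply: sobD.
  have := sobZ 'i%C (sob_absD uB).
  by rewrite /cabs/= normr0 normr1 add0r expr1n mul1r.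
apply: (sob_pmul k4 _ cA) => //; apply: (sobW _ (lexx _) uB).
by rewrite gerBl.
Qed.

(** The half derivative is recovered, up to the factor i, as Z u - chi u. Since [br n] equals 1 + rt
    n ^+ 2, the squared norm at order k + 1 is exactly the sum of those of u and |D|^(1/2) u at
    order k. *)
Lemma elliptic k c u A A0 B0 : `|k| <= 4 -> wl1 2 c A ->
  sob k u A0 -> sob k (Zc c u) B0 ->
  sob (k + 1) u (A0 + (2 * B0 + 2 * (A ^+ 2 * A0))).
Proof.
move=> k4 cA uA ZB.
have h : sob k (fun n => (rt R n)%:C * u n) (2 * B0 + 2 * (A ^+ 2 * A0)).
  apply: (sob_le2 _ ZB (sob_pmul k4 _ cA uA)) => // n.
  have e : Zc c u n = 'i%C * ((rt R n)%:C * u n) + pmul c u n.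
    by rewrite /Zc /padd /pscale absD_half.
  rewrite -[cabs (_ * _)]cabs_iM.
  by rewrite -[X in cabs X <= _](addrK (pmul c u n)) -e cabsB.
have := sum_leD uA h; apply: sum_leW => // n.
rewrite hwD hw1 cabsZ ger0_norm ?rt_ge0// !exprMn jw_sqr rt_sqr /br.
by rewrite le_eqVlt; apply/orP; left; apply/eqP; ring.
Qed.

End Sobolev.

(** * The commutator of Z and the transport operator *)

Section Commutator.
Variable R : realType.
Implicit Types (n m : int) (k : int) (u w f g c : pdist R) (A B : R).

Lemma czsum_lin (F G : int -> R[i]) (a b : R[i]) A B :
  csum_le F A -> csum_le G B ->
  czsum (fun n => a * F n + b * G n) = a * czsum F + b * czsum G.
Proof.
have Zb (x : R[i]) H C : csum_le H C -> csum_le (fun n => x * H n) (cabs x * C).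
  move=> HC; apply: (sum_leW _ (lexx _) (sum_leZ (cabs_ge0 x) HC)) => n.
  exact: cabsM.
move=> FA GB; rewrite (czsumD (Zb a _ _ FA) (Zb b _ _ GB)).
by rewrite (czsumZ a FA) (czsumZ b GB).
Qed.

Lemma pmul_linr k p c u w (a b : R[i]) A A1 A2 : `|k| <= 4 -> (1 < p)%N ->
  wl1 p c A -> sob k u A1 -> sob k w A2 ->
  pmul c (fun m => a * u m + b * w m) = fun n => a * pmul c u n + b * pmul c w n.
Proof.
move=> k4 p1 cA u1 w2; apply/funext => n.
have [C1 h1] := wl1_pmul_summable n k4 p1 cA u1.
have [C2 h2] := wl1_pmul_summable n k4 p1 cA w2.
rewrite /pmul -(czsum_lin a b h1 h2); congr czsum; apply/funext => m; ring.
Qed.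

Lemma pmul_linl k p c d u (a b : R[i]) A1 A2 B : `|k| <= 4 -> (1 < p)%N ->
  wl1 p c A1 -> wl1 p d A2 -> sob k u B ->
  pmul (fun m => a * c m + b * d m) u = fun n => a * pmul c u n + b * pmul d u n.
Proof.
move=> k4 p1 cA dA uB; apply/funext => n.
have [C1 h1] := wl1_pmul_summable n k4 p1 cA uB.
have [C2 h2] := wl1_pmul_summable n k4 p1 dA uB.
rewrite /pmul -(czsum_lin a b h1 h2); congr czsum; apply/funext => m; ring.
Qed.

Lemma Zc_lin k c u w (a b : R[i]) A A1 A2 : `|k| <= 4 ->
  wl1 2 c A -> sob k u A1 -> sob k w A2 ->
  Zc c (fun m => a * u m + b * w m) = fun n => a * Zc c u n + b * Zc c w n.
Proof.
move=> k4 cA u1 w2; apply/funext => n.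
rewrite /Zc /padd /pscale (pmul_linr a b k4 _ cA u1 w2)// !absD_half; ring.
Qed.

Lemma Zc_sub k c u w A A1 A2 : `|k| <= 4 ->
  wl1 2 c A -> sob k u A1 -> sob k w A2 ->
  Zc c (psub u w) = psub (Zc c u) (Zc c w).
Proof.
move=> k4 cA u1 w2; have := Zc_lin 1 (-1) k4 cA u1 w2.
have -> : (fun m => 1 * u m + -1 * w m) = psub u w.
  by apply/funext => m; rewrite mul1r mulN1r.
by move=> ->; apply/funext => m; rewrite mul1r mulN1r.
Qed.

Definition pabs u : pdist R := fun n => (cabs (u n))%:C.

Lemma cabs_pabs u n : cabs (pabs u n) = cabs (u n).
Proof. by rewrite cabs_real ger0_norm ?cabs_ge0. Qed.

Lemma sob_pabs k u B : sob k u B -> sob k (pabs u) B.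
Proof. by apply: sum_leW => // n; rewrite cabs_pabs. Qed.

Lemma wl1_pabs p c A : wl1 p c A -> wl1 p (pabs c) A.
Proof. by apply: sum_leW => // n; rewrite cabs_pabs. Qed.

Lemma czsum_real (f : int -> R) B : (forall n, 0 <= f n) -> sum_le f B ->
  czsum (fun n => (f n)%:C) = (nsum f)%:C.
Proof.
move=> f0 fB; rewrite /czsum/= -[RHS]/(_ +i* _); congr (_ +i* _).
  rewrite (zsum_sub (a := f) (b := fun=> 0) (A := B) (B := 0))//.
  - by rewrite (nsum_finite (a := fun=> 0) (s := [::]))// big_nil subr0.
  - by move=> n; rewrite subr0.
  - by apply/sum_leP => s _; rewrite big1.
by rewrite (zsum_finite (s := [::]))// big_nil.
Qed.

Lemma pmul_pabs k p c u A B n : `|k| <= 4 -> (1 < p)%N ->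
  wl1 p c A -> sob k u B ->
  exists2 h, pmul (pabs c) (pabs u) n = h%:C &
    sum_le (fun m => cabs (c (n - m)) * cabs (u m)) h.
Proof.
move=> k4 p1 cA uB.
have [C hC] := wl1_pmul_summable n k4 p1 (wl1_pabs cA) (sob_pabs uB).
have h0 m : 0 <= cabs (c (n - m)) * cabs (u m) by rewrite mulr_ge0 ?cabs_ge0.
have hC' : sum_le (fun m => cabs (c (n - m)) * cabs (u m)) C.
  apply: (sum_leW _ (lexx _) hC) => m.
  by rewrite cabsZ cabs_pabs ger0_norm ?cabs_ge0.
exists (nsum (fun m => cabs (c (n - m)) * cabs (u m))).
  rewrite -(czsum_real h0 hC'); congr czsum; apply/funext => m.
  by rewrite rmorphM.
exact: sum_le_nsum hC'.
Qed.

(** The double series is dominated by a product of coefficientwise majorants [pabs], which have the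
    same norms as the original factors and nonnegative coefficients. *)
Lemma pmul_dsum k p q c w g A1 A2 B n : `|k| <= 4 -> (1 < p)%N -> (1 < q)%N ->
  wl1 p c A1 -> wl1 q w A2 -> sob k g B ->
  exists C, dsum_le (fun m l => cabs (c (n - m) * (w (m - l) * g l))) C.
Proof.
move=> k4 p1 q1 cA wA gB.
have hB := sob_pmul k4 q1 (wl1_pabs wA) (sob_pabs gB).
have [C hC] := wl1_pmul_summable n k4 p1 cA hB.
exists C; apply: le_trans hC; apply: le_esum => m _.
have [h -> hs] := pmul_pabs m k4 q1 wA gB.
have h0 : 0 <= h.
  by apply: sum_le_ge0 hs => l; rewrite mulr_ge0 ?cabs_ge0.
rewrite [c _ * _]mulrC cabsZ ger0_norm// [h * _]mulrC.
apply: (sum_leW _ (lexx _) (sum_leZ (cabs_ge0 (c (n - m))) hs)) => l.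
apply: le_trans (cabsM _ _) _; rewrite ler_wpM2l ?cabs_ge0//; exact: cabsM.
Qed.

(** Multiplications commute. Both iterated products are written as double sums with the summation
    order exchanged, which [pmul_dsum] justifies. *)
Lemma pmul_swap k p q c w g A1 A2 B : `|k| <= 4 -> (1 < p)%N -> (1 < q)%N ->
  wl1 p c A1 -> wl1 q w A2 -> sob k g B ->
  pmul c (pmul w g) = pmul w (pmul c g).
Proof.
move=> k4 p1 q1 cA wA gB; apply/funext => n.
have E (x y : pdist R) (r s : nat) X Y : (1 < r)%N -> (1 < s)%N ->
    wl1 r x X -> wl1 s y Y ->
    pmul x (pmul y g) n = czsum (fun l => czsum (fun m => x (n - m) * (y (m - l) * g l))).
  move=> r1 s1 xX yY; have [C hC] := pmul_dsum n k4 r1 s1 xX yY gB.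
  rewrite -(czsum_exchange hC) /pmul; congr czsum; apply/funext => m.
  by have [D hD] := wl1_pmul_summable m k4 s1 yY gB; rewrite (czsumZ _ hD).
rewrite (E _ _ _ _ _ _ p1 q1 cA wA) (E _ _ _ _ _ _ q1 p1 wA cA).
congr czsum; apply/funext => l.
(* The reflection m -> n + l - m exchanges the frequencies n - m and m - l of the two factors. *)
rewrite -[RHS](czsum_reindex _ (bij_subz (n + l))); congr czsum.
apply/funext => m.
have -> : n - (n + l - m) = m - l by ring.
have -> : n + l - m - l = n - m by ring.
ring.
Qed.

Lemma wl1_Dx p c A : wl1 p.+1 c A -> wl1 p (Dx c) A.
Proof.
apply: sum_leW => // n; rewrite /Dx /fmultiplier -mulrA cabs_iM cabsZ.
rewrite mulrA exprSr ler_wpM2r ?cabs_ge0// ler_wpM2l ?exprn_ge0 ?br_ge0//.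
exact: norm_le_br.
Qed.

(** The Leibniz rule is the splitting n = m + (n - m) of the frequency. *)
Lemma Dx_pmul k c f A B : `|k| <= 4 -> `|k - 2| <= 4 ->
  wl1 3 c A -> sob k f B ->
  Dx (pmul c f) = padd (pmul c (Dx f)) (pmul (Dx c) f).
Proof.
move=> k4 k24 cA fB; apply/funext => n.
have [C1 h1] := wl1_pmul_summable n k4 (isT : (1 < 3)%N) cA fB.
have [C2 h2] := wl1_pmul_summable n k24 (isT : (1 < 3)%N) cA (sob_Dx fB).
have [C3 h3] := wl1_pmul_summable n k4 (isT : (1 < 2)%N) (wl1_Dx cA) fB.
rewrite /padd /pmul -(czsumD h2 h3) /Dx /fmultiplier -(czsumZ _ h1).
congr czsum; apply/funext => m.
rewrite rmorphB/= [(n%:~R - m%:~R)%:C]rmorphB/=; ring.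
Qed.

Definition Xop w u : pdist R := pmul w (Dx u).

Lemma sob_Xop k p w u A B : `|k - 2| <= 4 -> (1 < p)%N -> wl1 p w A ->
  sob k u B -> sob (k - 2) (Xop w u) (A ^+ 2 * B).
Proof. by move=> k4 p1 wA uB; apply: (sob_pmul k4 p1 wA); exact: sob_Dx. Qed.

Definition rtker w n m : R[i] := (rt R n - rt R m)%:C * (w (n - m) * ('i%C * (m%:~R)%:C)).

(** This is [Z, X] f, of sign opposite to the commutators [X, Z^i] used later. *)
Definition Zcomm c w f : pdist R :=
  psub (pscale 'i%C (kop (rtker w) f)) (pmul w (pmul (Dx c) f)).

Lemma absD_Xop k w f A B : `|k - 2| <= 4 -> `|k - 1 - 2| <= 4 ->
  wl1 2 w A -> sob k f B ->
  psub (absD 2^-1 (Xop w f)) (Xop w (absD 2^-1 f)) = kop (rtker w) f.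
Proof.
move=> k4 k4' wA fB; apply/funext => n; rewrite /psub absD_half.
have [C1 h1] := wl1_pmul_summable n k4 (isT : (1 < 2)%N) wA (sob_Dx fB).
have [C2 h2] := wl1_pmul_summable n k4' (isT : (1 < 2)%N) wA (sob_Dx (sob_absD fB)).
rewrite -[X in _ - X]mul1r -mulNr -(czsum_lin _ _ h1 h2) /kop; congr czsum.
apply/funext => m; rewrite /rtker /Dx /fmultiplier -/(absD 2^-1 f) absD_half.
rewrite rmorphB/=; ring.
Qed.

(** In the part from chi, the terms with the derivative on f cancel because multiplications commute,
    leaving - w chi' f. The conditions on k are the orders of f, d_x f and d_x |D|^(1/2) f, at which
    the sums converge. *)
Lemma Zc_Xop k c w f A1 A2 B : `|k| <= 4 -> `|k - 2| <= 4 -> `|k - 1 - 2| <= 4 ->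
  wl1 3 c A1 -> wl1 2 w A2 -> sob k f B ->
  Zc c (Xop w f) = padd (Xop w (Zc c f)) (Zcomm c w f).
Proof.
move=> k4 k24 k124 cA wA fB; have cA2 := wl1W (isT : (2 <= 3)%N) cA.
have Df := sob_Dx fB.
have cf := sob_pmul k4 (isT : (1 < 3)%N) cA fB.
have fk := sobW (_ : k - 2 <= k) (lexx _) fB.
have cDf := sob_pmul k24 (isT : (1 < 3)%N) cA Df.
have Dcf := sob_pmul k24 (isT : (1 < 2)%N) (wl1_Dx cA) (fk (ltac:(lia))).
have DZ : Dx (Zc c f) =
    fun m => 'i%C * Dx (absD 2^-1 f) m + 1 * (Dx (pmul c f)) m.
  by apply/funext => m; rewrite /Zc /Dx /fmultiplier /padd /pscale; ring.
have D1 := sobW (_ : k - 1 - 2 <= k - 2) (lexx _) (sob_Dx cf).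
rewrite {2}/Xop DZ.
rewrite (pmul_linr _ _ k124 (isT : (1 < 2)%N) wA (sob_Dx (sob_absD fB)) (D1 (ltac:(lia)))).
rewrite (Dx_pmul k4 k24 cA fB).
have -> : pmul w (padd (pmul c (Dx f)) (pmul (Dx c) f)) =
    padd (pmul w (pmul c (Dx f))) (pmul w (pmul (Dx c) f)).
  have := pmul_linr 1 1 k24 (isT : (1 < 2)%N) wA cDf Dcf.
  have -> : (fun m => 1 * pmul c (Dx f) m + 1 * pmul (Dx c) f m) =
    padd (pmul c (Dx f)) (pmul (Dx c) f).
    by apply/funext => m; rewrite !mul1r.
  by move=> ->; apply/funext => m; rewrite !mul1r.
apply/funext => n.
have := congr1 (fun x => x n) (absD_Xop k24 k124 wA fB).
rewrite /Zc /Zcomm /padd /psub /pscale/= => <-.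
rewrite -/(Xop w _) (pmul_swap k24 (isT : (1 < 3)%N) (isT : (1 < 2)%N) cA wA Df) /Xop.
ring.
Qed.

(** Only half a derivative is lost although X has order 1: [hw_rt_sub] says precisely that the
    kernel [rtker w] satisfies [kdom] from order p + 1 to order p. *)
Lemma sob_Zcomm (p : nat) c w f A1 A2 B : (p <= 3)%N ->
  wl1 3 c A1 -> wl1 2 w A2 -> sob (p%:Z + 1) f B ->
  sob p (Zcomm c w f)
    (2 * ((2 * A2) ^+ 2 * B) + 2 * (A2 ^+ 2 * (A1 ^+ 2 * B))).
Proof.
move=> p3 cA wA fB.
have p4 : `|p%:Z| <= 4 by lia.
apply: sobB.
  suff h : sob p (kop (rtker w) f) ((2 * A2) ^+ 2 * B).
    by have := sobZ 'i%C h; rewrite /cabs/= normr0 normr1 add0r expr1n mul1r.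
  apply: (kop_sob (a := fun l => 2 * (br R l ^+ 2 * cabs (w l))) _ _ _ fB).
  - by move=> l; rewrite !mulr_ge0 ?exprn_ge0 ?br_ge0 ?cabs_ge0.
  - exact: sum_leZ wA.
  - move=> n m; rewrite /rtker cabsZ.
    have h := hw_rt_sub R n m p3.
    have c0 := cabs_ge0 (w (n - m)).
    have h2 : cabs (w (n - m) * ('i%C * (m%:~R)%:C)) <= cabs (w (n - m)) * `|m%:~R|.
      by apply: le_trans (cabsM _ _) _; rewrite cabs_iM cabs_real.
    apply: (@le_trans _ _ (hw R p n * (`|rt R n - rt R m| * (cabs (w (n - m)) * `|m%:~R|)))).
      by rewrite ler_wpM2l ?hw_ge0// ler_wpM2l.
    by have H := ler_wpM2r c0 h; lra.
apply: (sob_pmul p4 _ wA) => //; apply: (sob_pmul p4 _ (wl1_Dx cA)) => //.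
by apply: sobW fB => //; lia.
Qed.

End Commutator.

(** * The truncated energy *)

Section Truncation.
Variable R : realType.
Implicit Types (n m : int) (k : int) (u w f g c : pdist R) (A B : R).

Definition rho (L : nat) n : R := Num.max 0 (1 - `|n%:~R| / L.+1%:R).

(* The integers in [-(L+1), L]; it contains the support of [rho L]. *)
Definition zlist (L : nat) : seq int :=
  [seq Posz i | i <- iota 0 L.+1] ++ [seq Negz i | i <- iota 0 L.+1].

Lemma zlist_uniq L : uniq (zlist L).
Proof.
rewrite cat_uniq !map_inj_uniq ?iota_uniq; [|by move=> ? ? []|by move=> ? ? []].
rewrite andbT andTb; apply/hasPn => x /mapP[i _ ->].
by apply/negP => /mapP[].
Qed.

Lemma rho_ge0 L n : 0 <= rho L n. Proof. by rewrite le_max lexx. Qed.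

Lemma rho_le1 L n : rho L n <= 1.
Proof. by rewrite ge_max ler01/= gerBl divr_ge0. Qed.

Lemma rho_out L n : n \notin zlist L -> rho L n = 0.
Proof.
move=> nL; apply/max_idPl; rewrite subr_le0 ler_pdivlMr ?ltr0n// mul1r.
rewrite -intr_norm -[X in X <= _]/((L.+1%:Z)%:~R) ler_int.
move: nL; rewrite mem_cat negb_or => /andP[/negP nP /negP nN].
case: n nP nN => p nP nN.
  have : ~~ (p \in iota 0 L.+1) by apply/negP => h; apply: nP; exact: map_f.
  by rewrite mem_iota; lia.
have : ~~ (p \in iota 0 L.+1) by apply/negP => h; apply: nN; exact: map_f.
by rewrite mem_iota; lia.
Qed.

Lemma rho_lip L n m : `|rho L n - rho L m| <= `|(n - m)%:~R| / L.+1%:R.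
Proof.
have L0 : 0 < (L.+1%:R : R) by rewrite ltr0n.
have h : `|(1 - `|n%:~R| / L.+1%:R) - (1 - `|m%:~R| / L.+1%:R)| <= `|(n - m)%:~R : R| / L.+1%:R.
  have -> : (1 - `|n%:~R| / L.+1%:R) - (1 - `|m%:~R| / L.+1%:R) =
    (`|m%:~R| - `|n%:~R|) / L.+1%:R :> R by ring.
  rewrite normrM [X in _ * X]ger0_norm ?invr_ge0 ?ler0n// ler_wpM2r ?invr_ge0//.
  by rewrite rmorphB/= [leRHS]distrC ler_dist_dist.
apply: le_trans h; rewrite /rho.
move: (1 - `|n%:~R| / _) (1 - `|m%:~R| / _) => x y.
have [x0|x0] := lerP x 0; have [y0|y0] := lerP y 0; rewrite ?subrr ?normr0//.
- by rewrite sub0r normrN gtr0_norm// ler_normr; apply/orP; right; lra.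
- by rewrite subr0 gtr0_norm// ler_normr; apply/orP; left; lra.
Qed.

(** For |m| <= 2 (L + 1) the slope 1/(L + 1) compensates |m|. Beyond that rho vanishes at m, and an
    n inside the support is at distance at least |m|/2 from m. *)
Lemma rho_lip_weight L n m : `|rho L n - rho L m| * `|m%:~R| <= 2 * `|(n - m)%:~R|.
Proof.
have L0 : 0 < (L.+1%:R : R) by rewrite ltr0n.
have l0 : 0 <= `|(n - m)%:~R : R| by [].
have m0 : 0 <= `|m%:~R : R| by [].
have [mL|mL] := lerP `|m%:~R : R| (2 * L.+1%:R).
  apply: le_trans (ler_pM _ _ (rho_lip L n m) mL) _ => //.
  by rewrite mulrCA -mulrA mulVf ?gt_eqF// mulr1.
have rm : rho L m = 0.
  by apply/max_idPl; rewrite subr_le0 ler_pdivlMr// mul1r; lra.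
rewrite rm subr0 ger0_norm ?rho_ge0//.
have [nL|nL] := lerP (L.+1%:R : R) `|n%:~R : R|.
  have -> : rho L n = 0 by apply/max_idPl; rewrite subr_le0 ler_pdivlMr// mul1r.
  by rewrite mul0r mulr_ge0.
have tri : `|m%:~R : R| <= `|(n - m)%:~R| + `|n%:~R|.
  have -> : m%:~R = n%:~R - (n - m)%:~R :> R by rewrite -rmorphB/= opprB addrC subrK.
  by rewrite [leRHS]addrC ler_normB.
apply: (@le_trans _ _ (1 * `|m%:~R : R|)); first by rewrite ler_wpM2r ?rho_le1.
by lra.
Qed.

Definition lowpass L u : pdist R := fun n => (rho L n)%:C * u n.

Lemma lowpass_out L u n : n \notin zlist L -> lowpass L u n = 0.
Proof. by move=> /rho_out; rewrite /lowpass => ->; rewrite mul0r. Qed.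

Lemma sob_lowpass L k u B : sob k u B -> sob k (lowpass L u) B.
Proof.
apply: sum_leW => // n.
rewrite lerXn2r ?nnegrE ?mulr_ge0 ?hw_ge0 ?cabs_ge0// ler_wpM2l ?hw_ge0//.
by rewrite cabsZ ger0_norm ?rho_ge0// ler_piMl ?cabs_ge0 ?rho_le1.
Qed.

Definition rpair (s : seq int) u w : R :=
  \sum_(n <- s) complex.Re ((u n)^*%C * w n).

Lemma Re_conjM_le (a b : R[i]) : `|complex.Re (a^*%C * b)| <= cabs a * cabs b.
Proof.
apply: le_trans (_ : cabs (a^*%C * b) <= _); first by rewrite lerDl.
by rewrite -[cabs a]cabs_conj cabsM.
Qed.

(** Cauchy-Schwarz with a free parameter t, which balances two factors of different size without
    taking square roots. *)
Lemma rpair_le s u w A B (t : R) : uniq s -> 0 < t ->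
  sob 0 u A -> sob 0 w B -> `|rpair s u w| <= (t * A + B / t) / 2.
Proof.
move=> us t0 uA wB.
have ti0 : 0 <= t^-1 by rewrite invr_ge0 ltW.
have := sum_leD (sum_leZ (ltW t0) uA) (sum_leZ ti0 wB).
move=> /(sum_leZ (_ : 0 <= 2^-1)); rewrite invr_ge0 => /(_ (ler0n _ _)) /sum_leP /(_ _ us) h.
apply: le_trans (_ : (2^-1 * (t * A + t^-1 * B)) <= _); last first.
  by rewrite mulrC [B / t]mulrC.
apply: le_trans h; apply: le_trans (ler_norm_sum _ _ _) _.
apply: ler_sum => n _; apply: le_trans (Re_conjM_le _ _) _.
rewrite !hw0 !mul1r.
have := sqr_ge0 (t * cabs (u n) - cabs (w n)); rewrite sqrrB => H.
have tn : t != 0 by rewrite gt_eqF.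
have -> : 2^-1 * (t * cabs (u n) ^+ 2 + t^-1 * cabs (w n) ^+ 2) =
  t^-1 * (((t * cabs (u n)) ^+ 2 + cabs (w n) ^+ 2) / 2) by field.
rewrite ler_pdivlMl//.
by lra.
Qed.

Lemma rpairD s u w f : rpair s u (padd w f) = rpair s u w + rpair s u f.
Proof.
rewrite /rpair -big_split; apply: eq_bigr => n _ /=.
by rewrite /padd mulrDr; case: (_ * _) (_ * _) => [? ?] [? ?].
Qed.

Lemma rpairB s u w f : rpair s u (psub w f) = rpair s u w - rpair s u f.
Proof.
rewrite /rpair -sumrB; apply: eq_bigr => n _ /=.
by rewrite /psub mulrBr; case: (_ * _) (_ * _) => [? ?] [? ?].
Qed.

Lemma rpairZ s u w (a : R) : rpair s u (pscale a%:C w) = a * rpair s u w.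
Proof.
rewrite /rpair mulr_sumr; apply: eq_bigr => n _ /=.
by rewrite /pscale mulrCA; case: ((u n)^*%C * w n) => [? ?]/=; rewrite mul0r subr0.
Qed.

Definition energy_pair L u w := rpair (zlist L) (lowpass L u) (lowpass L w).

Lemma lowpassD L u w : lowpass L (padd u w) = padd (lowpass L u) (lowpass L w).
Proof. by apply/funext => n; rewrite /lowpass /padd mulrDr. Qed.

Lemma lowpassB L u w : lowpass L (psub u w) = psub (lowpass L u) (lowpass L w).
Proof. by apply/funext => n; rewrite /lowpass /psub mulrBr. Qed.

Lemma lowpassZ L (a : R[i]) u : lowpass L (pscale a u) = pscale a (lowpass L u).
Proof. by apply/funext => n; rewrite /lowpass /pscale mulrCA. Qed.

Lemma pmul_finite (s : seq int) c u n : uniq s ->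
  (forall m, m \notin s -> u m = 0) ->
  pmul c u n = \sum_(m <- s) c (n - m) * u m.
Proof. by move=> us hu; apply: czsum_finite => // m /hu ->; rewrite mulr0. Qed.

Lemma Re_conj (z : R[i]) : complex.Re z^*%C = complex.Re z.
Proof. by case: z. Qed.

Lemma Re_sum (I : Type) (s : seq I) (F : I -> R[i]) :
  complex.Re (\sum_(i <- s) F i) = \sum_(i <- s) complex.Re (F i).
Proof.
elim: s => [|i s IH]; first by rewrite !big_nil.
by rewrite !big_cons -IH; case: (F i) (\sum_(j <- s) F j) => [? ?] [? ?].
Qed.

(* The transport operator is skew-symmetric up to the multiplication by the
   derivative of its coefficient. *)
Lemma rpair_Xop s u w : uniq s -> (forall m, m \notin s -> u m = 0) ->
  preal w -> rpair s u (Xop w u) = - 2^-1 * rpair s u (pmul (Dx w) u).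
Proof.
move=> us hu wr.
have wc n m : (w (m - n))^*%C = w (n - m).
  by have := congr1 (fun x => x (n - m)) wr; rewrite /pconj opprB.
have hDu m : m \notin s -> Dx u m = 0 by move=> /hu; rewrite /Dx /fmultiplier => ->; rewrite mulr0.
pose t n m := complex.Re ((u n)^*%C * (w (n - m) * Dx u m)).
have E1 : rpair s u (Xop w u) = \sum_(n <- s) \sum_(m <- s) t n m.
  apply: eq_bigr => n _; rewrite /Xop (pmul_finite _ _ us hDu) mulr_sumr Re_sum.
  by [].
have E2 : rpair s u (Xop w u) = \sum_(n <- s) \sum_(m <- s) t m n.
  by rewrite E1 exchange_big.
(* The factor i (n - m) of the derivative of w splits into a derivative on either copy of u; reality
   of w, in the form [wc], identifies the second half with the transpose of the first. *)
have E3 : rpair s u (pmul (Dx w) u) = \sum_(n <- s) \sum_(m <- s) - (t n m + t m n).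
  apply: eq_bigr => n _; rewrite (pmul_finite _ _ us hu) mulr_sumr Re_sum.
  apply: eq_bigr => m _; rewrite /t -[X in - (_ + X)]Re_conj !rmorphM/= wc.
  rewrite /Dx /fmultiplier rmorphB/= [(n%:~R - m%:~R)%:C]rmorphB/=.
  case: (u n) (u m) (w (n - m)) => [a b] [a' b'] [p q] /=.
  by move: (n%:~R) (m%:~R) => x y; ring.
rewrite E3.
have -> : \sum_(n <- s) \sum_(m <- s) - (t n m + t m n) =
    - (\sum_(n <- s) \sum_(m <- s) t n m + \sum_(n <- s) \sum_(m <- s) t m n).
  rewrite -big_split -sumrN; apply: eq_bigr => n _.
  by rewrite -big_split -sumrN.
by rewrite -E1 -E2; field.
Qed.

Definition rhoker L c n m : R[i] := (rho L n - rho L m)%:C * c (n - m).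

Lemma lowpass_Xop L w f A B : wl1 2 w A -> sob 0 f B ->
  lowpass L (Xop w f) = padd (Xop w (lowpass L f))
   (kop (fun n m => (rho L n - rho L m)%:C * (w (n - m) * ('i%C * (m%:~R)%:C))) f).
Proof.
move=> wA fB; apply/funext => n.
have k2 : `|(0 : int) - 2| <= 4 by [].
have [C1 h1] := wl1_pmul_summable n k2 (isT : (1 < 2)%N) wA (sob_Dx fB).
have [C2 h2] := wl1_pmul_summable n k2 (isT : (1 < 2)%N) wA (sob_Dx (sob_lowpass L fB)).
rewrite /padd -[LHS](subrK (Xop w (lowpass L f) n)) addrC; congr (_ + _).
rewrite /lowpass /Xop /pmul.
rewrite -[X in _ - X]mul1r -mulNr -(czsum_lin _ _ h1 h2) /kop; congr czsum.
apply/funext => m; rewrite /Dx /fmultiplier /lowpass rmorphB/=; ring.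
Qed.

(** The bound needs f in L^2 only, while X f is merely in H^(-1): the derivative disappears by
    skew-symmetry on the trigonometric polynomial J_L f, and in [J_L, X] f by [rho_lip_weight]. *)
Lemma energy_pair_Xop L w f A B : wl1 2 w A -> preal w -> sob 0 f B ->
  `|energy_pair L f (Xop w f)| <= (1 + 3 * A ^+ 2) * B.
Proof.
move=> wA wr fB; have fJ := sob_lowpass L fB; have us := zlist_uniq L.
have B0 := sob_ge0 fB; have A0 := wl1_ge0 wA.
rewrite /energy_pair (lowpass_Xop L wA fB) rpairD.
rewrite (rpair_Xop us (fun m => @lowpass_out L f m) wr).
have dw : csum_le (Dx w) A by exact: wl1_csum (wl1_Dx wA).
have h1 := rpair_le us ltr01 fJ (sob_pmul0 dw fJ).
have hk : sob 0 (kop (fun n m =>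
    (rho L n - rho L m)%:C * (w (n - m) * ('i%C * (m%:~R)%:C))) f) ((2 * A) ^+ 2 * B).
  apply: (kop_sob (a := fun l => 2 * (br R l ^+ 2 * cabs (w l))) _ _ _ fB).
  - by move=> l; rewrite !mulr_ge0 ?exprn_ge0 ?br_ge0 ?cabs_ge0.
  - exact: sum_leZ wA.
  - move=> n m; rewrite !hw0 mul1r mulr1 cabsZ.
    apply: (@le_trans _ _ (`|rho L n - rho L m| * (cabs (w (n - m)) * `|m%:~R|))).
      rewrite ler_wpM2l//; apply: le_trans (cabsM _ _) _.
      by rewrite cabs_iM cabs_real.
    rewrite mulrCA mulrC mulrA ler_wpM2r ?cabs_ge0//.
    apply: le_trans (rho_lip_weight _ _ _) _; rewrite ler_wpM2l//.
    apply: le_trans (norm_le_br _ _) _.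
    by rewrite expr2 ler_peMl ?br_ge0 ?br_ge1.
have h2 := rpair_le us ltr01 fJ hk.
apply: le_trans (ler_normD _ _) _; rewrite normrM normrN [`|2^-1|]ger0_norm ?invr_ge0//.
have AB : 0 <= A ^+ 2 * B by rewrite mulr_ge0 ?sqr_ge0.
rewrite !mul1r !divr1 in h1 h2; rewrite exprMn in h2; lra.
Qed.

(* The multiplication by the function with Fourier coefficients c is a
   nonnegative operator on trigonometric polynomials. *)
Definition positive_kernel c := forall (s : seq int) (z : int -> R[i]), uniq s ->
  0 <= \sum_(n <- s) complex.Re ((z n)^*%C * \sum_(m <- s) c (n - m) * z m).

Lemma lowpass_Zc L c f A B : wl1 2 c A -> sob 0 f B ->
  lowpass L (Zc c f) = padd (padd (pscale 'i%C (absD 2^-1 (lowpass L f)))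
    (pmul c (lowpass L f))) (kop (rhoker L c) f).
Proof.
move=> cA fB; apply/funext => n.
have k0 : `|(0 : int)| <= 4 by [].
have [C1 h1] := wl1_pmul_summable n k0 (isT : (1 < 2)%N) cA fB.
have [C2 h2] := wl1_pmul_summable n k0 (isT : (1 < 2)%N) cA (sob_lowpass L fB).
rewrite [RHS]/padd; have -> : kop (rhoker L c) f n = (rho L n)%:C * pmul c f n + -1 * pmul c (lowpass L f) n.
  rewrite -(czsum_lin _ _ h1 h2) /kop; congr czsum.
  by apply/funext => m; rewrite /rhoker /lowpass rmorphB/=; ring.
rewrite /padd /pscale /lowpass /Zc /padd /pscale !absD_half /lowpass; ring.
Qed.

(** A one-sided bound: the dispersive part contributes the real part of a purely imaginary number,
    the multiplication by chi a nonnegative term that is dropped, and only [J_L, chi] is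
    estimated. *)
Lemma energy_pair_Zc L c f A B : wl1 2 c A -> positive_kernel c -> sob 0 f B ->
  - energy_pair L f (Zc c f) <= (1 + A ^+ 2) * B / L.+1%:R.
Proof.
move=> cA cp fB; have fJ := sob_lowpass L fB; have us := zlist_uniq L.
have B0 := sob_ge0 fB; have A0 := wl1_ge0 cA.
rewrite /energy_pair (lowpass_Zc L cA fB) !rpairD.
have -> : rpair (zlist L) (lowpass L f) (pscale 'i%C (absD 2^-1 (lowpass L f))) = 0.
  apply: big1 => n _; rewrite /pscale absD_half.
  by case: (lowpass L f n) => a b /=; ring.
have p0 : 0 <= rpair (zlist L) (lowpass L f) (pmul c (lowpass L f)).
  have := cp _ (lowpass L f) us; congr (_ <= _); apply: eq_bigr => n _.
  by rewrite -(pmul_finite _ _ us (fun m => @lowpass_out L f m)).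
have Li0 : 0 <= (L.+1%:R : R)^-1 by rewrite invr_ge0.
have hk : sob 0 (kop (rhoker L c) f) ((L.+1%:R^-1 * A) ^+ 2 * B).
  apply: (kop_sob (a := fun l => L.+1%:R^-1 * (br R l ^+ 2 * cabs (c l))) _ _ _ fB).
  - by move=> l; rewrite !mulr_ge0 ?exprn_ge0 ?br_ge0 ?cabs_ge0.
  - exact: sum_leZ cA.
  - move=> n m; rewrite !hw0 mul1r mulr1 cabsZ mulrA ler_wpM2r ?cabs_ge0//.
    apply: le_trans (rho_lip _ _ _) _; rewrite mulrC ler_wpM2l//.
    apply: le_trans (norm_le_br _ _) _.
    by rewrite expr2 ler_peMl ?br_ge0 ?br_ge1.
have L0 : 0 < (L.+1%:R : R)^-1 by rewrite invr_gt0 ltr0n.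
(* The parameter is t = 1/(L + 1): the commutator has squared norm of size t^2, so both terms of
   [rpair_le] are of size t. *)
have := rpair_le us L0 fJ hk; rewrite ler_norml => /andP[h _].
have e : (L.+1%:R^-1 * B + (L.+1%:R^-1 * A) ^+ 2 * B / L.+1%:R^-1) / 2 =
   ((1 + A ^+ 2) * B / L.+1%:R) / 2 :> R.
  have : (L.+1%:R : R) != 0 by rewrite pnatr_eq0.
  by move: (L.+1%:R : R) => q q0; field.
rewrite e in h.
have : 0 <= (1 + A ^+ 2) * B / L.+1%:R.
  by rewrite !mulr_ge0// addr_ge0// sqr_ge0.
by move: ((1 + A ^+ 2) * B / L.+1%:R) h => X h X0; lra.
Qed.

Lemma energy_pair_le L f g A B : sob 0 f A -> sob 0 g B ->
  `|energy_pair L f g| <= (A + B) / 2.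
Proof.
move=> fA gB.
have := rpair_le (zlist_uniq L) ltr01 (sob_lowpass L fA) (sob_lowpass L gB).
by rewrite mul1r divr1.
Qed.

End Truncation.

(** * Powers of Z and the rate of the truncated energy *)

Section EnergyRate.
Variable R : realType.
Implicit Types (n m : int) (k : int) (u w f g v c : pdist R) (A B : R).

(** Each factor Z costs half a derivative. The orders stay in [-4, 4], the range in which [wl1 2]
    acts by multiplication. *)
Lemma sob_iter_Zc c A1 (k : int) (i : nat) : wl1 2 c A1 ->
  k <= 4 -> - (4 : int) <= k - i%:Z ->
  exists2 C, 0 <= C & forall u B, sob k u B -> sob (k - i%:Z) (iter i (Zc c) u) (C * B).
Proof.
move=> cA; elim: i => [|i IH] k4 ki.
  by exists 1 => // u B uB; rewrite subr0 mul1r.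
have [|C C0 hC] := IH k4; first by lia.
exists (2 * C + 2 * (A1 ^+ 2 * C)).
  have := sqr_ge0 A1; nra.
move=> u B /hC uB; rewrite iterS.
have -> : k - i.+1%:Z = k - i%:Z - 1 by lia.
have := sob_Z (_ : `|k - i%:Z - 1| <= 4) cA uB => /(_ (ltac:(lia))).
by congr (sob _ _ _); ring.
Qed.

Lemma uniform_constant (P : nat -> R -> Prop) (m : nat) :
  (forall i x y, P i x -> x <= y -> P i y) ->
  (forall i, (i < m)%N -> exists2 C, 0 <= C & P i C) ->
  exists2 C, 0 <= C & forall i, (i < m)%N -> P i C.
Proof.
move=> mono; elim: m => [|m IH] h; first by exists 0.
have [|C C0 hC] := IH; first by move=> i im; apply: h; exact: leqW.
have [D D0 hD] := h m (ltnSn m).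
exists (C + D); first exact: addr_ge0.
move=> i; rewrite ltnS leq_eqVlt => /predU1P[->|/hC hi].
  by apply: (mono _ _ _ hD); rewrite lerDr.
by apply: (mono _ _ _ hi); rewrite lerDl.
Qed.

Lemma sob0_iter_Zc c A1 : wl1 2 c A1 ->
  exists2 C, 0 <= C & forall i : nat, (i < 5)%N -> forall u B, sob 4 u B ->
    sob 0 (iter i (Zc c) u) (C * B).
Proof.
move=> cA; apply: (uniform_constant (P := fun i C => forall u B, sob 4 u B ->
    sob 0 (iter i (Zc c) u) (C * B))).
  move=> i x y h xy u B uB; apply: sobW (h u B uB) => //.
  by rewrite ler_wpM2r// (sob_ge0 uB).
move=> i i5; have [||C C0 hC] := @sob_iter_Zc c A1 4 i cA; [lia|lia|].
by exists C => // u B uB; apply: (sobW _ (lexx _) (hC _ _ uB)); lia.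
Qed.

Lemma iter_Zc_lin c A1 (k : int) (i : nat) u w (a b : R[i]) B1 B2 : wl1 2 c A1 ->
  `|k| <= 4 -> - (4 : int) <= k - i%:Z -> sob k u B1 -> sob k w B2 ->
  iter i (Zc c) (fun n => a * u n + b * w n) =
  fun n => a * iter i (Zc c) u n + b * iter i (Zc c) w n.
Proof.
move=> cA; elim: i => [//|i IH] k4 ki uB wB.
rewrite !iterS IH//; last by lia.
have [||C C0 hC] := @sob_iter_Zc c A1 k i cA; [lia|lia|].
apply: (@Zc_lin R (k - i%:Z)) cA (hC _ _ uB) (hC _ _ wB); lia.
Qed.

Lemma iter_Zc_sub c A1 (k : int) (i : nat) u w B1 B2 : wl1 2 c A1 ->
  `|k| <= 4 -> - (4 : int) <= k - i%:Z -> sob k u B1 -> sob k w B2 ->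
  iter i (Zc c) (psub u w) = psub (iter i (Zc c) u) (iter i (Zc c) w).
Proof.
move=> cA k4 ki uB wB; have := iter_Zc_lin 1 (-1) cA k4 ki uB wB.
have -> : (fun m => 1 * u m + -1 * w m) = psub u w.
  by apply/funext => m; rewrite mul1r mulN1r.
by move=> ->; apply/funext => m; rewrite mul1r mulN1r.
Qed.

Lemma iter_Zc_scale c A1 (k : int) (i : nat) u (a : R[i]) B1 : wl1 2 c A1 ->
  `|k| <= 4 -> - (4 : int) <= k - i%:Z -> sob k u B1 ->
  iter i (Zc c) (pscale a u) = pscale a (iter i (Zc c) u).
Proof.
move=> cA k4 ki uB; have := iter_Zc_lin a 0 cA k4 ki uB uB.
have -> : (fun m => a * u m + 0 * u m) = pscale a u.
  by apply/funext => m; rewrite mul0r addr0.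
by move=> ->; apply/funext => m; rewrite mul0r addr0.
Qed.

Lemma iter_Zc_add c A1 (k : int) (i : nat) u w B1 B2 : wl1 2 c A1 ->
  `|k| <= 4 -> - (4 : int) <= k - i%:Z -> sob k u B1 -> sob k w B2 ->
  iter i (Zc c) (padd u w) = padd (iter i (Zc c) u) (iter i (Zc c) w).
Proof.
move=> cA k4 ki uB wB; have := iter_Zc_lin 1 1 cA k4 ki uB wB.
have -> : (fun m => 1 * u m + 1 * w m) = padd u w.
  by apply/funext => m; rewrite !mul1r.
by move=> ->; apply/funext => m; rewrite !mul1r.
Qed.

(* [Zpow_comm] is the commutator [X, Z^i] applied to v, with X = w d_x. *)
Fixpoint Zpow_comm c w v (i : nat) : pdist R :=
  if i is i'.+1 then psub (Zc c (Zpow_comm c w v i')) (Zcomm c w (iter i' (Zc c) v))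
  else fun=> 0.

(** The recursion is [X, Z^(i+1)] = Z [X, Z^i] - [Z, X] Z^i. Both terms lose (i+1)/2 derivatives, as
    Z^(i+1) itself does, so the derivative in X costs nothing. Bound and identity are proved
    together because linearity of Z requires the bound. *)
Lemma sob_Zpow_comm c A1 A2 (i : nat) : wl1 3 c A1 -> 0 <= A2 -> (i <= 4)%N ->
  exists2 C, 0 <= C & forall w v B, wl1 2 w A2 -> sob 4 v B ->
    sob (4 - i%:Z) (Zpow_comm c w v i) (C * B) /\
    iter i (Zc c) (Xop w v) = psub (Xop w (iter i (Zc c) v)) (Zpow_comm c w v i).
Proof.
move=> cA A20; have cA2 := wl1W (isT : (2 <= 3)%N) cA.
have A10 := wl1_ge0 cA.
elim: i => [|i IH] i4.
  exists 0 => // w v B wA vB; split.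
    rewrite mul0r; apply/sum_leP => s _.
    by rewrite big1// => n _ /=; rewrite cabs0 mulr0 expr0n.
  by apply/funext => n; rewrite /psub /= subr0.
have [|C C0 hC] := IH; first by lia.
have [||D D0 hD] := @sob_iter_Zc c A1 4 i cA2; [lia|lia|].
set K := 2 * (2 * C + 2 * (A1 ^+ 2 * C)) +
  2 * (2 * ((2 * A2) ^+ 2 * D) + 2 * (A2 ^+ 2 * (A1 ^+ 2 * D))).
exists K.
  have a1 := sqr_ge0 A1; have a2 := sqr_ge0 A2; have a3 := sqr_ge0 (2 * A2).
  by rewrite /K !addr_ge0// mulr_ge0// addr_ge0// mulr_ge0// mulr_ge0// mulr_ge0.
move=> w v B wA vB; have [hr hX] := hC w v B wA vB; have hv := hD _ _ vB.
have i3 : (3 - i <= 3)%N by lia.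
(* [sob_Zcomm] is used at p = 3 - i: it takes Z^i v at order 4 - i to order 4 - (i + 1). *)
have e3 : (3 - i)%:Z + 1 = 4 - i%:Z by lia.
split.
  rewrite /=; have -> : K * B = 2 * (2 * (C * B) + 2 * (A1 ^+ 2 * (C * B))) +
     2 * (2 * ((2 * A2) ^+ 2 * (D * B)) + 2 * (A2 ^+ 2 * (A1 ^+ 2 * (D * B)))).
    by rewrite /K; ring.
  apply: sobB.
    have -> : 4 - i.+1%:Z = 4 - i%:Z - 1 by lia.
    by apply: sob_Z cA2 hr; lia.
  have -> : 4 - i.+1%:Z = (3 - i)%:Z by lia.
  by apply: sob_Zcomm => //; rewrite e3.
rewrite !iterS hX.
have hXf : sob (4 - i%:Z - 2) (Xop w (iter i (Zc c) v)) (A2 ^+ 2 * (D * B)).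
  by apply: sob_Xop wA hv => //; lia.
have hr' := sobW (_ : 4 - i%:Z - 2 <= 4 - i%:Z) (lexx _) hr.
rewrite (@Zc_sub R (4 - i%:Z - 2) c _ _ A1 _ _ _ cA2 hXf (hr' (ltac:(lia)))); last by lia.
rewrite (@Zc_Xop R (4 - i%:Z) c w _ A1 A2 _ _ _ _ cA wA hv); try lia.
by apply/funext => n; rewrite /= /psub /padd; ring.
Qed.

(** A triangular induction: order j + 1 of Z^i v follows from order j of Z^i v and of Z^(i+1) v. At
    j = 4 and i = 0 it bounds the H^2 norm of v by the energy. *)
Lemma sob_elliptic_iter c A1 (j : nat) : wl1 2 c A1 -> (j <= 4)%N ->
  exists2 C, 0 <= C & forall v B,
    (forall i : nat, (i < 5)%N -> sob 0 (iter i (Zc c) v) B) ->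
    forall i : nat, (i + j <= 4)%N -> sob j (iter i (Zc c) v) (C * B).
Proof.
move=> cA; elim: j => [|j IH] j4.
  exists 1 => // v B h i ij; rewrite mul1r; apply: h; lia.
have [|C C0 hC] := IH; first by lia.
exists (C + (2 * C + 2 * (A1 ^+ 2 * C))).
  have := sqr_ge0 A1; nra.
move=> v B h i ij.
have h1 := hC v B h i (ltac:(lia)); have h2 := hC v B h i.+1 (ltac:(lia)).
have := elliptic (_ : `|j%:Z| <= 4) cA h1 h2 => /(_ (ltac:(lia))).
have -> : j%:Z + 1 = j.+1%:Z by lia.
by congr (sob _ _ _); ring.
Qed.

(** The left-hand side is half the time derivative of the truncated energy along the equation, up to
    the factor 2 pi. The constant is chosen before w, v, eps and L. *)
Lemma energy_rate c A1 A2 : wl1 3 c A1 -> positive_kernel c -> 0 <= A2 ->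
  exists2 C, 0 <= C & forall w v B eps L, wl1 2 w A2 -> preal w -> 0 < eps ->
    sob 4 v B ->
    - (\sum_(i < 5) energy_pair L (iter i (Zc c) v)
        (iter i (Zc c) (padd (Xop w v) (pscale (eps^-1)%:C (Zc c v)))))
    <= (C + C / (eps * L.+1%:R)) * B.
Proof.
move=> cA cp A20; have cA2 := wl1W (isT : (2 <= 3)%N) cA.
have A10 := wl1_ge0 cA.
have [C C0 hC] : exists2 C, 0 <= C & forall i : nat, (i < 5)%N -> forall w v B,
    wl1 2 w A2 -> sob 4 v B ->
    [/\ sob 0 (iter i (Zc c) v) (C * B), sob 0 (Zpow_comm c w v i) (C * B) &
    iter i (Zc c) (Xop w v) = psub (Xop w (iter i (Zc c) v)) (Zpow_comm c w v i)].
  have [C C0 hC] := sob0_iter_Zc cA2.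
  apply: (uniform_constant (P := fun i C => forall w v B, wl1 2 w A2 -> sob 4 v B ->
    [/\ sob 0 (iter i (Zc c) v) (C * B), sob 0 (Zpow_comm c w v i) (C * B) &
    iter i (Zc c) (Xop w v) = psub (Xop w (iter i (Zc c) v)) (Zpow_comm c w v i)])).
    move=> i x y h xy w v B wA vB; have [h1 h2 h3] := h w v B wA vB.
    have xyB : x * B <= y * B by rewrite ler_wpM2r// (sob_ge0 vB).
    by split=> //; [exact: sobW h1|exact: sobW h2].
  move=> i i5; have [|D D0 hD] := @sob_Zpow_comm c A1 A2 i cA A20; first by lia.
  exists (C + D); first by rewrite addr_ge0.
  move=> w v B wA vB; have [h1 h2] := hD w v B wA vB; have B0 := sob_ge0 vB.
  split=> //.
    by apply: sobW (hC i i5 _ _ vB) => //; rewrite ler_wpM2r// lerDl.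
  apply: sobW h1; last by rewrite ler_wpM2r// lerDr.
  lia.
(* The sum of the three constants 1 + 3 A2^2 for X, 1 for [X, Z^i] and A1^2 for [J_L, chi] dominates
   each bound needed below. *)
set K := (2 + 3 * A2 ^+ 2 + A1 ^+ 2) * C.
have K0 : 0 <= K.
  by have := sqr_ge0 A1; have := sqr_ge0 A2 => a2 a1; rewrite /K mulr_ge0//; lra.
exists (5 * K); first by rewrite mulr_ge0.
move=> w v B eps L wA wr eps0 vB; have B0 := sob_ge0 vB.
rewrite -sumrN.
have L0 : 0 < eps * L.+1%:R by rewrite mulr_gt0 ?ltr0n.
have -> : (5 * K + 5 * K / (eps * L.+1%:R)) * B =
   \sum_(i < 5) ((K + K / (eps * L.+1%:R)) * B).
  by rewrite sumr_const card_ord -mulr_natr; ring.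
apply: ler_sum => i _.
have [h1 h2 h3] := hC i (ltn_ord i) w v B wA vB.
have hX : sob 2 (Xop w v) (A2 ^+ 2 * B) by apply: (sob_Xop (k := 4)) wA vB.
have hZ := sob_Z (_ : `|(4 : int) - 1| <= 4) cA2 vB.
have hZ' := sobW (_ : 2 <= (4 : int) - 1) (lexx _) (hZ isT).
have hZe := sobZ (eps^-1)%:C (hZ' isT).
have i5 := ltn_ord i.
rewrite (@iter_Zc_add c A1 2 i _ _ _ _ cA2 isT _ hX hZe); last by lia.
rewrite (@iter_Zc_scale c A1 2 i _ _ _ cA2 isT _ (hZ' isT)); last by lia.
(* Writing Z^i (Z v) as Z (Z^i v) pairs f = Z^i v with Z f, so that [X, Z^i] carries no factor
   1/eps. *)
rewrite h3 -iterSr iterS /energy_pair lowpassD lowpassB lowpassZ rpairD rpairB rpairZ.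
have e1 := energy_pair_Xop L wA wr h1.
have e2 := energy_pair_le L h1 h2.
have e3 := energy_pair_Zc L cA2 cp h1.
rewrite /energy_pair in e1 e2 e3.
rewrite ler_norml in e1; move/andP: e1 => [e1 _].
rewrite ler_norml in e2; move/andP: e2 => [_ e2].
set x1 := rpair _ _ (lowpass L (Xop _ _)) in e1 *.
set x2 := rpair _ _ (lowpass L (Zpow_comm _ _ _ _)) in e2 *.
set x3 := rpair _ _ (lowpass L (Zc _ _)) in e3 *.
have e3' : - (eps^-1 * x3) <= K / (eps * L.+1%:R) * B.
  rewrite -mulrN invfM.
  have -> : K * (eps^-1 / L.+1%:R) * B = eps^-1 * (K * B / L.+1%:R) by ring.
  rewrite ler_wpM2l ?invr_ge0 ?(ltW eps0)//; apply: le_trans e3 _.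
  rewrite ler_wpM2r ?invr_ge0// mulrA ler_wpM2r// /K ler_wpM2r//.
  have := sqr_ge0 A2; lra.
have K1 : (1 + 3 * A2 ^+ 2) * (C * B) + (C * B + C * B) / 2 <= K * B.
  have : 0 <= A1 ^+ 2 * (C * B) by rewrite mulr_ge0 ?sqr_ge0// mulr_ge0.
  by rewrite /K; lra.
rewrite mulrDl; move: (K / (eps * L.+1%:R) * B) (eps^-1 * x3) e3' => z y e3'.
by lra.
Qed.

End EnergyRate.

(** * The Fourier coefficients of the cut-off function *)

Section RealAnalysis.
Variable R : realType.
Implicit Types (f g F : R -> R) (a b x : R).

Local Notation mu := (@lebesgue_measure R).

Lemma integrable_continuous a b f : {within `[a, b], continuous f} ->
  mu.-integrable `[a, b] (EFin \o f).
Proof. by move=> cf; apply: continuous_compact_integrable => //; exact: segment_compact. Qed.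

Lemma within_continuous (A : set R) f : continuous f -> {within A, continuous f}.
Proof. exact: continuous_subspaceT. Qed.

Lemma is_derive_continuous f x (d : R) : is_derive x 1 f d -> {for x, continuous f}.
Proof.
by move=> fd; apply: differentiable_continuous; apply/derivable1_diffP; case: fd.
Qed.

Lemma Rintegral_is_derive a b F f : a < b ->
  (forall x, is_derive x 1 F (f x)) -> continuous f ->
  \int[mu]_(x in `[a, b]) f x = F b - F a.
Proof.
move=> ab Ff cf; have cF : continuous F by move=> x; exact: is_derive_continuous.
rewrite /Rintegral (@continuous_FTC2 R f F a b)//.
- exact: within_continuous.
- split=> [x _||]; first by case: (Ff x).
    exact/cvg_at_right_filter/cF.
  exact/cvg_at_left_filter/cF.
- by move=> x _; rewrite derive1E; exact: derive_val.
Qed.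

Lemma continuous_mull (k : R) f : continuous f -> continuous (fun x => k * f x).
Proof.
move=> cf x; have ck : {for x, continuous (fun=> k : R)} by exact: cst_continuous.
exact: (continuousM ck (cf x)).
Qed.

Lemma continuous_sum (I : Type) (s : seq I) (G : I -> R -> R) :
  (forall i, continuous (G i)) -> continuous (fun x => \sum_(i <- s) G i x).
Proof.
move=> cG; elim: s => [|i s IH].
  under eq_fun do rewrite big_nil; exact: cst_continuous.
by under eq_fun do rewrite big_cons; move=> x; apply: continuousD; [exact: cG|exact: IH].
Qed.

Lemma Rintegral_sum (I : Type) (s : seq I) (G : I -> R -> R) a b :
  (forall i, continuous (G i)) ->
  \int[mu]_(x in `[a, b]) (\sum_(i <- s) G i x) =
  \sum_(i <- s) \int[mu]_(x in `[a, b]) G i x.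
Proof.
move=> cG; elim: s => [|i s IH].
  rewrite big_nil; under eq_Rintegral do rewrite big_nil.
  by rewrite Rintegral_cst// mul0r.
rewrite big_cons -IH -RintegralD//.
- by apply: eq_Rintegral => x _; rewrite big_cons.
- by apply: integrable_continuous; exact: within_continuous.
- by apply: integrable_continuous; apply: within_continuous; exact: continuous_sum.
Qed.

End RealAnalysis.

(** * Trigonometric integrals and their decay *)

Section Cutoff.
Variable R : realType.
Implicit Types (f g F : R -> R) (a b x y : R) (n m : int).

Local Notation mu := (@lebesgue_measure R).

Lemma is_derive_cosM y x : is_derive x 1 (fun x => cos (y * x)) (- y * sin (y * x)).
Proof.
have h : is_derive x 1 (fun x => y * x) y.
  have := is_deriveZ (f := id) y (x := x) (v := 1 : R).
  by move=> /(_ _ (is_derive_id _ _)); rewrite /GRing.scale/= mulr1.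
have := is_derive1_comp (is_derive_cos (y * x)) h.
by move=> H; apply: is_derive_eq; rewrite !mulNr mulrC.
Qed.

Lemma is_derive_sinM y x : is_derive x 1 (fun x => sin (y * x)) (y * cos (y * x)).
Proof.
have h : is_derive x 1 (fun x => y * x) y.
  have := is_deriveZ (f := id) y (x := x) (v := 1 : R).
  by move=> /(_ _ (is_derive_id _ _)); rewrite /GRing.scale/= mulr1.
have := is_derive1_comp (is_derive_sin (y * x)) h.
by move=> H; apply: is_derive_eq; rewrite mulrC.
Qed.

Lemma continuous_cosM y : continuous (fun x => cos (y * x)).
Proof. by move=> x; apply: is_derive_continuous; exact: is_derive_cosM. Qed.

Lemma continuous_sinM y : continuous (fun x => sin (y * x)).
Proof. by move=> x; apply: is_derive_continuous; exact: is_derive_sinM. Qed.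

Lemma smooth_is_derive f (k : nat) x : smooth f ->
  is_derive x 1 f^`(k)%classic (f^`(k.+1)%classic x).
Proof.
move=> sf; apply: DeriveDef; first exact: sf.
by rewrite -derive1E.
Qed.

Lemma smooth_continuous f (k : nat) : smooth f -> continuous f^`(k)%classic.
Proof.
by move=> sf x; apply: is_derive_continuous; exact: smooth_is_derive.
Qed.

Lemma periodic_derive1 f (p : R) : (forall x, f (x + p) = f x) ->
  forall x, f^`()%classic (x + p) = f^`()%classic x.
Proof.
move=> fp x; rewrite /derive1; congr (lim _).
have -> // : (fun h : R => h^-1 *: (f (h + (x + p)) - f (x + p))) =
  (fun h : R => h^-1 *: (f (h + x) - f x)).
by apply/funext => h; rewrite addrA !fp.
Qed.

Lemma periodic_derive1n f (p : R) (k : nat) : (forall x, f (x + p) = f x) ->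
  forall x, f^`(k)%classic (x + p) = f^`(k)%classic x.
Proof.
by move=> fp; elim: k => // k IH x; rewrite !derive1nS; exact: periodic_derive1.
Qed.

Definition cosint g n := \int[mu]_(x in `[0, 2 * pi]) (g x * cos (n%:~R * x)).
Definition sinint g n := \int[mu]_(x in `[0, 2 * pi]) (g x * sin (n%:~R * x)).

Lemma pi2_gt0 : 0 < 2 * pi :> R. Proof. by rewrite mulr_gt0 ?pi_gt0. Qed.

Lemma cos_sin_nat_2pi (p : nat) :
  cos (p%:R * (2 * pi)) = 1 :> R /\ sin (p%:R * (2 * pi)) = 0 :> R.
Proof.
elim: p => [|p [IHc IHs]]; first by rewrite mul0r cos0 sin0.
rewrite -natr1 mulrDl mul1r cosD sinD IHc IHs [2 * pi]mulr_natl cos2pi sin2pi.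
by rewrite !(mulr0, mul0r) mulr1 subr0 addr0.
Qed.

Lemma cos_int_2pi n : cos (n%:~R * (2 * pi)) = 1 :> R.
Proof.
case: n => p; first exact: (cos_sin_nat_2pi p).1.
by rewrite NegzE rmorphN mulNr cosN; exact: (cos_sin_nat_2pi _).1.
Qed.

Lemma sin_int_2pi n : sin (n%:~R * (2 * pi)) = 0 :> R.
Proof.
case: n => p; first exact: (cos_sin_nat_2pi p).2.
by rewrite NegzE rmorphN mulNr sinN (cos_sin_nat_2pi p.+1).2 oppr0.
Qed.

Lemma periodic_ends g : (forall x, g (x + 2 * pi) = g x) -> g (2 * pi) = g 0.
Proof. by move=> gp; rewrite -[in LHS](add0r (2 * pi)) gp. Qed.

(** Integration by parts: the fundamental theorem for h(x) sin(n x), whose boundary values vanish.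
    In [sinint_deriv] they cancel by periodicity of the derivatives. *)
Lemma cosint_deriv g n (k : nat) : smooth g -> (forall x, g (x + 2 * pi) = g x) ->
  n%:~R * cosint g^`(k)%classic n = - sinint g^`(k.+1)%classic n.
Proof.
move=> sg gp; set h := g^`(k)%classic; set h' := g^`(k.+1)%classic.
have hd x : is_derive x 1 h (h' x) by exact: smooth_is_derive.
have ch : continuous h by exact: smooth_continuous.
have ch' : continuous h' by exact: smooth_continuous.
have c1 : continuous (fun x => h' x * sin (n%:~R * x)).
  by move=> x; apply: continuousM; [exact: ch'|exact: continuous_sinM].
have c2 : continuous (fun x => h x * cos (n%:~R * x)).
  by move=> x; apply: continuousM; [exact: ch|exact: continuous_cosM].
have c2' : continuous (fun x => n%:~R * (h x * cos (n%:~R * x))).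
  exact: continuous_mull.
have D x : is_derive x 1 (fun x => h x * sin (n%:~R * x))
    (h' x * sin (n%:~R * x) + n%:~R * (h x * cos (n%:~R * x))).
  have := is_deriveM (hd x) (is_derive_sinM n%:~R x).
  by move=> H; apply: is_derive_eq; rewrite /GRing.scale/=; ring.
have := Rintegral_is_derive pi2_gt0 D.
rewrite RintegralD//; try by apply: integrable_continuous; exact: within_continuous.
rewrite RintegralZl//; last by apply: integrable_continuous; exact: within_continuous.
rewrite -/(sinint h' n) -/(cosint h n) sin_int_2pi !mulr0 sin0 mulr0 subr0.
by move=> /(_ (fun x => continuousD (@c1 x) (@c2' x))) e; lra.
Qed.

Lemma sinint_deriv g n (k : nat) : smooth g -> (forall x, g (x + 2 * pi) = g x) ->
  n%:~R * sinint g^`(k)%classic n = cosint g^`(k.+1)%classic n.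
Proof.
move=> sg gp; set h := g^`(k)%classic; set h' := g^`(k.+1)%classic.
have hd x : is_derive x 1 h (h' x) by exact: smooth_is_derive.
have ch : continuous h by exact: smooth_continuous.
have ch' : continuous h' by exact: smooth_continuous.
have c1 : continuous (fun x => h' x * cos (n%:~R * x)).
  by move=> x; apply: continuousM; [exact: ch'|exact: continuous_cosM].
have c2 : continuous (fun x => h x * sin (n%:~R * x)).
  by move=> x; apply: continuousM; [exact: ch|exact: continuous_sinM].
have c2' : continuous (fun x => - n%:~R * (h x * sin (n%:~R * x))).
  exact: continuous_mull.
have D x : is_derive x 1 (fun x => h x * cos (n%:~R * x))
    (h' x * cos (n%:~R * x) + - n%:~R * (h x * sin (n%:~R * x))).
  have := is_deriveM (hd x) (is_derive_cosM n%:~R x).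
  by move=> H; apply: is_derive_eq; rewrite /GRing.scale/=; ring.
have := Rintegral_is_derive pi2_gt0 D.
rewrite RintegralD//; try by apply: integrable_continuous; exact: within_continuous.
rewrite RintegralZl//; last by apply: integrable_continuous; exact: within_continuous.
rewrite -/(sinint h n) -/(cosint h' n) cos_int_2pi mulr0 cos0.
have hp : h (2 * pi) = h 0 by exact: periodic_ends (periodic_derive1n k gp).
rewrite hp subrr; by move=> /(_ (fun x => continuousD (@c1 x) (@c2' x))) e; lra.
Qed.

Lemma trig_int_bound g : continuous g -> exists2 M, 0 <= M &
  forall n, `|cosint g n| + `|sinint g n| <= M.
Proof.
move=> cg.
have ing : mu.-integrable `[0, 2 * pi] (EFin \o (fun x => `|g x|)).
  apply: integrable_continuous; apply: within_continuous => x.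
  by apply: cvg_norm; exact: cg.
have B (t : R -> R) : continuous t -> (forall x, `|t x| <= 1) ->
    `|\int[mu]_(x in `[0, 2 * pi]) (g x * t x)| <= \int[mu]_(x in `[0, 2 * pi]) `|g x|.
  move=> ct t1.
  have cgt : continuous (fun x => g x * t x).
    by move=> x; apply: continuousM; [exact: cg|exact: ct].
  have igt := integrable_continuous (within_continuous (A := `[0, 2 * pi]) cgt).
  apply: le_trans (le_normr_Rintegral _ igt) _ => //.
  apply: le_Rintegral => //.
    apply: integrable_continuous; apply: within_continuous => x.
    by apply: cvg_norm; exact: cgt.
  by move=> x _; rewrite normrM ler_piMr.
exists (2 * \int[mu]_(x in `[0, 2 * pi]) `|g x|).
  by rewrite mulr_ge0// Rintegral_ge0.
move=> n; rewrite mulr_natl mulr2n lerD//; apply: B.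
- exact: continuous_cosM.
- by move=> x; rewrite ler_norml cos_geN1 cos_le1.
- exact: continuous_sinM.
- by move=> x; rewrite ler_norml sin_geN1 sin_le1.
Qed.

(** Five integrations by parts. Of the five powers of [br n], three serve as the weight in [wl1 3]
    and two make the series converge. The mode n = 0, where |n| gives nothing, is bounded directly
    by M'. *)
Lemma trig_int_decay g : smooth g -> (forall x, g (x + 2 * pi) = g x) ->
  exists2 M, 0 <= M & forall n, br R n ^+ 5 * (`|cosint g n| + `|sinint g n|) <= M.
Proof.
move=> sg gp.
have step n (k : nat) : `|n%:~R| * (`|cosint g^`(k)%classic n| + `|sinint g^`(k)%classic n|) =
    `|cosint g^`(k.+1)%classic n| + `|sinint g^`(k.+1)%classic n|.
  rewrite mulrDr -!normrM (cosint_deriv n k sg gp) (sinint_deriv n k sg gp).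
  by rewrite normrN addrC.
have steps n (k : nat) : `|n%:~R| ^+ k * (`|cosint g n| + `|sinint g n|) =
    `|cosint g^`(k)%classic n| + `|sinint g^`(k)%classic n|.
  elim: k => [|k IH]; first by rewrite expr0 mul1r.
  by rewrite exprS -mulrA IH step.
have [M M0 hM] := trig_int_bound (smooth_continuous (k := 5) sg).
have [M' M'0 hM'] := trig_int_bound (smooth_continuous (k := 0) sg).
exists (2 ^+ 5 * M + M'); first by rewrite addr_ge0// mulr_ge0// exprn_ge0.
move=> n; have [->|n0] := eqVneq n 0.
  rewrite /br normr0 addr0 expr1n mul1r; apply: le_trans (hM' 0) _.
  by rewrite lerDr mulr_ge0// exprn_ge0.
have n1 : 1 <= `|n%:~R : R|.
  by rewrite -intr_norm -[1]/(1%:~R) ler_int; move: n0; lia.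
apply: (@le_trans _ _ (2 ^+ 5 * M)); last by rewrite lerDl.
apply: le_trans (_ : 2 ^+ 5 * `|n%:~R| ^+ 5 * (`|cosint g n| + `|sinint g n|) <= _).
  rewrite ler_wpM2r ?addr_ge0// -exprMn lerXn2r ?nnegrE ?br_ge0 ?mulr_ge0//.
  by rewrite /br; lra.
by rewrite -mulrA ler_wpM2l ?exprn_ge0// steps.
Qed.

Lemma fourier_coefE (chi : R -> R) n : continuous chi ->
  fourier_coef (fun x => (chi x)%:C) n =
  ((2 * pi)^-1 * cosint chi n) +i* (- ((2 * pi)^-1 * sinint chi n)).
Proof.
move=> cchi; rewrite /fourier_coef /cintegral.
have -> : \int[mu]_(x in `[0%R, (2 * pi)%R])
   complex.Re ((chi x)%:C * (cos (n%:~R * x) -i* sin (n%:~R * x))) = cosint chi n.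
  by apply: eq_Rintegral => x _ /=; rewrite mul0r subr0.
have -> : \int[mu]_(x in `[0%R, (2 * pi)%R])
   complex.Im ((chi x)%:C * (cos (n%:~R * x) -i* sin (n%:~R * x))) =
   \int[mu]_(x in `[0%R, (2 * pi)%R]) (-1 * (chi x * sin (n%:~R * x))).
  by apply: eq_Rintegral => x _ /=; rewrite mul0r addr0; ring.
rewrite RintegralZl//.
  rewrite -/(sinint chi n); apply/eqP; rewrite eq_complex/=.
  by apply/andP; split; apply/eqP; ring.
apply: integrable_continuous; apply: within_continuous => x.
by apply: continuousM; [exact: cchi|exact: continuous_sinM].
Qed.

End Cutoff.

(** * Summability and positivity of the cut-off coefficients *)

Section FourierCutoff.
Variable R : realType.
Implicit Types (x y : R) (n m : int).

Local Notation mu := (@lebesgue_measure R).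

Lemma ler_sum_subset (f : int -> R) (s t : seq int) : uniq s -> uniq t ->
  (forall n, 0 <= f n) -> {subset s <= t} -> \sum_(n <- s) f n <= \sum_(n <- t) f n.
Proof.
move=> us ut f0 st; rewrite [leRHS](bigID (fun n => n \in s))/=.
rewrite -[X in _ <= X + _]big_filter.
have P : perm_eq [seq n <- t | n \in s] s.
  apply: uniq_perm; rewrite ?filter_uniq// => n.
  by rewrite mem_filter; case: (boolP (n \in s)) => // /st ->.
by rewrite (perm_big _ P) lerDl; apply: sumr_ge0.
Qed.

Lemma sub_zlist (s : seq int) : exists L, {subset s <= zlist L}.
Proof.
elim: s => [|n s [L hL]]; first by exists 0%N.
exists (L + `|n|%N)%N => k; rewrite inE mem_cat => /orP[/eqP ->|ks].
  case: n => p; apply/orP; [left|right]; apply: map_f; rewrite mem_iota; lia.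
have := hL k ks; rewrite mem_cat => /orP[/mapP[p]|/mapP[p]];
  rewrite mem_iota => hi ->; apply/orP; [left|right]; apply: map_f;
  rewrite mem_iota; lia.
Qed.

(** Telescoping 1/(1+q)^2 <= 1/q - 1/(1+q) gives at most 2 on each half-line. *)
Lemma sum_le_invbr2 : sum_le (fun n => (br R n ^+ 2)^-1) 4.
Proof.
have f0 n : 0 <= (br R n ^+ 2)^-1 by rewrite invr_ge0 exprn_ge0 ?br_ge0.
have tele (p : nat) : \sum_(i <- iota 0 p.+1) ((1 + i%:R : R) ^+ 2)^-1 <= 2 - (p.+1%:R)^-1.
  elim: p => [|p IH].
    by rewrite /= big_seq1 addr0 expr1n invr1; lra.
  rewrite -[p.+2]addn1 iotaD big_cat/= big_seq1 add0n.
  apply: le_trans (lerD IH (lexx _)) _.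
  have q0 : (0 : R) < p.+1%:R by rewrite ltr0n.
  rewrite [(p.+1 + 1)%N]addn1 -[p.+2%:R]nat1r; move: (p.+1%:R : R) q0 => q q0.
  have q1 : 0 < 1 + q by rewrite addr_gt0.
  have : ((1 + q) ^+ 2)^-1 <= q^-1 - (1 + q)^-1.
    have -> : q^-1 - (1 + q)^-1 = (q * (1 + q))^-1.
      by field; rewrite !gt_eqF.
    by rewrite lef_pV2 ?posrE ?exprn_gt0 ?mulr_gt0// expr2 ler_wpM2r ?lerDr// ltW.
  by lra.
apply/sum_leP => s us; have [L hL] := sub_zlist s.
apply: le_trans (ler_sum_subset us (zlist_uniq L) f0 hL) _.
rewrite /zlist big_cat !big_map.
have L0 : 0 <= (L.+1%:R : R)^-1 by rewrite invr_ge0.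
have T := tele L.
have h1 : \sum_(i <- iota 0 L.+1) (br R (Posz i) ^+ 2)^-1 <= 2 - (L.+1%:R)^-1.
  by apply: le_trans T; apply: ler_sum => i _; rewrite /br ger0_norm.
have h2 : \sum_(i <- iota 0 L.+1) (br R (Negz i) ^+ 2)^-1 <= 2 - (L.+1%:R)^-1.
  apply: le_trans T; apply: ler_sum => i _.
  rewrite lef_pV2 ?posrE ?exprn_gt0 ?br_gt0 ?ltr_wpDr//.
  rewrite lerXn2r ?nnegrE ?br_ge0 ?addr_ge0// /br lerD2l NegzE rmorphN/= normrN.
  by rewrite ger0_norm ?ler0n// ler_nat.
by apply: le_trans (lerD h1 h2) _; move: (L.+1%:R^-1) L0 => q q0; lra.
Qed.

Variables (omega : set R) (chi : R -> R).
Hypothesis hchi : cutoff omega chi.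

Let c := fourier_coef (fun x => (chi x)%:C).

Let cchi : continuous chi.
Proof. exact: (smooth_continuous (k := 0) (cutoff_smooth hchi)). Qed.

Lemma cutoff_wl1 : exists A, wl1 3 c A.
Proof.
have [M M0 hM] := trig_int_decay (cutoff_smooth hchi) (cutoff_periodic hchi).
exists ((2 * pi)^-1 * M * 4).
have p0 : 0 <= (2 * pi : R)^-1 by rewrite invr_ge0 ltW ?pi2_gt0.
apply: (sum_leW _ (lexx _) (sum_leZ (_ : 0 <= (2 * pi)^-1 * M) sum_le_invbr2)).
  move=> n; have b0 := br_gt0 R n.
  rewrite ler_pdivlMr ?exprn_gt0// mulrAC -exprD.
  rewrite /c fourier_coefE// /cabs/= normrN !normrM -mulrDr [`|_^-1|]ger0_norm//.
  by rewrite mulrCA ler_wpM2l.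
by rewrite mulr_ge0.
Qed.

(** The form is (2 pi)^(-1) times the integral of chi |sum_n z_n e^(inx)|^2, and chi is
    nonnegative. *)
Lemma cutoff_positive_kernel : positive_kernel c.
Proof.
move=> s z us.
have p0 : 0 <= (2 * pi : R)^-1 by rewrite invr_ge0 ltW ?pi2_gt0.
pose P n m := complex.Re ((z n)^*%C * z m); pose Q n m := complex.Im ((z n)^*%C * z m).
pose G (n m : int) x := P n m * (chi x * cos ((n - m)%:~R * x)) +
  Q n m * (chi x * sin ((n - m)%:~R * x)).
have c1 n : continuous (fun x => chi x * cos (n%:~R * x)).
  by move=> x; apply: continuousM; [exact: cchi|exact: continuous_cosM].
have c2 n : continuous (fun x => chi x * sin (n%:~R * x)).
  by move=> x; apply: continuousM; [exact: cchi|exact: continuous_sinM].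
have cP n m : continuous (fun x => P n m * (chi x * cos ((n - m)%:~R * x))).
  exact: continuous_mull.
have cQ n m : continuous (fun x => Q n m * (chi x * sin ((n - m)%:~R * x))).
  exact: continuous_mull.
have cG n m : continuous (G n m).
  by move=> x; apply: cvgD; [exact: cP|exact: cQ].
have GE n m : complex.Re ((z n)^*%C * (c (n - m) * z m)) =
    (2 * pi)^-1 * \int[mu]_(x in `[0, 2 * pi]) G n m x.
  rewrite RintegralD//; try by apply: integrable_continuous; exact: within_continuous.
  rewrite RintegralZl//; last by apply: integrable_continuous; exact: within_continuous.
  rewrite RintegralZl//; last by apply: integrable_continuous; exact: within_continuous.
  rewrite -/(cosint chi (n - m)) -/(sinint chi (n - m)) /c fourier_coefE// /P /Q.
  by case: (z n) (z m) => [a b] [a' b']/=; ring.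
have -> : \sum_(n <- s) complex.Re ((z n)^*%C * \sum_(m <- s) c (n - m) * z m) =
    (2 * pi)^-1 * \int[mu]_(x in `[0, 2 * pi]) (\sum_(n <- s) \sum_(m <- s) G n m x).
  rewrite Rintegral_sum; last by move=> n; apply: continuous_sum => m; exact: cG.
  rewrite mulr_sumr; apply: eq_bigr => n _.
  rewrite mulr_sumr Re_sum Rintegral_sum; last by move=> m; exact: cG.
  by rewrite mulr_sumr; apply: eq_bigr => m _; exact: GE.
rewrite mulr_ge0// Rintegral_ge0// => x _.
(* [A n] and [B n] are the real and imaginary parts of z_n e^(inx). *)
pose A n := complex.Re (z n) * cos (n%:~R * x) - complex.Im (z n) * sin (n%:~R * x).
pose B n := complex.Re (z n) * sin (n%:~R * x) + complex.Im (z n) * cos (n%:~R * x).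
have -> : \sum_(n <- s) \sum_(m <- s) G n m x =
    chi x * ((\sum_(n <- s) A n) ^+ 2 + (\sum_(n <- s) B n) ^+ 2).
  rewrite !expr2 !mulr_suml -big_split mulr_sumr; apply: eq_bigr => n _.
  rewrite !mulr_sumr -big_split mulr_sumr; apply: eq_bigr => m _ /=.
  rewrite /G /P /Q /A /B rmorphB/= mulrBl cosB sinB.
  by case: (z n) (z m) => [a b] [a' b']/=; ring.
by rewrite mulr_ge0 ?(cutoff_ge0 hchi)// addr_ge0 ?sqr_ge0.
Qed.

End FourierCutoff.

(** * From Sobolev norms to weighted sums; the smoothing map *)

Section SobolevNorms.
Variable R : realType.
Implicit Types (u w c : pdist R) (s M B : R) (n : int).

Lemma two_pi_ge1 : 1 <= 2 * pi :> R.
Proof. by have := pi_ge2 R; lra. Qed.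

Lemma L2norm_sqr u :
  (L2norm u ^+ 2 = (2 * pi)%:E * nnsum (fun n => sqmod (u n)))%E.
Proof.
rewrite /L2norm -/(nnsum _).
have x0 : (0 <= (2 * pi)%:E * nnsum (fun n => sqmod (u n)))%E.
  by rewrite mule_ge0 ?lee_fin ?(ltW (pi2_gt0 R))// nnsum_ge0// => n; exact: sqmod_ge0.
by rewrite poweR12_sqrt// sqr_sqrte.
Qed.

Lemma L2norm_ge0 u : (0 <= L2norm u)%E.
Proof. exact: poweR_ge0. Qed.

Lemma L2norm_le_sum u M : (L2norm u <= M%:E)%E ->
  sum_le (fun n => sqmod (u n)) (M ^+ 2).
Proof.
move=> uM; have n0 := L2norm_ge0 u.
have M0 : 0 <= M by rewrite -lee_fin (le_trans n0).
have : ((L2norm u) ^+ 2 <= (M ^+ 2)%:E)%E.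
  by rewrite EFin_expe !expe2; apply: lee_pmul.
rewrite L2norm_sqr => h; apply: le_trans h.
apply: lee_pemull; first by apply: nnsum_ge0 => n; exact: sqmod_ge0.
by rewrite lee_fin two_pi_ge1.
Qed.

Lemma sqmodZ (a : R) (z : R[i]) : sqmod (a%:C * z) = a ^+ 2 * sqmod z.
Proof. by case: z => x y; rewrite /sqmod/=; ring. Qed.

(** The factor 2^p comes from (1 + |n|)^2 <= 2 (1 + n^2), and one more factor 2 from comparing
    [cabs] with the modulus. *)
Lemma sob_Hnorm (p : nat) s u M : p%:R <= s -> (Hnorm s u <= M%:E)%E ->
  sob (2 * p)%N u (2 ^+ p.+1 * M ^+ 2).
Proof.
move=> ps /L2norm_le_sum h.
apply: (sum_leW _ (lexx _) (sum_leZ (exprn_ge0 p.+1 (ler0n R 2)) h)) => n.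
rewrite /bracketD /fmultiplier sqmodZ exprMn.
have b1 : 1 <= 1 + (n%:~R : R) ^+ 2 by rewrite lerDl sqr_ge0.
have b0 : 0 <= 1 + (n%:~R : R) ^+ 2 by rewrite (le_trans _ b1).
have e : hw R (2 * p)%N n ^+ 2 = (br R n ^+ 2) ^+ p.
  by rewrite /hw -exprnP -jw_sqr -!exprM; congr (_ ^+ _); lia.
have h1 : (br R n ^+ 2) ^+ p <= 2 ^+ p * (1 + n%:~R ^+ 2) ^+ p.
  rewrite -exprMn lerXn2r ?nnegrE ?sqr_ge0 ?mulr_ge0//.
  by apply: le_trans (sqrD_le _ _) _; rewrite expr1n real_normK ?num_real//; lra.
have h2 : (1 + (n%:~R : R) ^+ 2) ^+ p <= ((1 + n%:~R ^+ 2) `^ (s / 2)) ^+ 2.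
  rewrite -[leRHS]powR_mulrn ?powR_ge0// -powRrM.
  have -> : s / 2 * 2%:R = s by rewrite divfK.
  by rewrite -powR_mulrn// ler_powR.
have h3 := cabs_le_sqmod (u n).
rewrite e [2 ^+ p.+1]exprSr.
have p2 : 0 <= (2 : R) ^+ p by rewrite exprn_ge0.
apply: le_trans (_ : 2 ^+ p * ((1 + n%:~R ^+ 2) `^ (s / 2)) ^+ 2 * (2 * sqmod (u n)) <= _).
  apply: ler_pM; rewrite ?exprn_ge0 ?cabs_ge0 ?br_ge0//.
  by apply: le_trans h1 _; rewrite ler_wpM2l.
by rewrite le_eqVlt; apply/orP; left; apply/eqP; ring.
Qed.

(** Embedding of H^3: the weighted modulus is the product of [br n] ^-1, which is square summable,
    and br n ^+ 3 times the modulus. The free t makes the bound small when B is small. *)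
Lemma wl1_sob6 c B (t : R) : 0 < t -> sob 6 c B ->
  wl1 2 c ((t * 4 + B / t) / 2).
Proof.
move=> t0 cB; have ti0 : 0 <= t^-1 by rewrite invr_ge0 ltW.
have := sum_leD (sum_leZ (ltW t0) (sum_le_invbr2 R)) (sum_leZ ti0 cB).
move=> /(sum_leZ (_ : 0 <= 2^-1)); rewrite invr_ge0 => /(_ (ler0n _ _)).
apply: sum_leW => [n|]; last by rewrite mulrC [t^-1 * _]mulrC.
have -> : hw R 6 n = br R n ^+ 3.
  by rewrite /hw -jw_sqr -exprM.
have b0 := br_gt0 R n; move: (br R n) (cabs (c n)) b0 => b x b0.
have bn : b != 0 by rewrite gt_eqF.
have tn : t != 0 by rewrite gt_eqF.
have -> : 2^-1 * (t * (b ^+ 2)^-1 + t^-1 * (b ^+ 3 * x) ^+ 2) =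
  b ^+ 2 * x + (2 * t * b ^+ 2)^-1 * (t - b ^+ 4 * x) ^+ 2 by field; rewrite bn tn.
by rewrite lerDl mulr_ge0 ?sqr_ge0// invr_ge0 !mulr_ge0 ?sqr_ge0// ltW.
Qed.

Lemma sob_L2 u B : sum_le (fun n => sqmod (u n)) B -> sob 0 u (2 * B).
Proof.
move=> /(sum_leZ (ler0n R 2)); apply: sum_leW => // n.
by rewrite hw0 mul1r cabs_le_sqmod.
Qed.

Lemma sob0_sqmod u B : sob 0 u B -> sum_le (fun n => sqmod (u n)) B.
Proof.
by apply: sum_leW => // n; rewrite hw0 mul1r sqmod_le_cabs.
Qed.

Section Smoothing.
Variables (N : nat) (W : pdist R -> pdist R) (sigma : R).
Hypotheses (hN : (1 <= N)%N) (hW : smoothing_map N W) (hsigma : 2 <= sigma).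

Let s3 : 3%:R <= sigma + N%:R.
Proof.
have : (1 : R) <= N%:R by rewrite ler1n.
by move=> h; have := hsigma; lra.
Qed.

Lemma Hnorm_bracketD s u : Hnorm (s + N%:R) (bracketD (- N%:R) u) = Hnorm s u.
Proof.
rewrite /Hnorm; congr L2norm; apply/funext => n.
rewrite /bracketD /fmultiplier mulrA -rmorphM/= -powRD.
  by congr (_ * _); congr (_%:C); congr (_ `^ _); ring.
apply/implyP => _; rewrite gt_eqF//.
by rewrite (@lt_le_trans _ _ 1)// lerDl sqr_ge0.
Qed.

(** W gains N >= 1 derivatives over sigma >= 2, hence W u is bounded in H^3. *)
Lemma smoothing_wl1 M : exists2 A, 0 <= A & forall u, (Hnorm sigma u <= M%:E)%E ->
  wl1 2 (W u) A /\ preal (W u).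
Proof.
have [k k0 hk] := smoothing_bound hW (sigma + N%:R).
exists ((1 * 4 + 2 ^+ 4 * (k * M) ^+ 2 / 1) / 2).
  by have := sqr_ge0 (k * M); rewrite divr1; lra.
move=> u uM; have uH : inH sigma u by exact: le_lt_trans uM (ltry M).
split; last exact: (smoothing_real hW uH).
apply: wl1_sob6 => //; apply: (@sob_Hnorm 3) s3 _.
rewrite EFinM; apply: le_trans (hk u _) _; first by rewrite addrK.
by rewrite Hnorm_bracketD lee_pmul2l ?lte_fin.
Qed.

Lemma smoothing_wl1_continuous u (e : R) : inH sigma u -> 0 < e ->
  exists2 d, 0 < d & forall u', inH sigma u' ->
    (Hnorm sigma (psub u' u) < d%:E)%E -> wl1 2 (psub (W u') (W u)) e.
Proof.
move=> uH e0; have uH' : inH (sigma + N%:R - N%:R) u by rewrite addrK.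
have [_ h] := smoothing_continuous hW uH'.
have e8 : 0 < e / 8 by rewrite divr_gt0.
have [d d0 hd] := h _ e8; exists d => // u' u'H ud.
have := hd u'; rewrite addrK => /(_ u'H ud) /ltW /(sob_Hnorm s3) hs.
(* With t = e/4 in [wl1_sob6] and H^3 size e/8, both terms contribute e/2. *)
have e4 : 0 < e / 4 by rewrite divr_gt0.
have := wl1_sob6 e4 hs.
have -> // : (e / 4 * 4 + 2 ^+ 4 * (e / 8) ^+ 2 / (e / 4)) / 2 = e.
by field; rewrite gt_eqF.
Qed.

Lemma WepsE eps u : 0 < eps -> inH sigma u -> Weps W eps u = W u.
Proof.
move=> eps0 uH; rewrite /Weps (smoothing_scale hW _ uH).
apply/funext => n; rewrite /pscale mulrA -rmorphM/= mulVf ?gt_eqF//.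
by rewrite mul1r.
Qed.

End Smoothing.

End SobolevNorms.

(** * Smooth steps and the du Bois-Reymond lemma *)

Section SmoothStep.
Variable R : realType.
Implicit Types (f g : R -> R) (x y : R).

Lemma is_derive_eps f x (l : R) : (forall e, 0 < e -> exists2 d, 0 < d &
    forall h, h != 0 -> `|h| < d -> `|f (x + h) - f x - h * l| <= e * `|h|) ->
  is_derive x 1 f l.
Proof.
move=> H.
have cv : h^-1 *: ((f \o shift x) (h *: (1 : R)) - f x) @[h --> 0^'] --> l.
  apply/cvgrPdist_le => e e0; have [d d0 hd] := H e e0.
  exists d => //= h; rewrite /= sub0r normrN => hd' h0.
  have -> : (h *: 1 + x : R) = x + h by rewrite /GRing.scale/= mulr1 addrC.
  rewrite /GRing.scale/= distrC.
  have -> : h^-1 * (f (x + h) - f x) - l = h^-1 * (f (x + h) - f x - h * l) by field.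
  rewrite normrM normfV mulrC ler_pdivrMr ?normr_gt0//; exact: hd.
apply: DeriveDef; first by apply/cvg_ex; exists l.
by apply: cvg_lim cv; exact: Rhausdorff.
Qed.

(** Recursion on the derivative of f itself, so that closure under sums, products, inverses and
    affine substitutions follows by induction on the order. *)
Fixpoint diffn (n : nat) f : Prop :=
  if n is n'.+1 then (forall x, derivable f x 1) /\ diffn n' f^`()%classic else True.

Lemma diffn_smooth f : (forall n, diffn n f) -> smooth f.
Proof.
move=> + n; elim: n f => [|n IH] f h x; first by have [] := h 1%N.
rewrite derive1Sn; apply: IH => m; by have [] := h m.+1.
Qed.

Lemma diffn_is_derive n f g : (forall x, is_derive x 1 f (g x)) -> diffn n g ->
  diffn n.+1 f.
Proof.
move=> fg gn; split; first by move=> x; case: (fg x).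
have -> // : f^`()%classic = g.
by apply/funext => x; rewrite derive1E; exact: derive_val.
Qed.

Lemma diffnS n f : diffn n.+1 f -> diffn n f.
Proof.
elim: n f => // n IH f [df h]; split=> //; exact: IH.
Qed.

Lemma diffn_derive n f x : diffn n.+1 f -> is_derive x 1 f (f^`()%classic x).
Proof.
by move=> [df _]; apply: DeriveDef; [exact: df|rewrite derive1E].
Qed.

Lemma diffn_cst n (k : R) : diffn n (fun=> k).
Proof.
elim: n k => // n IH k.
have d x : is_derive x 1 (fun=> k) (0 : R) by exact: is_derive_cst.
exact: (diffn_is_derive d (IH 0)).
Qed.

Lemma diffnD n f g : diffn n f -> diffn n g -> diffn n (fun x => f x + g x).
Proof.
elim: n f g => // n IH f g fn gn.
apply: (@diffn_is_derive _ _ (fun x => f^`()%classic x + g^`()%classic x)).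
  by move=> x; exact: is_deriveD (diffn_derive x fn) (diffn_derive x gn).
by apply: IH; [case: fn|case: gn].
Qed.

Lemma diffnM n f g : diffn n f -> diffn n g -> diffn n (fun x => f x * g x).
Proof.
elim: n f g => // n IH f g fn gn.
apply: (@diffn_is_derive _ _ (fun x => f x * g^`()%classic x + g x * f^`()%classic x)).
  move=> x; have := is_deriveM (diffn_derive x fn) (diffn_derive x gn).
  by [].
by apply: diffnD; apply: IH; [exact: diffnS|case: gn|exact: diffnS|case: fn].
Qed.

Lemma diffnV n f : (forall x, f x != 0) -> diffn n f -> diffn n (fun x => (f x)^-1).
Proof.
move=> f0; elim: n => // n IH fn.
apply: (@diffn_is_derive _ _ (fun x => (-1 * ((f x)^-1 * (f x)^-1)) * f^`()%classic x)).
  move=> x; have := is_deriveV (f0 x) (diffn_derive x fn).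
  by move=> H; apply: is_derive_eq; rewrite /GRing.scale/= -exprVn expr2 mulN1r.
have h := IH (diffnS fn); apply: diffnM; last by case: fn.
by apply: diffnM; [exact: diffn_cst|exact: diffnM].
Qed.

Lemma is_derive_affine (a b x : R) : is_derive x 1 (fun y => a * y + b) a.
Proof.
have := is_deriveD (is_deriveZ a (is_derive_id x (1 : R))) (is_derive_cst b x (1 : R)).
by move=> H; apply: is_derive_eq; rewrite /GRing.scale/= mulr1 addr0.
Qed.

Lemma is_derive_comp_affine f (a b l x : R) : is_derive (a * x + b) 1 f l ->
  is_derive x 1 (fun y => f (a * y + b)) (l * a).
Proof. by move=> fl; exact: (@is_derive1_comp _ f (fun y => a * y + b) x l a fl (is_derive_affine a b x)). Qed.

Lemma diffn_affine n f (a b : R) : diffn n f -> diffn n (fun x => f (a * x + b)).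
Proof.
elim: n f => // n IH f fn.
have D x : is_derive x 1 (fun x => f (a * x + b)) (f^`()%classic (a * x + b) * a).
  exact: is_derive_comp_affine (diffn_derive _ fn).
apply: (diffn_is_derive D); apply: diffnM; last exact: diffn_cst.
by apply: IH; case: fn.
Qed.

(** The functions x^(-k) exp(-1/x), extended by 0. Derivatives of this family stay in its span, so
    all of them are smooth at once by induction. *)
Definition flat (k : nat) x : R := if 0 < x then x^-1 ^+ k * expR (- x^-1) else 0.

Lemma flat_ge0 k x : 0 <= flat k x.
Proof.
rewrite /flat; case: ifPn => // x0.
by rewrite mulr_ge0 ?expR_ge0// exprn_ge0// invr_ge0 ltW.
Qed.

Lemma flat_gt0 k x : 0 < x -> 0 < flat k x.
Proof. by move=> x0; rewrite /flat x0 mulr_gt0 ?expR_gt0// exprn_gt0// invr_gt0. Qed.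

Lemma flat_le0 k x : x <= 0 -> flat k x = 0.
Proof. by rewrite /flat leNgt => /negbTE ->. Qed.

(** One term of the exponential series at 1/x, of degree k + 2. The quadratic decay gives derivative
    0 at the origin. *)
Lemma flat_quadratic k x : flat k x <= (k.+2)`!%:R * x ^+ 2.
Proof.
rewrite /flat; case: ifPn => [x0|_]; last by rewrite mulr_ge0 ?sqr_ge0.
have y0 : 0 < x^-1 by rewrite invr_gt0.
have := expR_ge1Dxn k.+1 (ltW y0) => h.
rewrite expRN ler_pdivrMr ?expR_gt0//.
have -> : (k.+2)`!%:R * x ^+ 2 * expR x^-1 = x ^+ 2 * ((k.+2)`!%:R * expR x^-1) by ring.
apply: (@le_trans _ _ (x ^+ 2 * (x^-1 ^+ k.+2))).
  rewrite -[k.+2]addn2 exprD [_ ^+ k * _]mulrC mulrA -exprMn divff ?gt_eqF//.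
  by rewrite expr1n mul1r.
rewrite ler_wpM2l ?sqr_ge0// mulrC -ler_pdivrMr ?ltr0n ?fact_gt0//.
by apply: le_trans h; rewrite lerDr.
Qed.

Lemma is_derive_pow f x (d : R) (k : nat) : is_derive x 1 f d ->
  is_derive x 1 (fun y => f y ^+ k) (k%:R * f x ^+ k.-1 * d).
Proof.
move=> fd; have := is_deriveX k fd.
have -> : (f ^+ k) = fun y => f y ^+ k by apply/funext => y; rewrite exprfctE.
by [].
Qed.

Lemma is_derive_flat k x :
  is_derive x 1 (flat k) (- k%:R * flat k.+1 x + flat k.+2 x).
Proof.
have [x0|x0|->] := ltrgtP x 0.
- have -> : - k%:R * flat k.+1 x + flat k.+2 x = 0.
    by rewrite !flat_le0 ?ltW// mulr0 addr0.
  have d0 : is_derive x 1 (fun=> 0) (0 : R) by exact: is_derive_cst.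
  apply: near_eq_is_derive d0.
  near=> y; rewrite flat_le0//; apply: ltW; near: y; exact: lt_nbhsl.
- have xn0 : x != 0 by rewrite gt_eqF.
  apply: (near_eq_is_derive (f := fun y => y^-1 ^+ k * expR (- y^-1))).
    near=> y; rewrite /flat ifT//; near: y; exact: lt_nbhsr.
  have d1 : is_derive x 1 (fun y : R => y^-1) (- x ^- 2).
    have := is_deriveV (f := id) xn0 (is_derive_id x (1 : R)).
    by move=> H; apply: is_derive_eq; rewrite /GRing.scale/= mulr1.
  have d2 := is_derive_pow k d1.
  have d3 : is_derive x 1 (fun y : R => - y^-1) (x ^- 2).
    by have := is_deriveN d1; rewrite opprK.
  have d4 := is_derive1_comp (is_derive_expR _) d3.
  have H := is_deriveM d2 d4; apply: (is_derive_eq H).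
  rewrite /flat x0 /GRing.scale/=.
  rewrite [in RHS]exprS [in RHS]exprS !exprVn.
  case: k {d2 H} => [|k]; first by rewrite !mul0r expr0 invr1; field.
  by rewrite -[k.+1.-1]/k !exprS -mulr_natr; field; rewrite expf_neq0.
- have -> : - k%:R * flat k.+1 (0 : R) + flat k.+2 0 = 0.
    by rewrite !flat_le0// mulr0 addr0.
  apply: is_derive_eps => e e0.
  have F0 : (0 : R) < (k.+2)`!%:R by rewrite ltr0n fact_gt0.
  exists (e / (k.+2)`!%:R); first by rewrite divr_gt0.
  move=> h h0; rewrite ltr_pdivlMr// => hd.
  rewrite add0r (@flat_le0 _ 0)// subr0 mulr0 subr0 ger0_norm ?flat_ge0//.
  apply: le_trans (flat_quadratic _ _) _.
  rewrite -[h ^+ 2]real_normK ?num_real// expr2 mulrA ler_wpM2r// mulrC; exact: ltW.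
Unshelve. all: by end_near. Qed.

Lemma diffn_flat n k : diffn n (flat k).
Proof.
elim: n k => // n IH k; apply: diffn_is_derive (is_derive_flat k) _.
by apply: diffnD => //; apply: diffnM => //; exact: diffn_cst.
Qed.

Definition stepden x := flat 0 x + flat 0 (- 1 * x + 1).

Lemma stepden_gt0 x : 0 < stepden x.
Proof.
have [x0|x0] := ltrP 0 x.
  by rewrite ltr_pwDl ?flat_gt0 ?flat_ge0.
by rewrite ltr_wpDl ?flat_ge0// flat_gt0//; lra.
Qed.

Definition step x := flat 0 x / stepden x.

Definition dstep x := (flat 2 x * flat 0 (- 1 * x + 1) +
  flat 0 x * flat 2 (- 1 * x + 1)) / (stepden x ^+ 2).

Lemma is_derive_step x : is_derive x 1 step (dstep x).
Proof.
have e y : - 0%:R * flat 1 y + flat 2 y = flat 2 y by rewrite oppr0 mul0r add0r.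
have d0 y : is_derive y 1 (flat 0) (flat 2 y).
  by rewrite -e; exact: is_derive_flat.
have d1 := is_derive_comp_affine (d0 (- 1 * x + 1)).
have d2 := is_deriveD (d0 x) d1.
have n0 : stepden x != 0 by rewrite gt_eqF// stepden_gt0.
have d3 := is_deriveV (f := stepden) n0 d2.
have := is_deriveM (d0 x) d3 => H; apply: is_derive_eq.
rewrite /dstep /GRing.scale/=; move: n0; rewrite /stepden => n0; field.
exact: n0.
Qed.

Lemma dstep_ge0 x : 0 <= dstep x.
Proof.
by rewrite divr_ge0 ?sqr_ge0// addr_ge0// mulr_ge0// flat_ge0.
Qed.

Lemma step_le0 x : x <= 0 -> step x = 0.
Proof. by move=> x0; rewrite /step flat_le0// mul0r. Qed.

Lemma step_ge1 x : 1 <= x -> step x = 1.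
Proof.
move=> x1; rewrite /step /stepden (@flat_le0 _ (- 1 * x + 1)) ?addr0; last by lra.
by rewrite divff// gt_eqF// flat_gt0//; lra.
Qed.

Lemma dstep_out x : x <= 0 \/ 1 <= x -> dstep x = 0.
Proof.
move=> [x0|x1]; rewrite /dstep.
  by rewrite !(@flat_le0 _ x)// !mul0r addr0 mul0r.
by rewrite !(@flat_le0 _ (- 1 * x + 1)) ?mulr0 ?addr0 ?mul0r//; lra.
Qed.

Lemma smooth_step_at (p d : R) : 0 < d -> exists S dS : R -> R,
  [/\ forall n, diffn n S, forall x, is_derive x 1 S (dS x), forall x, 0 <= dS x,
    forall x, x <= p -> S x = 0 & forall x, p + d <= x -> S x = 1] /\
  (forall x, x <= p \/ p + d <= x -> dS x = 0).
Proof.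
move=> d0; have di : 0 < d^-1 by rewrite invr_gt0.
have dn : d != 0 by rewrite gt_eqF.
exists (fun x => step (d^-1 * x + - (d^-1 * p))).
exists (fun x => dstep (d^-1 * x + - (d^-1 * p)) * d^-1).
have le0 x : x <= p -> d^-1 * x + - (d^-1 * p) <= 0.
  by move=> xp; rewrite subr_le0 ler_wpM2l// ltW.
have ge1 x : p + d <= x -> 1 <= d^-1 * x + - (d^-1 * p).
  move=> xp; rewrite -mulrBr mulrC ler_pdivlMr// mul1r; lra.
split; [split|].
- move=> n; apply: (@diffn_affine n step).
  apply: diffnM; first exact: diffn_flat.
  apply: diffnV; first by move=> x; rewrite gt_eqF// stepden_gt0.
  by apply: diffnD; [|apply: diffn_affine]; exact: diffn_flat.
- by move=> x; exact: is_derive_comp_affine (is_derive_step _).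
- by move=> x; rewrite mulr_ge0 ?dstep_ge0// ltW.
- by move=> x /le0; exact: step_le0.
- by move=> x /ge1; exact: step_ge1.
- by move=> x [/le0|/ge1] h; rewrite dstep_out ?mul0r//; [left|right].
Qed.

End SmoothStep.

(** * The du Bois-Reymond lemma *)

Section DuBoisReymond.
Variable R : realType.
Implicit Types (f g F H phi : R -> R) (a b x T : R).

Local Notation mu := (@lebesgue_measure R).

Lemma within_itv_continuous T f x : 0 < T -> {within `[0, T], continuous f} ->
  x \in `]0, T[ -> {for x, continuous f}.
Proof. by move=> T0 /(continuous_within_itvP _ T0)[cf _ _] /cf. Qed.

Lemma continuous_for_eps f x (e : R) : {for x, continuous f} -> 0 < e ->
  exists2 d, 0 < d & forall y, `|y - x| < d -> `|f y - f x| < e.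
Proof.
move=> /cvgrPdist_lt cf e0; have /nbhs_ballP[d /= d0 hd] := cf e e0.
exists d => // y xy; rewrite distrC; apply: hd.
by rewrite /ball/= distrC.
Qed.

Lemma test_function_zero T phi t : test_function T phi ->
  t <= 0 \/ T <= t -> phi t = 0.
Proof.
move=> [_ [a [b [a0 bT h]]]] ht; apply: h.
by apply/negP; rewrite in_itv/= => /andP[at_ tb]; case: ht => ?; lra.
Qed.

Lemma test_function_derive T phi x : test_function T phi ->
  is_derive x 1 phi (phi^`()%classic x).
Proof. by move=> [sp _]; exact: (smooth_is_derive 0 x sp). Qed.

Lemma test_function_continuous T phi : test_function T phi -> continuous phi.
Proof. by move=> [sp _]; exact: (smooth_continuous (k := 0) sp). Qed.

Lemma test_function_continuous' T phi : test_function T phi ->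
  continuous phi^`()%classic.
Proof. by move=> [sp _]; exact: (smooth_continuous (k := 1) sp). Qed.

Lemma within_continuousM T f g : {within `[0, T], continuous f} ->
  {within `[0, T], continuous g} -> {within `[0, T], continuous (fun t => f t * g t)}.
Proof. by move=> cf cg z; apply: continuousM; [exact: cf|exact: cg]. Qed.

Lemma within_continuousD T f g : {within `[0, T], continuous f} ->
  {within `[0, T], continuous g} -> {within `[0, T], continuous (fun t => f t + g t)}.
Proof. by move=> cf cg z; apply: cvgD; [exact: cf|exact: cg]. Qed.

Lemma within_continuousN T f : {within `[0, T], continuous f} ->
  {within `[0, T], continuous (fun t => - f t)}.
Proof. by move=> cf z; apply: cvgN; exact: cf. Qed.

Lemma within_derivable_oo T f : 0 < T -> {within `[0, T], continuous f} ->
  {in `]0, T[, forall x, derivable f x 1} -> derivable_oo_LRcontinuous f 0 T.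
Proof. by move=> T0 /(continuous_within_itvP _ T0)[_ cl cr] df; split. Qed.

Lemma primitive T f : 0 < T -> {within `[0, T], continuous f} ->
  exists2 F : R -> R, {within `[0, T], continuous F} &
    forall x, x \in `]0, T[ -> is_derive x 1 F (f x).
Proof.
move=> T0 cf; have intf := integrable_continuous cf.
exists (fun x => \int[mu]_(t in `[0, x]) f t).
  exact: (parameterized_integral_continuous (ltW T0) intf).
move=> x xT; have cfx := within_itv_continuous T0 cf xT.
move: xT; rewrite in_itv/= => /andP[x0 xT].
have [d e] := continuous_FTC1_closed xT intf x0 cfx.
by apply: DeriveDef; [exact: d|rewrite -derive1E; exact: e].
Qed.

Lemma test_function_by_parts T phi F f : 0 < T -> test_function T phi ->
  {within `[0, T], continuous f} -> {within `[0, T], continuous F} ->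
  (forall x, x \in `]0, T[ -> is_derive x 1 F (f x)) ->
  \int[mu]_(t in `[0, T]) (phi^`()%classic t * F t + phi t * f t) = 0.
Proof.
move=> T0 tphi cf cF dF.
have cphi := within_continuous (A := `[0, T]) (test_function_continuous tphi).
have cphi' := within_continuous (A := `[0, T]) (test_function_continuous' tphi).
have c1 := within_continuousM cphi' cF; have c2 := within_continuousM cphi cf.
have D x : x \in `]0, T[ ->
    is_derive x 1 (fun t => phi t * F t) (phi^`()%classic x * F x + phi x * f x).
  move=> xT; have H := is_deriveM (test_function_derive x tphi) (dF x xT).
  by apply: (is_derive_eq H); rewrite /GRing.scale/= addrC mulrC.
rewrite /Rintegral (@continuous_FTC2 R _ (fun t => phi t * F t) 0 T)//.
- rewrite !(test_function_zero tphi) ?mul0r ?subee//; [by left|by right].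
- exact: within_continuousD.
- apply: within_derivable_oo => //; first exact: within_continuousM.
  by move=> x /D; case.
- by move=> x /D xD; rewrite derive1E; exact: derive_val.
Qed.

(** The test function rises just after p and descends just after q, so that pairing its derivative
    with H compares averages of H near p and near q. *)
Lemma weak_constant_le T H (p q : R) : 0 < T -> {within `[0, T], continuous H} ->
  (forall phi, test_function T phi ->
    \int[mu]_(t in `[0, T]) (phi^`()%classic t * H t) = 0) ->
  p \in `]0, T[ -> q \in `]0, T[ -> p < q -> H q <= H p.
Proof.
move=> T0 cH wH pT qT pq; rewrite leNgt; apply/negP => Hpq.
pose e := (H q - H p) / 4; have e0 : 0 < e by rewrite divr_gt0// subr_gt0.
have [r1 r10 h1] := continuous_for_eps (within_itv_continuous T0 cH pT) e0.
have [r2 r20 h2] := continuous_for_eps (within_itv_continuous T0 cH qT) e0.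
move: (pT) (qT); rewrite !in_itv/= => /andP[p0 pT'] /andP[q0 qT'].
pose d := Num.min (Num.min r1 r2) (T - q) / 2.
have d0 : 0 < d by rewrite divr_gt0// !lt_min r10 r20 subr_gt0.
have dle : d < Num.min (Num.min r1 r2) (T - q).
  by rewrite ltr_pdivrMr//; move: d0; rewrite /d pmulr_lgt0// => h; lra.
move: dle; rewrite !lt_min => /andP[/andP[dr1 dr2] dT].
have [S1 [S1' [[sS1 dS1 S1p S1l S1r] S1o]]] := smooth_step_at p d0.
have [S2 [S2' [[sS2 dS2 S2p S2l S2r] S2o]]] := smooth_step_at q d0.
pose phi t := S1 t + -1 * S2 t.
have Dphi x : is_derive x 1 phi (S1' x + -1 * S2' x).
  exact: is_deriveD (dS1 x) (is_deriveZ (-1) (dS2 x)).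
have phi'E x : phi^`()%classic x = S1' x + -1 * S2' x.
  by rewrite derive1E; exact: derive_val.
have tphi : test_function T phi.
  split.
    apply: diffn_smooth => n; apply: diffnD; first exact: sS1.
    by apply: diffnM; [exact: diffn_cst|exact: sS2].
  exists p, (q + d); split=> //; first by lra.
  move=> t; rewrite in_itv/= negb_and -!ltNge /phi => /orP[tp|tq].
    by rewrite S1l ?S2l ?mulr0 ?addr0//; lra.
  by rewrite S1r ?S2r; lra.
(* As e is a quarter of the gap, H <= c - e where S1 rises and H >= c + e where S2 rises. Hence G'
   dominates phi' H, while its integral is - 2 e. *)
pose c := (H p + H q) / 2.
pose G t := (c - e) * S1 t + (- (c + e)) * S2 t.
pose G' t := (c - e) * S1' t + (- (c + e)) * S2' t.
have DG x : is_derive x 1 G (G' x).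
  exact: is_deriveD (is_deriveZ (c - e) (dS1 x)) (is_deriveZ (- (c + e)) (dS2 x)).
have cS (S S' : R -> R) : (forall n, diffn n S) -> (forall x, is_derive x 1 S (S' x)) ->
    continuous S'.
  move=> sS dS; have -> : S' = S^`()%classic.
    by apply/funext => x; rewrite derive1E; apply/esym; exact: derive_val.
  exact: (smooth_continuous (k := 1) (diffn_smooth sS)).
have cG' : continuous G'.
  by move=> x; apply: cvgD; apply: continuous_mull; [exact: cS sS1 dS1|exact: cS sS2 dS2].
have GI := Rintegral_is_derive T0 DG cG'.
have : \int[mu]_(t in `[0, T]) (phi^`()%classic t * H t) <= \int[mu]_(t in `[0, T]) G' t.
  apply: le_Rintegral => //.
  - apply: integrable_continuous; apply: within_continuousM => //.
    by apply: within_continuous; exact: test_function_continuous' tphi.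
  - by apply: integrable_continuous; exact: within_continuous.
  move=> t _; rewrite phi'E /G'.
  have k1 : S1' t * H t <= (c - e) * S1' t.
    have [tp|tp] := lerP t p; first by rewrite S1o ?mul0r ?mulr0//; left.
    have [tq|tq] := lerP (p + d) t; first by rewrite S1o ?mul0r ?mulr0//; right.
    rewrite mulrC ler_wpM2r//.
    have : `|H t - H p| < e by apply: h1; rewrite ger0_norm; lra.
    by rewrite ltr_norml => /andP[_]; rewrite /c /e; lra.
  have k2 : (c + e) * S2' t <= S2' t * H t.
    have [tp|tp] := lerP t q; first by rewrite S2o ?mul0r ?mulr0//; left.
    have [tq|tq] := lerP (q + d) t; first by rewrite S2o ?mul0r ?mulr0//; right.
    rewrite [leRHS]mulrC ler_wpM2r//.
    have : `|H t - H q| < e by apply: h2; rewrite ger0_norm; lra.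
    by rewrite ltr_norml => /andP[+ _]; rewrite /c /e; lra.
  by lra.
rewrite wH// GI /G.
have -> : S1 T = 1 by apply: S1r; lra.
have -> : S2 T = 1 by apply: S2r; lra.
have -> : S1 0 = 0 by apply: S1l; lra.
have -> : S2 0 = 0 by apply: S2l; lra.
by move=> h; lra.
Qed.

Lemma weak_constant T H (p q : R) : 0 < T -> {within `[0, T], continuous H} ->
  (forall phi, test_function T phi ->
    \int[mu]_(t in `[0, T]) (phi^`()%classic t * H t) = 0) ->
  p \in `]0, T[ -> q \in `]0, T[ -> H p = H q.
Proof.
move=> T0 cH wH pT qT.
wlog pq : p q pT qT / p < q.
  move=> h; have [pq|qp|->//] := ltgtP p q; first exact: h.
  by apply/esym; exact: h.
apply/eqP; rewrite eq_le (weak_constant_le T0 cH wH pT qT pq) andbT.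
rewrite -lerN2; apply: (weak_constant_le (H := fun t => - H t) T0 _ _ pT qT pq).
  exact: within_continuousN.
move=> phi tphi.
transitivity (\int[mu]_(t in `[0, T]) (-1 * (phi^`()%classic t * H t))).
  by apply: eq_Rintegral => t _; ring.
rewrite RintegralZl ?wH ?mulr0//.
apply: integrable_continuous; apply: within_continuousM => //.
by apply: within_continuous; exact: test_function_continuous' tphi.
Qed.

(** If F is a primitive of f, then g + F is weakly constant, hence constant, and g inherits the
    derivative of - F. *)
Lemma du_bois_reymond T g f : 0 < T ->
  {within `[0, T], continuous g} -> {within `[0, T], continuous f} ->
  (forall phi, test_function T phi ->
    \int[mu]_(t in `[0, T]) (- phi^`()%classic t * g t + phi t * f t) = 0) ->
  forall x, x \in `]0, T[ -> is_derive x 1 g (- f x).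
Proof.
move=> T0 cg cf wgf; have [F cF dF] := primitive T0 cf.
pose H t := g t + F t.
have cH : {within `[0, T], continuous H} by exact: within_continuousD.
have wH phi : test_function T phi ->
    \int[mu]_(t in `[0, T]) (phi^`()%classic t * H t) = 0.
  move=> tphi.
  have cphi := within_continuous (A := `[0, T]) (test_function_continuous tphi).
  have cphi' := within_continuous (A := `[0, T]) (test_function_continuous' tphi).
  have e1 := test_function_by_parts T0 tphi cf cF dF.
  have e2 := wgf phi tphi.
  transitivity (\int[mu]_(t in `[0, T])
    ((phi^`()%classic t * F t + phi t * f t) -
     (- phi^`()%classic t * g t + phi t * f t))).
    by apply: eq_Rintegral => t _; rewrite /H; ring.
  rewrite RintegralB ?e1 ?e2 ?subr0//.
  - apply: integrable_continuous; apply: within_continuousD; exact: within_continuousM.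
  - apply: integrable_continuous; apply: within_continuousD; apply: within_continuousM => //.
    exact: within_continuousN.
move=> x xT.
have gE y : y \in `]0, T[ -> H x - F y = g y.
  by move=> yT; rewrite (weak_constant T0 cH wH xT yT) /H addrK.
have d : is_derive x 1 (fun y => H x - F y) (- f x).
  have h := is_deriveB (is_derive_cst (H x) x (1 : R)) (dF x xT).
  by apply: (is_derive_eq h); rewrite sub0r.
apply: near_eq_is_derive d.
move: (xT); rewrite in_itv/= => /andP[x0 xT'].
near=> y; apply: gE; rewrite in_itv/=; apply/andP; split; near: y.
  exact: lt_nbhsr.
exact: lt_nbhsl.
Unshelve. all: by end_near. Qed.

End DuBoisReymond.

(** * Passage to the limit in the differential inequality *)

Section DerivativeLe.
Variable R : realType.
Implicit Types (f g phi : R -> R) (x t T C K : R).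

Local Notation mu := (@lebesgue_measure R).

Lemma Rintegral_oo_cc T f : {within `[0, T], continuous f} ->
  \int[mu]_(t in `]0, T[) f t = \int[mu]_(t in `[0, T]) f t.
Proof.
move=> cf; have ic := integrable_continuous cf.
have s1 : `]0, T[ `<=` `[0, T] by exact: subset_itvW.
have s2 : `[0, T[ `<=` `[0, T].
  by move=> x /=; rewrite !in_itv/= => /andP[-> /ltW].
have i1 : mu.-integrable `]0, T[ (EFin \o f) by apply: (@integrableS _ _ R mu `[0, T]).
have i2 : mu.-integrable `[0, T[ (EFin \o f) by apply: (@integrableS _ _ R mu `[0, T]).
by rewrite (Rintegral_itv_obnd_cbnd i1) (Rintegral_itv_bndo_bndc i2).
Qed.

Lemma le_of_add_eq (A B x y : R) : A + B = x - y -> - x <= - y -> - B <= A.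
Proof. by move=> h1 h2; lra. Qed.

Lemma le_eps_lim (a b : R) : (forall d, 0 < d -> a <= b + d) -> a <= b.
Proof. by move=> h; apply/ler_addgt0Pr. Qed.

Section Approx.
Variables (T C K : R) (e : R -> R) (E dE : nat -> R -> R).
Hypotheses (T0 : 0 < T) (C0 : 0 <= C) (K0 : 0 <= K).
Hypothesis ce : {within `[0, T], continuous e}.
Hypothesis cE : forall L, {within `[0, T], continuous (E L)}.
Hypothesis E0 : forall L t, t \in `[0, T] -> 0 <= E L t <= e t.
Hypothesis Ecvg : forall t, t \in `[0, T] -> forall d, 0 < d ->
  exists L0, forall L, (L0 <= L)%N -> e t <= E L t + d.
Hypothesis dEP : forall L t, t \in `]0, T[ -> is_derive t 1 (E L) (dE L t).
Hypothesis dE_le : forall L t, t \in `]0, T[ ->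
  dE L t <= (C + K / L.+1%:R) * e t.

Let oo_cc t : t \in `]0, T[ -> t \in `[0, T].
Proof. by rewrite !in_itv/= => /andP[a b]; rewrite !ltW. Qed.

Let e_ge0 t : t \in `[0, T] -> 0 <= e t.
Proof. by move=> /(E0 0%N) /andP[a b]; exact: le_trans a b. Qed.

Lemma inv_succ_le (d : R) : 0 < d -> exists L0, forall L, (L0 <= L)%N ->
  K / L.+1%:R <= d.
Proof.
move=> d0; exists (Num.truncn (K / d)) => L hL.
rewrite ler_pdivrMr ?ltr0n// mulrC -ler_pdivrMr//.
have kd : 0 <= K / d by rewrite divr_ge0// ltW.
apply: ltW; apply: lt_le_trans (_ : (Num.truncn (K / d)).+1%:R <= _).
  by have := truncn_itv kd; move=> /andP[].
by rewrite ler_nat.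
Qed.

(** The mean value theorem for [E L] on [t, t + h], using E L <= e at the left end and convergence
    at the right end. With h fixed, L tends to infinity and the term with K disappears. *)
Lemma approx_local_increment t (r : R) : t \in `]0, T[ -> 0 < r ->
  exists2 d, 0 < d & forall h, 0 < h -> h < d ->
    e (t + h) - e t <= h * (C * (e t + r)).
Proof.
move=> tT r0; have [d1 d10 hd1] := continuous_for_eps (within_itv_continuous T0 ce tT) r0.
move: (tT); rewrite in_itv/= => /andP[t0 tT'].
exists (Num.min d1 (T - t)); first by rewrite lt_min d10 subr_gt0.
move=> h h0; rewrite lt_min => /andP[hd hT].
have er0 : 0 <= e t + r by rewrite addr_ge0 ?(ltW r0)// e_ge0// oo_cc.
have thT : t + h \in `[0, T] by rewrite in_itv/=; apply/andP; split; lra.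
apply: le_eps_lim => d d0; have d2 : 0 < d / 2 by rewrite divr_gt0.
have [L1 hL1] := Ecvg thT d2.
have hr0 : 0 < h * (e t + r) + 1 by rewrite ltr_wpDl// mulr_ge0// ltW.
have [L2 hL2] := inv_succ_le (divr_gt0 d2 hr0).
pose L := maxn L1 L2.
have {}hL1 := hL1 L (leq_maxl _ _); have {}hL2 := hL2 L (leq_maxr _ _).
have tth : t <= t + h by lra.
have D x : x \in `]t, (t + h)[ -> is_derive x 1 (E L) (dE L x).
  by rewrite in_itv/= => /andP[a b]; apply: dEP; rewrite in_itv/=; apply/andP; split; lra.
have cEL : {within `[t, (t + h)], continuous (E L)}.
  have sub : `[t, (t + h)] `<=` `[0, T].
    move=> x /=; rewrite !in_itv/= => /andP[a b].
    by apply/andP; split; lra.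
  exact: (continuous_subspaceW sub (@cE L)).
have tht : t < t + h by lra.
have [x xth eq] := MVT tht D cEL.
move: xth; rewrite in_itv/= => /andP[x1 x2].
have xT : x \in `]0, T[ by rewrite in_itv/=; apply/andP; split; lra.
have ex : e x <= e t + r.
  have : `|e x - e t| < r by apply: hd1; rewrite ger0_norm; lra.
  by rewrite ltr_norml => /andP[_]; lra.
have KL0 : 0 <= K / L.+1%:R by rewrite divr_ge0.
have b1 : dE L x <= (C + K / L.+1%:R) * (e t + r).
  by apply: le_trans (dE_le L xT) _; rewrite ler_wpM2l// addr_ge0.
have b2 : h * (K / L.+1%:R * (e t + r)) <= d / 2.
  have : K / L.+1%:R * (h * (e t + r) + 1) <= d / 2 by rewrite -ler_pdivlMr.
  by move: (K / L.+1%:R) KL0 => y y0; lra.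
have b3 := ler_wpM2r (ltW h0) b1.
have /andP[_ b4] := E0 L (oo_cc tT).
rewrite addrAC subrr add0r in eq.
move: (K / L.+1%:R) b1 b2 b3 KL0 {hL2} => y b1 b2 b3 y0.
have -> : h * (C * (e t + r)) = (C + y) * (e t + r) * h - h * (y * (e t + r)) by ring.
by lra.
Qed.

Lemma approx_derive_le t : t \in `]0, T[ -> derivable e t 1 ->
  e^`()%classic t <= C * e t.
Proof.
move=> tT de; have et0 := e_ge0 (oo_cc tT).
apply: le_eps_lim => d d0.
have C1 : 0 < C + 1 by rewrite ltr_wpDl.
pose r := d / (2 * (C + 1)); have r0 : 0 < r by rewrite divr_gt0// mulr_gt0.
have [d1 d10 h1] := approx_local_increment tT r0.
have d2 : 0 < d / 2 by rewrite divr_gt0.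
have : h^-1 *: (e (h *: (1 : R) + t) - e t) @[h --> 0^'] --> e^`()%classic t.
  by rewrite derive1E; exact: de.
move=> /cvgrPdist_lt /(_ _ d2) [d3 /= d30 h3].
pose h := Num.min d1 d3 / 2.
have m0 : 0 < Num.min d1 d3 by rewrite lt_min d10.
have h0 : 0 < h by rewrite divr_gt0.
have : h < Num.min d1 d3 by rewrite /h; lra.
rewrite lt_min => /andP[hd1 hd3].
have := h3 h; rewrite /= sub0r normrN gtr0_norm// => /(_ hd3 (lt0r_neq0 h0)).
rewrite /GRing.scale/= mulr1 [h + t]addrC => q.
have i1 := h1 h h0 hd1.
have i2 : h^-1 * (e (t + h) - e t) <= C * (e t + r) by rewrite ler_pdivrMl.
have i3 : C * r <= d / 2.
  rewrite /r mulrA ler_pdivrMr ?mulr_gt0//.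
  have -> : d / 2 * (2 * (C + 1)) = d * (C + 1) by field.
  by rewrite mulrC ler_wpM2l ?(ltW d0)// lerDl.
move: q; rewrite ltr_norml => /andP[_ q].
by move: (h^-1 * (e (t + h) - e t)) q i2 => y q i2; rewrite mulrDr in i2; lra.
Qed.

(** [dE L] carries no continuity assumption, so it is not integrated. Instead E phi - P, with P a
    primitive of the continuous remaining terms, has nonpositive derivative and is compared at 0 and
    T. *)
Lemma approx_weak_L phi L : test_function T phi -> (forall t, 0 <= phi t) ->
  - (\int[mu]_(t in `[0, T]) (E L t * phi^`()%classic t)) <=
  (C + K / L.+1%:R) * (\int[mu]_(t in `[0, T]) (e t * phi t)).
Proof.
move=> tphi phi0.
have cphi := within_continuous (A := `[0, T]) (test_function_continuous tphi).
have cphi' := within_continuous (A := `[0, T]) (test_function_continuous' tphi).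
set CL := C + K / L.+1%:R.
have c1 := within_continuousM ce cphi.
have c2 := within_continuousM (@cE L) cphi'.
have c3 : {within `[0, T], continuous (fun t => CL * (e t * phi t))}.
  by apply: within_continuousM => //; apply: within_continuous; exact: cst_continuous.
have c4 := within_continuousD c3 c2.
have [P cP dP] := primitive T0 c4.
pose Q t := E L t * phi t - P t.
have cQ : {within `[0, T], continuous Q}.
  apply: within_continuousD; first exact: within_continuousM.
  exact: within_continuousN.
have dQ t : t \in `]0, T[ -> is_derive t 1 Q
    ((E L t * phi^`()%classic t + phi t * dE L t) -
     (CL * (e t * phi t) + E L t * phi^`()%classic t)).
  move=> tT; have h := is_deriveM (dEP L tT) (test_function_derive t tphi).
  exact: is_deriveB h (dP t tT).
have QT : Q T <= Q 0.
  apply: (@ler0_derive1_nincr _ Q 0 T) (lexx _) (ltW T0) (lexx _) => // t tT.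
    by case: (dQ t tT).
  have h := dQ t tT; rewrite derive1E derive_val.
  by have := ler_wpM2l (phi0 t) (dE_le L tT); rewrite -/CL; lra.
have PI : \int[mu]_(t in `[0, T]) (CL * (e t * phi t) + E L t * phi^`()%classic t) =
    P T - P 0.
  rewrite /Rintegral (@continuous_FTC2 R _ P 0 T)//.
    by apply: within_derivable_oo => // t /dP; case.
  by move=> t /dP h; rewrite derive1E; exact: derive_val.
rewrite RintegralD// in PI; try exact: integrable_continuous.
rewrite RintegralZl// in PI; last exact: integrable_continuous.
move: QT; rewrite /Q (test_function_zero tphi (or_intror (lexx _))).
rewrite (test_function_zero tphi (or_introl (lexx _))) !mulr0 !sub0r => h.
exact: le_of_add_eq PI h.
Qed.

(** Dominated convergence with majorant e |phi'|. *)
Lemma approx_cvg phi : test_function T phi ->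
  \int[mu]_(t in `[0, T]) (E L t * phi^`()%classic t) @[L --> \oo] -->
  \int[mu]_(t in `[0, T]) (e t * phi^`()%classic t).
Proof.
move=> tphi.
have cphi' := within_continuous (A := `[0, T]) (test_function_continuous' tphi).
have cphi'n : {within `[0, T], continuous (fun t => `|phi^`()%classic t|)}.
  by move=> z; apply: cvg_norm; exact: cphi'.
have iE L := integrable_continuous (within_continuousM (@cE L) cphi').
have ie := integrable_continuous (within_continuousM ce cphi').
have ien := integrable_continuous (within_continuousM ce cphi'n).
have [||_ _] := @dominated_convergence _ _ R mu `[0, T] (measurable_itv _)
   (fun L t => (E L t * phi^`()%classic t)%:E) (fun t => (e t * phi^`()%classic t)%:E)
   (fun t => (e t * `|phi^`()%classic t|)%:E)
   (fun L => measurable_int _ (iE L)) (measurable_int _ ie) _ ien.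
- apply: aeW => t tT; apply: cvg_EFin; first exact: nearW.
  apply: cvgM; last exact: cvg_cst.
  apply/cvgrPdist_le => d d0.
  have [L0 hL] := Ecvg tT d0; exists L0 => // L /= /hL h.
  by have /andP[_ h2] := E0 L tT; rewrite ger0_norm; lra.
- apply: aeW => t L tT; rewrite lee_fin normrM ler_wpM2r//.
  by have /andP[h1 h2] := E0 L tT; rewrite ger0_norm.
move=> cv; apply: fine_cvg; rewrite /Rintegral fineK//.
exact: integrable_fin_num ie.
Qed.

Lemma approx_weak phi : test_function T phi -> (forall t, 0 <= phi t) ->
  - (\int[mu]_(t in `[0, T]) (e t * phi^`()%classic t)) <=
  C * (\int[mu]_(t in `[0, T]) (e t * phi t)).
Proof.
move=> tphi phi0.
set A := \int[mu]_(t in _) (e t * phi t).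
have A0 : 0 <= A by apply: Rintegral_ge0 => t tT; rewrite mulr_ge0// e_ge0.
apply: le_eps_lim => d d0; have d2 : 0 < d / 2 by rewrite divr_gt0.
have := approx_cvg tphi => /cvgrPdist_le /(_ _ d2)[L1 _ hL1].
have A1 : 0 < A + 1 by rewrite ltr_wpDl.
have [L2 hL2] := inv_succ_le (divr_gt0 d2 A1).
pose L := maxn L1 L2.
have {}hL1 := hL1 L (leq_maxl _ _); have {}hL2 := hL2 L (leq_maxr _ _).
have := approx_weak_L L tphi phi0; rewrite -/A.
move: hL1; rewrite /= ler_norml => /andP[h1 h2].
have KL0 : 0 <= K / L.+1%:R by rewrite divr_ge0.
have : K / L.+1%:R * (A + 1) <= d / 2 by rewrite -ler_pdivlMr.
by move: (K / L.+1%:R) KL0 => y y0 h3; rewrite mulrDl => h4; lra.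
Qed.

Lemma approx_derivative_le (Ee : R -> \bar R) :
  (forall t, t \in `[0, T] -> Ee t = (e t)%:E) -> derivative_le T C Ee.
Proof.
move=> Eee.
have eqfine t : t \in `[0, T] -> fine (Ee t) = e t by move=> /Eee ->.
have cf : {within `[0, T], continuous (fun t => fine (Ee t))}.
  apply: (@subspace_eq_continuous _ _ _ e) => // t /set_mem tT.
  by apply/esym/eqfine.
have ie := integrable_continuous cf.
have s1 : `]0, T[ `<=` `[0, T] by exact: subset_itvW.
split.
- by move=> t /oo_cc /Eee ->.
- split.
  + have /measurable_realfun.measurable_EFinP := measurable_int _ ie.
    by apply: measurable_funS => //; exact: subset_itvW.
  + exact: interval_open.
  + move=> A AT cA.
    have mA : measurable A by apply: measurable_realfun.closed_measurable; exact: compact_closed.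
    have /integrableP[_] := @integrableS _ _ R mu `[0, T] A _ (measurable_itv _) mA
      (subset_trans AT s1) ie.
    by [].
- move=> t tT de.
  have nearE : \forall y \near t, fine (Ee y) = e y.
    move: (tT); rewrite in_itv/= => /andP[t0 tT'].
    near=> y; apply: eqfine; rewrite in_itv/=; apply/andP; split; apply: ltW; near: y.
      exact: lt_nbhsr.
    exact: lt_nbhsl.
  have de' : derivable e t 1 by exact: near_eq_derivable de.
  rewrite eqfine ?oo_cc// derive1E (near_eq_derive _ nearE) -derive1E.
  exact: approx_derive_le.
- move=> phi tphi phi0.
  have cphi := within_continuous (A := `[0, T]) (test_function_continuous tphi).
  have cphi' := within_continuous (A := `[0, T]) (test_function_continuous' tphi).
  rewrite !Rintegral_oo_cc; [|exact: within_continuousM..].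
  have := approx_weak tphi phi0.
  have -> : \int[mu]_(t in `[0, T]) (e t * phi^`()%classic t) =
    \int[mu]_(t in `[0, T]) (fine (Ee t) * phi^`()%classic t).
    by apply: eq_Rintegral => t /set_mem tT; rewrite eqfine.
  have -> // : \int[mu]_(t in `[0, T]) (e t * phi t) =
    \int[mu]_(t in `[0, T]) (fine (Ee t) * phi t).
  by apply: eq_Rintegral => t /set_mem tT; rewrite eqfine.
Unshelve. all: by end_near. Qed.

End Approx.

End DerivativeLe.

(** * Regularity in time of the solution *)

Section TimeContinuity.
Variable R : realType.
Implicit Types (u v w : R -> pdist R) (k : int) (t r T e : R) (n : int).

Definition sobcont k T u := forall t, t \in `[0, T] -> forall e, 0 < e ->
  exists2 d, 0 < d & forall r, r \in `[0, T] -> `|r - t| < d ->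
    sob k (psub (u r) (u t)) e.

Lemma within_eps T (f : R -> R) :
  (forall t, t \in `[0, T] -> forall e, 0 < e -> exists2 d, 0 < d &
    forall r, r \in `[0, T] -> `|r - t| < d -> `|f r - f t| <= e) ->
  {within `[0, T], continuous f}.
Proof.
move=> h; apply/subspace_continuousP => t tT.
apply/cvgrPdist_le => e e0; have [d d0 hd] := h t tT e e0.
exists d => //= r rt rT; rewrite distrC; apply: hd => //.
by rewrite distrC.
Qed.

Lemma Hcontinuous_sobcont T sigma v : 2 <= sigma -> H_continuous_on sigma T v ->
  sobcont 4 T v.
Proof.
move=> s2 cv t tT e e0; have [_ lim0] := cv t tT.
(* Here e bounds a squared norm, and 8 is the constant of [sob_Hnorm] at p = 2. *)
have n0 : nbhs (0%:E : \bar R) [set x | (x < (Num.sqrt (e / 8))%:E)%E].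
  have q0 : 0 < Num.sqrt (e / 8) by rewrite sqrtr_gt0 divr_gt0.
  exists (Num.sqrt (e / 8)) => //= x; rewrite /= sub0r normrN lte_fin.
  by move=> h; apply: le_lt_trans h; exact: ler_norm.
have := lim0 _ n0 => -[d /= d0 hd]; exists d => // r rT rt.
have /= lt1 := hd r; rewrite distrC in lt1.
have := sob_Hnorm (p := 2) s2 (ltW (lt1 rt rT)).
rewrite sqr_sqrtr; last by rewrite divr_ge0// ltW.
by congr (sob _ _ _); field.
Qed.

Lemma sobcont_lip k k' T K u u' : 0 <= K ->
  (forall r t d, r \in `[0, T] -> t \in `[0, T] ->
    sob k (psub (u r) (u t)) d -> sob k' (psub (u' r) (u' t)) (K * d)) ->
  sobcont k T u -> sobcont k' T u'.
Proof.
move=> K0 h cu t tT e e0; have K1 : 0 < K + 1 by rewrite ltr_wpDl.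
have [d d0 hd] := cu t tT _ (divr_gt0 e0 K1).
exists d => // r rT rt; have := h r t _ rT tT (hd r rT rt); apply: sobW => //.
by rewrite mulrA ler_pdivrMr// mulrC ler_wpM2l ?(ltW e0)// lerDl.
Qed.

Lemma sobcontW k k' T u : k <= k' -> sobcont k' T u -> sobcont k T u.
Proof.
move=> kk; apply: (@sobcont_lip k' k T 1) => // r t d _ _.
by rewrite mul1r; exact: sobW.
Qed.

Lemma sobcontD k T u w : sobcont k T u -> sobcont k T w ->
  sobcont k T (fun t => padd (u t) (w t)).
Proof.
move=> cu cw t tT e e0; have e4 : 0 < e / 4 by rewrite divr_gt0.
have [d1 d10 h1] := cu t tT _ e4; have [d2 d20 h2] := cw t tT _ e4.
exists (Num.min d1 d2); first by rewrite lt_min d10.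
move=> r rT; rewrite lt_min => /andP[r1 r2].
have := sobD (h1 r rT r1) (h2 r rT r2).
have -> : 2 * (e / 4) + 2 * (e / 4) = e by field.
by congr sob; apply/funext => n; rewrite /padd /psub; ring.
Qed.

Lemma sobcontZ k T (a : R[i]) u : sobcont k T u ->
  sobcont k T (fun t => pscale a (u t)).
Proof.
apply: (@sobcont_lip k k T (cabs a ^+ 2)); first exact: sqr_ge0.
move=> r t d _ _ /(sobZ a).
by congr sob; apply/funext => n; rewrite /pscale /psub mulrBr.
Qed.

Lemma sobcont_cabs k T u n : sobcont k T u -> forall t, t \in `[0, T] ->
  forall e, 0 < e -> exists2 d, 0 < d & forall r, r \in `[0, T] -> `|r - t| < d ->
    cabs (u r n - u t n) <= e.
Proof.
move=> cu t tT e e0.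
have he : 0 < (hw R k n * e) ^+ 2 by rewrite exprn_gt0// mulr_gt0// hw_gt0.
have [d d0 hd] := cu t tT _ he; exists d => // r rT rt.
have := sob_cabs n (hd r rT rt).
rewrite ler_sqr ?nnegrE ?mulr_ge0 ?hw_ge0 ?cabs_ge0 ?(ltW e0)//.
by rewrite ler_pM2l ?hw_gt0.
Qed.

Lemma sobcont_Re k T u n : sobcont k T u ->
  {within `[0, T], continuous (fun t => complex.Re (u t n))}.
Proof.
move=> cu; apply: within_eps => t tT e e0.
have [d d0 hd] := sobcont_cabs n cu tT e0; exists d => // r rT rt.
apply: le_trans (hd r rT rt); rewrite /cabs.
by case: (u r n) (u t n) => [a b] [a' b']/=; rewrite lerDl.
Qed.

Lemma sobcont_Im k T u n : sobcont k T u ->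
  {within `[0, T], continuous (fun t => complex.Im (u t n))}.
Proof.
move=> cu; apply: within_eps => t tT e e0.
have [d d0 hd] := sobcont_cabs n cu tT e0; exists d => // r rT rt.
apply: le_trans (hd r rT rt); rewrite /cabs.
by case: (u r n) (u t n) => [a b] [a' b']/=; rewrite lerDr.
Qed.

Lemma sobcont_iter_Zc k T c A1 B v (i : nat) : wl1 2 c A1 -> k <= 4 ->
  - (4 : int) <= k - i%:Z -> (forall t, t \in `[0, T] -> sob k (v t) B) ->
  sobcont k T v -> sobcont (k - i%:Z) T (fun t => iter i (Zc c) (v t)).
Proof.
move=> cA k4 ki vB; have [C C0 hC] := sob_iter_Zc cA k4 ki.
apply: (@sobcont_lip _ _ T C) => // r t d rT tT /hC.
by rewrite (iter_Zc_sub cA _ ki (vB r rT) (vB t tT)); last by lia.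
Qed.

(** The difference is split as (w_r - w_t) d_x v_r + w_t d_x (v_r - v_t). *)
Lemma sobcont_Xop T (w v : R -> pdist R) A B : 0 <= A ->
  (forall t, t \in `[0, T] -> wl1 2 (w t) A) ->
  (forall t, t \in `[0, T] -> sob 4 (v t) B) ->
  (forall t, t \in `[0, T] -> forall e, 0 < e -> exists2 d, 0 < d &
    forall r, r \in `[0, T] -> `|r - t| < d -> wl1 2 (psub (w r) (w t)) e) ->
  sobcont 4 T v -> sobcont 2 T (fun t => Xop (w t) (v t)).
Proof.
move=> A0 wA vB cw cv t tT e e0; have B0 := sob_ge0 (vB t tT).
have A2 : 0 < 4 * (A ^+ 2 + 1) by rewrite mulr_gt0// ltr_wpDl// sqr_ge0.
have B1 : 0 < 4 * (B + 1) by rewrite mulr_gt0// ltr_wpDl.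
(* The bound e1 <= 1 lets e1^2, which appears in the squared norm, be replaced by e1. *)
pose e1 := Num.min 1 (e / (4 * (B + 1))).
have e10 : 0 < e1 by rewrite lt_min ltr01 divr_gt0.
have [d1 d10 h1] := cw t tT _ e10.
have [d2 d20 h2] := cv t tT _ (divr_gt0 e0 A2).
exists (Num.min d1 d2); first by rewrite lt_min d10.
move=> r rT; rewrite lt_min => /andP[r1 r2].
have X1 := sob_Xop (isT : `|(4 : int) - 2| <= 4) (isT : (1 < 2)%N) (h1 r rT r1) (vB r rT).
have X2 := sob_Xop (isT : `|(4 : int) - 2| <= 4) (isT : (1 < 2)%N) (wA t tT) (h2 r rT r2).
have := sobD X1 X2.
have -> : padd (Xop (psub (w r) (w t)) (v r)) (Xop (w t) (psub (v r) (v t))) =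
    psub (Xop (w r) (v r)) (Xop (w t) (v t)).
  have E1 := pmul_linl 1 (-1) (isT : `|(4 : int) - 2| <= 4) (isT : (1 < 2)%N)
    (wA r rT) (wA t tT) (sob_Dx (vB r rT)).
  have E2 := pmul_linr 1 (-1) (isT : `|(4 : int) - 2| <= 4) (isT : (1 < 2)%N)
    (wA t tT) (sob_Dx (vB r rT)) (sob_Dx (vB t tT)).
  have F1 : psub (w r) (w t) = fun m => 1 * w r m + -1 * w t m.
    by apply/funext => m; rewrite mul1r mulN1r.
  have F2 : Dx (psub (v r) (v t)) = fun m => 1 * Dx (v r) m + -1 * Dx (v t) m.
    by apply/funext => m; rewrite /psub /Dx /fmultiplier; ring.
  rewrite /Xop F1 F2 E1 E2; apply/funext => n; rewrite /padd /psub; ring.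
apply: sobW => //.
have e1B : 2 * (e1 ^+ 2 * B) <= e / 2.
  have e11 : e1 <= 1 by rewrite ge_min lexx.
  have e12 : e1 * (4 * (B + 1)) <= e by rewrite -ler_pdivlMr// ge_min lexx orbT.
  have : e1 ^+ 2 * B <= e1 * B.
    by rewrite ler_wpM2r// expr2 ler_piMl// ltW.
  have : 0 <= e1 by exact: ltW.
  by lra.
have : A ^+ 2 * (e / (4 * (A ^+ 2 + 1))) <= e / 4.
  rewrite mulrA ler_pdivrMr//.
  have -> : e / 4 * (4 * (A ^+ 2 + 1)) = e * A ^+ 2 + e by field.
  by rewrite mulrC lerDl ltW.
by lra.
Qed.

End TimeContinuity.

(** * Differentiability in time of the modes of Z^i v *)

Section TimeDerivative.
Variable R : realType.
Implicit Types (u v w : R -> pdist R) (k : int) (t r T e : R) (n : int).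

Lemma MVT_between T (q dq : R -> R) (x y : R) :
  (forall z, z \in `]0, T[ -> is_derive z 1 q (dq z)) ->
  x \in `]0, T[ -> y \in `]0, T[ ->
  exists z, [/\ z \in `]0, T[, `|z - x| <= `|y - x| & q y - q x = dq z * (y - x)].
Proof.
move=> D; rewrite !in_itv/= => /andP[x0 xT] /andP[y0 yT].
have main (a b : R) : 0 < a -> a < b -> b < T ->
    exists2 z, (a < z < b) & q b - q a = dq z * (b - a).
  move=> a0 ab bT.
  have Dab z : z \in `]a, b[ -> is_derive z 1 q (dq z).
    rewrite in_itv/= => /andP[az zb]; apply: D; rewrite in_itv/=.
    by apply/andP; split; lra.
  have cq : {within `[a, b], continuous q}.
    apply: derivable_within_continuous => z; rewrite in_itv/= => /andP[az zb].
    by have [|] := D z; rewrite ?in_itv/=; [apply/andP; split; lra|].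
  have [z] := MVT ab Dab cq; rewrite in_itv/= => zab e; by exists z.
have [xy|yx|->] := ltgtP x y.
- have [z /andP[z1 z2] e] := main x y x0 xy yT; exists z; split=> //.
    by rewrite in_itv/=; apply/andP; split; lra.
  by rewrite !ger0_norm; lra.
- have [z /andP[z1 z2] e] := main y x y0 yx xT; exists z; split=> //.
    by rewrite in_itv/=; apply/andP; split; lra.
    by rewrite !ler0_norm; lra.
  by rewrite -(opprB (q x)) e; ring.
- exists y; split; [by rewrite in_itv/= y0|by rewrite subrr|by rewrite !subrr mulr0].
Qed.

Lemma is_derive_bigsum (I : Type) (s : seq I) (f : I -> R -> R) (df : I -> R) (x : R) :
  (forall j, is_derive x 1 (f j) (df j)) ->
  is_derive x 1 (fun y => \sum_(j <- s) f j y) (\sum_(j <- s) df j).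
Proof.
move=> h; elim: s => [|j s IH].
  rewrite big_nil; have -> : (fun y => \sum_(j <- [::]) f j y) = fun=> 0.
    by apply/funext => y; rewrite big_nil.
  exact: is_derive_cst.
rewrite big_cons.
have -> : (fun y => \sum_(i <- j :: s) f i y) = fun y => f j y + \sum_(i <- s) f i y.
  by apply/funext => y; rewrite big_cons.
exact: is_deriveD (h j) IH.
Qed.

Definition coef_derivable T v (F : R -> pdist R) := forall t n, t \in `]0, T[ ->
  is_derive t 1 (fun r => complex.Re (v r n)) (- complex.Re (F t n)) /\
  is_derive t 1 (fun r => complex.Im (v r n)) (- complex.Im (F t n)).

Definition increment v (F : R -> pdist R) t (h : R) : pdist R :=
  fun n => v (t + h) n - v t n + h%:C * F t n.

(* The mean value theorem is applied to the scalar product of the increment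
   with its own value at the end point, truncated to finitely many modes. *)
Lemma increment_small T v F : coef_derivable T v F -> sobcont 0 T F ->
  forall t, t \in `]0, T[ -> forall e, 0 < e ->
  exists2 d, 0 < d & forall h, h != 0 -> `|h| < d ->
    (t + h \in `]0, T[) /\ sob 0 (increment v F t h) (e * h ^+ 2).
Proof.
move=> D cF t tT e e0.
have tT' : t \in `[0, T] by move: tT; rewrite !in_itv/= => /andP[a b]; rewrite !ltW.
have e4 : 0 < e / 4 by rewrite divr_gt0.
have [d d0 hd] := cF t tT' _ e4.
move: (tT); rewrite in_itv/= => /andP[t0 tT2].
exists (Num.min d (Num.min t (T - t))).
  by rewrite !lt_min d0 t0 subr_gt0.
move=> h h0; rewrite !lt_min => /andP[hdd /andP[ht hTt]].
have thT : t + h \in `]0, T[.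
  rewrite in_itv/=; move: ht hTt; rewrite !ltr_norml => /andP[? ?] /andP[? ?].
  by apply/andP; split; lra.
split=> //.
suff : sum_le (fun n => sqmod (increment v F t h n)) (e / 2 * h ^+ 2).
  by move=> /sob_L2; congr (sob _ _ _); field.
apply/sum_leP => s us.
pose c := increment v F t h.
(* The increment c is frozen; q pairs it with v(r) + r F(t), whose variation from t to t + h is c
   itself. *)
pose q r := \sum_(n <- s) (complex.Re (c n) * (complex.Re (v r n) + r * complex.Re (F t n)) +
   complex.Im (c n) * (complex.Im (v r n) + r * complex.Im (F t n))).
pose dq r := \sum_(n <- s) complex.Re ((c n)^*%C * - (F r n - F t n)).
have Dq z : z \in `]0, T[ -> is_derive z 1 q (dq z).
  move=> zT; apply: is_derive_bigsum => n; have [dR dI] := D z n zT.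
  have l (a b x : R) (f : R -> R) (df : R) : is_derive x 1 f df ->
      is_derive x 1 (fun y => a * (f y + y * b)) (a * (df + b)).
    move=> fd; have h1 := is_deriveZ b (is_derive_id x (1 : R)).
    have h2 := is_deriveZ a (is_deriveD fd h1).
    have -> : (fun y => a * (f y + y * b)) = a \*: (f + b \*: id).
      by apply/funext => y; rewrite /GRing.scale/= [y * b]mulrC.
    by apply: (is_derive_eq h2); rewrite /GRing.scale/= mulr1.
  have h1 := is_deriveD (l (complex.Re (c n)) (complex.Re (F t n)) z _ _ dR)
    (l (complex.Im (c n)) (complex.Im (F t n)) z _ _ dI).
  apply: (is_derive_eq h1).
  by case: (c n) (F z n) (F t n) => [a b] [a' b'] [x y]/=; ring.
have [z [zT zt eq]] := MVT_between Dq tT thT.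
have qE : q (t + h) - q t = \sum_(n <- s) sqmod (c n).
  rewrite /q -sumrB; apply: eq_bigr => n _; rewrite /sqmod /c /increment.
  by case: (v (t + h) n) (v t n) (F t n) => [a b] [a' b'] [x y]/=; ring.
rewrite -/c -qE eq.
have ath : t + h - t = h by rewrite addrAC subrr add0r.
rewrite ath in eq zt; rewrite ath.
have zT' : z \in `[0, T] by move: zT; rewrite !in_itv/= => /andP[a b]; rewrite !ltW.
have Fz := hd z zT' (le_lt_trans zt hdd).
set S := \sum_(n <- s) sqmod (c n) in qE.
have S0 : 0 <= S by apply: sumr_ge0 => n _; exact: sqmod_ge0.
have ah : 0 < `|h| by rewrite normr_gt0.
(* The weight 4 |h| in the inequality for products leaves S/2 on the right, which is absorbed into
   S. *)
have dqb : `|dq z| * `|h| <= S / 2 + e / 4 * h ^+ 2.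
  have : `|dq z| <= \sum_(n <- s) (S * 0 + (cabs (c n) ^+ 2 / (4 * `|h|) + `|h| * cabs (F z n - F t n) ^+ 2)).
    apply: le_trans (ler_norm_sum _ _ _) _; apply: ler_sum => n _.
    rewrite mulr0 add0r; apply: le_trans (Re_conjM_le _ _) _; rewrite cabsN.
    move: (cabs (c n)) (cabs (F z n - F t n)) => a b.
    have := sqr_ge0 (a - 2 * `|h| * b) => H.
    have -> : a ^+ 2 / (4 * `|h|) + `|h| * b ^+ 2 =
      a * b + (4 * `|h|)^-1 * (a - 2 * `|h| * b) ^+ 2 by field; rewrite gt_eqF.
    by rewrite lerDl mulr_ge0// invr_ge0 mulr_ge0.
  have -> : \sum_(n <- s) (S * 0 + (cabs (c n) ^+ 2 / (4 * `|h|) + `|h| * cabs (F z n - F t n) ^+ 2)) =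
    (\sum_(n <- s) cabs (c n) ^+ 2) / (4 * `|h|) + `|h| * \sum_(n <- s) cabs (F z n - F t n) ^+ 2.
    rewrite mulr_suml mulr_sumr -big_split; apply: eq_bigr => n _.
    by rewrite mulr0 add0r.
  move=> b1; have := ler_wpM2r (ltW ah) b1; rewrite mulrDl => b2.
  apply: le_trans b2 _; apply: lerD.
    have -> : (\sum_(n <- s) cabs (c n) ^+ 2) / (4 * `|h|) * `|h| =
      (\sum_(n <- s) cabs (c n) ^+ 2) / 4 by field; rewrite gt_eqF.
    have : \sum_(n <- s) cabs (c n) ^+ 2 <= 2 * S.
      by rewrite mulr_sumr; apply: ler_sum => n _; exact: cabs_le_sqmod.
    by move=> H; lra.
  have : \sum_(n <- s) cabs (F z n - F t n) ^+ 2 <= e / 4.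
    have := (sum_leP _ _).1 Fz s us; apply: le_trans; apply: ler_sum => n _.
    by rewrite hw0 mul1r.
  rewrite -[h ^+ 2]real_normK ?num_real// => H.
  have -> : `|h| * (\sum_(n <- s) cabs (F z n - F t n) ^+ 2) * `|h| =
     (\sum_(n <- s) cabs (F z n - F t n) ^+ 2) * `|h| ^+ 2.
    by rewrite mulrAC -expr2 mulrC.
  by rewrite ler_wpM2r ?exprn_ge0.
have : S <= `|dq z| * `|h| by rewrite -qE eq -normrM ler_norm.
by rewrite -eq qE => H; lra.
Qed.

(** A mode of Z^i v depends on all modes of v, so modewise derivatives do not suffice: smallness of
    the increment in L^2 is carried by Z^i to H^(-i/2) and read off at the mode n. *)
Lemma iter_Zc_coef_derivable T c A1 B B' v F (i : nat) : wl1 2 c A1 ->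
  (i <= 4)%N ->
  (forall t, t \in `[0, T] -> sob 4 (v t) B) ->
  (forall t, t \in `[0, T] -> sob 0 (F t) B') ->
  coef_derivable T v F -> sobcont 0 T F ->
  coef_derivable T (fun t => iter i (Zc c) (v t)) (fun t => iter i (Zc c) (F t)).
Proof.
move=> cA i4 vB FB D cF t n tT.
have cc x : x \in `]0, T[ -> x \in `[0, T].
  by rewrite !in_itv/= => /andP[a b]; rewrite !ltW.
have v0 x : x \in `]0, T[ -> sob 0 (v x) B.
  by move=> /cc /vB; apply: sobW.
have F0 x : x \in `]0, T[ -> sob 0 (F x) B' by move=> /cc /FB.
have i0 : - (4 : int) <= 0 - i%:Z by lia.
have [C C0 hC] := sob_iter_Zc cA (isT : (0 : int) <= 4) i0.
have key e : 0 < e -> exists2 d, 0 < d & forall h, h != 0 -> `|h| < d ->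
    cabs (iter i (Zc c) (v (t + h)) n - iter i (Zc c) (v t) n +
      h%:C * iter i (Zc c) (F t) n) <= e * `|h|.
  move=> e0; pose E := (hw R (0 - i%:Z) n * e) ^+ 2 / (C + 1).
  have C1 : 0 < C + 1 by rewrite ltr_wpDl.
  have E0 : 0 < E by rewrite divr_gt0// exprn_gt0// mulr_gt0// hw_gt0.
  have [d d0 hd] := increment_small D cF tT E0; exists d => // h h0 hdd.
  have [thT inc] := hd h h0 hdd.
  have := sob_cabs n (hC _ _ inc).
  have -> : increment v F t h = padd (psub (v (t + h)) (v t)) (pscale h%:C (F t)) by [].
  rewrite (iter_Zc_add cA (isT : `|(0 : int)| <= 4) i0 (sobB (v0 _ thT) (v0 _ tT)) (sobZ _ (F0 _ tT))).
  rewrite (iter_Zc_sub cA (isT : `|(0 : int)| <= 4) i0 (v0 _ thT) (v0 _ tT)).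
  rewrite (iter_Zc_scale _ cA (isT : `|(0 : int)| <= 4) i0 (F0 _ tT)) => H.
  have {}H : (hw R (0 - i%:Z) n * cabs (iter i (Zc c) (v (t + h)) n -
     iter i (Zc c) (v t) n + h%:C * iter i (Zc c) (F t) n)) ^+ 2 <=
     (hw R (0 - i%:Z) n * (e * `|h|)) ^+ 2.
    have -> : (hw R (0 - i%:Z) n * (e * `|h|)) ^+ 2 = (hw R (0 - i%:Z) n * e) ^+ 2 * h ^+ 2.
      by rewrite mulrA exprMn real_normK ?num_real.
    apply: le_trans H _; rewrite mulrA.
    rewrite ler_wpM2r ?sqr_ge0// /E mulrA ler_pdivrMr// mulrC.
    by rewrite ler_wpM2l ?sqr_ge0// lerDl.
  move: H; rewrite ler_sqr ?nnegrE ?mulr_ge0 ?hw_ge0 ?cabs_ge0 ?(ltW e0)//.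
  by rewrite ler_pM2l ?hw_gt0.
split; apply: is_derive_eps => e /key[d d0 hd]; exists d => // h h0 /(hd h h0);
  apply: le_trans; rewrite mulrN opprK /cabs.
  case: (iter _ _ _ _) (iter _ _ _ _) (iter _ _ _ _) => [a b] [a' b'] [x y]/=.
  by rewrite mul0r subr0 lerDl.
case: (iter _ _ _ _) (iter _ _ _ _) (iter _ _ _ _) => [a b] [a' b'] [x y]/=.
by rewrite !mul0r addr0 lerDr.
Qed.

Lemma energy_pair_derive T u F L t : coef_derivable T u F -> t \in `]0, T[ ->
  is_derive t 1 (fun r => energy_pair L (u r) (u r))
    (- (2 * energy_pair L (u t) (F t))).
Proof.
move=> D tT.
have -> : (fun r => energy_pair L (u r) (u r)) = fun r => \sum_(n <- zlist L)
   (rho R L n ^+ 2 * (complex.Re (u r n) ^+ 2 + complex.Im (u r n) ^+ 2)).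
  apply/funext => r; apply: eq_bigr => n _; rewrite /lowpass.
  by case: (u r n) => [a b]/=; ring.
have h n : is_derive t 1
    (fun r => rho R L n ^+ 2 * (complex.Re (u r n) ^+ 2 + complex.Im (u r n) ^+ 2))
    (rho R L n ^+ 2 * (2 * complex.Re (u t n) * - complex.Re (F t n) +
      2 * complex.Im (u t n) * - complex.Im (F t n))).
  have [d1 d2] := D t n tT.
  have p1 := is_derive_pow 2 d1; have p2 := is_derive_pow 2 d2.
  have H := is_deriveZ (rho R L n ^+ 2) (is_deriveD p1 p2).
  by apply: (is_derive_eq H); rewrite /GRing.scale/= !expr1.
apply: (is_derive_eq (is_derive_bigsum (zlist L) h)).
rewrite /energy_pair /rpair mulr_sumr -sumrN; apply: eq_bigr => n _.
by rewrite /lowpass; case: (u t n) (F t n) => [a b] [x y]/=; ring.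
Qed.

End TimeDerivative.

(** * Convergence and continuity of the energies *)

Section EnergyApproximation.
Variable R : realType.
Implicit Types (u v : R -> pdist R) (f : pdist R) (t r T e K : R) (n : int).

Lemma energy_pairE L f : energy_pair L f f =
  \sum_(n <- zlist L) rho R L n ^+ 2 * sqmod (f n).
Proof.
apply: eq_bigr => n _; rewrite /lowpass /sqmod.
by case: (f n) => [a b]/=; ring.
Qed.

Lemma rho_sqr_le1 L n : rho R L n ^+ 2 <= 1.
Proof. by rewrite expr_le1 ?rho_ge0 ?rho_le1. Qed.

Lemma energy_pair_ge0 L f : 0 <= energy_pair L f f.
Proof.
rewrite energy_pairE; apply: sumr_ge0 => n _.
by rewrite mulr_ge0 ?sqr_ge0 ?sqmod_ge0.
Qed.

Lemma energy_pair_le_nsum L f K : sum_le (fun n => sqmod (f n)) K ->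
  energy_pair L f f <= nsum (fun n => sqmod (f n)).
Proof.
move=> fK; rewrite energy_pairE.
have := (sum_leP _ _).1 (sum_le_nsum (fun n => sqmod_ge0 (f n)) fK) _ (zlist_uniq L).
apply: le_trans; apply: ler_sum => n _.
by rewrite ler_piMl ?sqmod_ge0 ?rho_sqr_le1.
Qed.

Lemma zlist_mono L L' : (L <= L')%N -> {subset zlist L <= zlist L'}.
Proof.
move=> LL n; rewrite !mem_cat => /orP[/mapP[p]|/mapP[p]]; rewrite mem_iota => hp ->;
  apply/orP; [left|right]; apply: map_f; rewrite mem_iota; lia.
Qed.

(** Half of d pays for the restriction to a finite set of modes, the other half for the distance of
    rho^2 to 1 on that set. *)
Lemma energy_pair_cvg f K d : sum_le (fun n => sqmod (f n)) K -> 0 < d ->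
  exists L0, forall L, (L0 <= L)%N ->
    nsum (fun n => sqmod (f n)) <= energy_pair L f f + d.
Proof.
move=> fK d0; have f0 n : 0 <= sqmod (f n) by exact: sqmod_ge0.
have d2 : 0 < d / 2 by rewrite divr_gt0.
have [s us hs] : exists2 s : seq int, uniq s &
    nsum (fun n => sqmod (f n)) - d / 2 < \sum_(n <- s) sqmod (f n).
  apply: contrapT => H.
  have /(nsum_le f0) : sum_le (fun n => sqmod (f n)) (nsum (fun n => sqmod (f n)) - d / 2).
    apply/sum_leP => s us; rewrite leNgt; apply/negP => h; apply: H; by exists s.
  by lra.
have [L1 sL1] := sub_zlist s.
(* From 1 - rho^2 <= 2 (1 - rho) <= 2 |n|/(L + 1). *)
pose Q := \sum_(n <- s) 2 * (`|n%:~R| * sqmod (f n)).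
have Q0 : 0 <= Q by apply: sumr_ge0 => n _; rewrite !mulr_ge0.
have [L2 hL2] := inv_succ_le Q0 d2.
exists (maxn L1 L2) => L; rewrite geq_max => /andP[L1L L2L].
have b1 : \sum_(n <- s) rho R L n ^+ 2 * sqmod (f n) <= energy_pair L f f.
  rewrite energy_pairE; apply: ler_sum_subset => //; first exact: zlist_uniq.
    by move=> n; rewrite mulr_ge0 ?sqr_ge0.
  by move=> n /sL1; exact: zlist_mono.
have b2 : \sum_(n <- s) sqmod (f n) <=
    (\sum_(n <- s) rho R L n ^+ 2 * sqmod (f n)) + Q / L.+1%:R.
  rewrite /Q mulr_suml -big_split; apply: ler_sum => n _ /=.
  have r1 : 1 - `|n%:~R| / L.+1%:R <= rho R L n by rewrite le_max lexx orbT.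
  have r0 := rho_ge0 R L n; have r2 := rho_le1 R L n.
  have -> : 2 * (`|n%:~R| * sqmod (f n)) / L.+1%:R =
    2 * (`|n%:~R| / L.+1%:R) * sqmod (f n) by ring.
  rewrite -mulrDl -[leLHS]mul1r ler_wpM2r//.
  move: (`|n%:~R| / L.+1%:R) r1 => x r1.
  have := sqr_ge0 (1 - rho R L n); rewrite sqrrB expr1n mul1r => h.
  by lra.
have b3 := hL2 L L2L.
by move: (Q / L.+1%:R) b2 b3 => x b2 b3; lra.
Qed.

(** It rests on x^2 <= (1 + t) y^2 + (1 + 1/t) (x - y)^2, which compares squared norms directly. For
    continuity t is chosen before d. *)
Lemma nsum_sqmod_sub (f g : pdist R) K d (t : R) : 0 < t -> sob 0 f K -> sob 0 g K ->
  sob 0 (psub f g) d ->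
  nsum (fun n => sqmod (f n)) - nsum (fun n => sqmod (g n)) <= t * K + (1 + t^-1) * d.
Proof.
move=> t0 fK gK fgd.
have s0 (h : pdist R) n : 0 <= sqmod (h n) by exact: sqmod_ge0.
have t1 : 0 <= 1 + t by rewrite addr_ge0// ltW.
have t2 : 0 <= 1 + t^-1 by rewrite addr_ge0// invr_ge0 ltW.
have gN := nsum_le (s0 g) (sob0_sqmod gK).
have := sum_leD (sum_leZ t1 (sum_le_nsum (s0 g) (sob0_sqmod gK))) (sum_leZ t2 (sob0_sqmod fgd)).
move=> H.
have : sum_le (fun n => sqmod (f n)) ((1 + t) * nsum (fun n => sqmod (g n)) + (1 + t^-1) * d).
  apply: (sum_leW _ (lexx _) H) => n; rewrite /psub /sqmod.
  case: (f n) (g n) => [a b] [a' b']/=.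
  have tn : t != 0 by rewrite gt_eqF.
  have e (x y : R) : (1 + t) * y ^+ 2 + (1 + t^-1) * (x - y) ^+ 2 =
    x ^+ 2 + t^-1 * (x - (1 + t) * y) ^+ 2 by field.
  have -> : (1 + t) * (a' ^+ 2 + b' ^+ 2) + (1 + t^-1) * ((a - a') ^+ 2 + (b - b') ^+ 2)
   = ((1 + t) * a' ^+ 2 + (1 + t^-1) * (a - a') ^+ 2) +
     ((1 + t) * b' ^+ 2 + (1 + t^-1) * (b - b') ^+ 2) by ring.
  by rewrite !e; apply: lerD; rewrite lerDl mulr_ge0 ?sqr_ge0// invr_ge0 ltW.
move=> /(nsum_le (s0 f)); rewrite mulrDl mul1r => h.
have := ler_wpM2l (ltW t0) gN.
by move: ((1 + t^-1) * d) h => x h; lra.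
Qed.

Lemma sobcont_nsum T K u : sobcont 0 T u ->
  (forall t, t \in `[0, T] -> sob 0 (u t) K) ->
  {within `[0, T], continuous (fun t => nsum (fun n => sqmod (u t n)))}.
Proof.
move=> cu uK; apply: within_eps => t tT e e0.
have K0 := sob_ge0 (uK t tT).
pose q := e / (2 * (K + 1)); have K1 : 0 < 2 * (K + 1) by rewrite mulr_gt0// ltr_wpDl.
have q0 : 0 < q by rewrite divr_gt0.
have q1 : 0 < 2 * (1 + q^-1) by rewrite mulr_gt0// ltr_wpDr ?invr_gt0// ltW ?invr_gt0.
have [d d0 hd] := cu t tT _ (divr_gt0 e0 q1); exists d => // r rT rt.
have h1 := hd r rT rt.
have h2 : sob 0 (psub (u t) (u r)) (e / (2 * (1 + q^-1))).
  apply: sum_leW h1 => // n; rewrite /psub -[u t n - u r n]opprB cabsN.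
  by rewrite le_eqVlt eqxx.
have i1 := nsum_sqmod_sub q0 (uK r rT) (uK t tT) h1.
have i2 := nsum_sqmod_sub q0 (uK t tT) (uK r rT) h2.
have b1 : q * K <= e / 2.
  rewrite /q mulrAC ler_pdivrMr//.
  have -> : e / 2 * (2 * (K + 1)) = e * K + e by field.
  by rewrite lerDl ltW.
have b2 : (1 + q^-1) * (e / (2 * (1 + q^-1))) = e / 2.
  have : 1 + q^-1 != 0 by move: q1; rewrite pmulr_rgt0// => /lt0r_neq0.
  by move: (1 + q^-1) => y y0; field.
rewrite b2 in i1 i2.
by rewrite ler_norml; apply/andP; split; lra.
Qed.

Lemma within_continuous_sum (I : Type) (s : seq I) T (G : I -> R -> R) :
  (forall j, {within `[0, T], continuous (G j)}) ->
  {within `[0, T], continuous (fun x => \sum_(j <- s) G j x)}.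
Proof.
move=> cG; elim: s => [|j s IH].
  have -> : (fun x => \sum_(j <- [::]) G j x) = fun=> 0.
    by apply/funext => x; rewrite big_nil.
  by apply: within_continuous; exact: cst_continuous.
have -> : (fun x => \sum_(i <- j :: s) G i x) = fun x => G j x + \sum_(i <- s) G i x.
  by apply/funext => x; rewrite big_cons.
exact: within_continuousD (cG j) IH.
Qed.

Lemma energy_pair_continuous k T u L : sobcont k T u ->
  {within `[0, T], continuous (fun t => energy_pair L (u t) (u t))}.
Proof.
move=> cu.
have -> : (fun t => energy_pair L (u t) (u t)) = fun t => \sum_(n <- zlist L)
   (rho R L n ^+ 2 * (complex.Re (u t n) * complex.Re (u t n) +
     complex.Im (u t n) * complex.Im (u t n))).
  by apply/funext => t; rewrite energy_pairE; apply: eq_bigr => n _; rewrite /sqmod !expr2.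
apply: within_continuous_sum => n; apply: within_continuousM.
  by apply: within_continuous; exact: cst_continuous.
by apply: within_continuousD; apply: within_continuousM;
  (exact: sobcont_Re cu || exact: sobcont_Im cu).
Qed.

End EnergyApproximation.

(** * The equation mode by mode, and the energy estimate *)

Section Solution.
Variables (R : realType) (chi : R -> R) (W : pdist R -> pdist R).
Implicit Types (u v : R -> pdist R) (f : pdist R) (t r T e K : R) (n : int).

Local Notation mu := (@lebesgue_measure R).
Let c := fourier_coef (fun x => (chi x)%:C).

Lemma grav_rhsE eps f : Weps W eps f = W f ->
  grav_rhs W chi eps f = padd (Xop (W f) f) (pscale (eps^-1)%:C (Zc c f)).
Proof.
move=> We; rewrite /grav_rhs We; apply/funext => n.
rewrite /padd /pscale /Zc /padd /pscale /Xop /pmul_fun -/c; ring.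
Qed.

(** The weak formulation at the mode n is, for its real and imaginary parts, the hypothesis of
    [du_bois_reymond]. *)
Lemma grav_solution_coef_derivable eps sigma T (v0 : pdist R) v (F : R -> pdist R)
    (k k' : int) :
  0 < T -> grav_solution W chi eps sigma T v0 v ->
  (forall t, t \in `[0, T] -> grav_rhs W chi eps (v t) = F t) ->
  sobcont k T v -> sobcont k' T F -> coef_derivable T v F.
Proof.
move=> T0 [_ _ weak] rhsE cv cF t n tT; split.
  refine (du_bois_reymond T0 (sobcont_Re (n := n) cv) (sobcont_Re (n := n) cF) _ tT) => phi tphi.
  have := congr1 (@complex.Re R) (weak phi tphi n); rewrite /cintegral/= => h; rewrite -[RHS]h.
  apply: eq_Rintegral => r /set_mem rT; rewrite rhsE//.
  by case: (v r n) (F r n) => [a b] [x y]/=; ring.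
refine (du_bois_reymond T0 (sobcont_Im (n := n) cv) (sobcont_Im (n := n) cF) _ tT) => phi tphi.
have := congr1 (@complex.Im R) (weak phi tphi n); rewrite /cintegral/= => h; rewrite -[RHS]h.
apply: eq_Rintegral => r /set_mem rT; rewrite rhsE//.
by case: (v r n) (F r n) => [a b] [x y]/=; ring.
Qed.

Lemma Egrav_nsum v t K : (forall i : 'I_5, sob 0 (iter i (Zc c) (v t)) K) ->
  Egrav chi v t =
  (2 * pi * \sum_(i < 5) nsum (fun n => sqmod (iter i (Zc c) (v t) n)))%:E.
Proof.
move=> vK; rewrite mulr_sumr -sumEFin; apply: eq_bigr => i _.
rewrite L2norm_sqr (nnsumE _ (sob0_sqmod (vK i)))// => n; exact: sqmod_ge0.
Qed.

End Solution.

Theorem theorem4p2 (R : realType) (omega : set R) (chi : R -> R)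
  (hchi : cutoff omega chi)
  (N : nat) (hN : (1 <= N)%N) (W : pdist R -> pdist R)
  (hW : smoothing_map N W)
  (sigma : R) (hsigma : 2 <= sigma) (M : R) (hM : 0 < M) :
  exists2 C : R, 0 < C &
    forall (eps : R) (heps0 : 0 < eps) (heps1 : eps < 1)
      (T : R) (hT : 0 < T) (v0 : pdist R) (hv0 : inH sigma v0)
      (v : R -> pdist R)
      (hv : grav_solution W chi eps sigma T v0 v)
      (hvM : forall t : R, t \in `[0, T] -> (Hnorm sigma (v t) <= M%:E)%E),
      derivative_le T C (Egrav chi v).
Proof.
pose c := fourier_coef (fun x => (chi x)%:C).
have [A1 cA] : exists A, wl1 3 c A by exact: cutoff_wl1 hchi.
have cA2 : wl1 2 c A1 by exact: wl1W cA.
have cp : positive_kernel c by exact: cutoff_positive_kernel hchi.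
have [A2 A20 hA2] := smoothing_wl1 hN hW hsigma M.
have [C1 C10 hC1] := energy_rate cA cp A20.
have [C2 C20 hC2] := sob_elliptic_iter cA2 (isT : (4 <= 4)%N).
(* One factor 2 is from differentiating a square, the other from passing from the modulus to [cabs]
   in [sob_L2]. The 1 added below makes the constant strictly positive. *)
pose C0 := 4 * (C1 * C2); have C00 : 0 <= C0 by rewrite mulr_ge0// mulr_ge0.
exists (C0 + 1); first by rewrite ltr_wpDl.
move=> eps heps0 heps1 T hT v0 hv0 v hv hvM.
pose B := 2 ^+ 3 * M ^+ 2.
have vB t : t \in `[0, T] -> sob 4 (v t) B.
  by move=> tT; exact: (sob_Hnorm (p := 2) hsigma (hvM t tT)).
have vH t : t \in `[0, T] -> inH sigma (v t).
  by move=> tT; exact: le_lt_trans (hvM t tT) (ltry M).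
have wA t : t \in `[0, T] -> wl1 2 (W (v t)) A2.
  by move=> tT; exact: (hA2 _ (hvM t tT)).1.
have wR t : t \in `[0, T] -> preal (W (v t)).
  by move=> tT; exact: (hA2 _ (hvM t tT)).2.
have [cvH _ _] := hv; have cv := Hcontinuous_sobcont hsigma cvH.
have cw t : t \in `[0, T] -> forall e, 0 < e -> exists2 d, 0 < d &
    forall r, r \in `[0, T] -> `|r - t| < d -> wl1 2 (psub (W (v r)) (W (v t))) e.
  move=> tT e e0.
  have [d d0 hd] := smoothing_wl1_continuous hN hW hsigma (vH t tT) e0.
  have [_ lim0] := cvH t tT.
  have n0 : nbhs (0%:E : \bar R) [set x | (x < d%:E)%E].
    exists d => //= x; rewrite /= sub0r normrN lte_fin.
    by move=> h; apply: le_lt_trans h; exact: ler_norm.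
  have := lim0 _ n0 => -[d' /= d'0 hd']; exists d' => // r rT rt.
  by apply: hd; [exact: vH|apply: hd' => //=; rewrite distrC].
pose F t := padd (Xop (W (v t)) (v t)) (pscale (eps^-1)%:C (Zc c (v t))).
have cF : sobcont 0 T F.
  apply: sobcontD.
    by apply: sobcontW (sobcont_Xop A20 wA vB cw cv).
  apply: sobcontZ; apply: (@sobcontW _ _ (4 - 1%:Z)) => //.
  by apply: (sobcont_iter_Zc (i := 1) cA2 _ _ vB cv).
(* This bound grows as eps tends to 0. It serves only to differentiate the modes and does not enter
   the final constant. *)
pose B' := 2 * (A2 ^+ 2 * B) +
  2 * (cabs (eps^-1)%:C ^+ 2 * (2 * B + 2 * (A1 ^+ 2 * B))).
have FB t : t \in `[0, T] -> sob 0 (F t) B'.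
  move=> tT; apply: sobD.
    apply: (sobW _ (lexx _) (sob_Xop (k := 4) _ _ (wA t tT) (vB t tT))) => //.
  apply: sobZ; apply: (sobW _ (lexx _) (sob_Z (k := 4) _ cA2 (vB t tT))) => //.
have rhsE t : t \in `[0, T] -> grav_rhs W chi eps (v t) = F t.
  by move=> tT; apply: grav_rhsE; exact: WepsE hW _ _ heps0 (vH t tT).
have D := grav_solution_coef_derivable hT hv rhsE cv cF.
have [K0 _ hK0] := sob0_iter_Zc cA2.
pose K := K0 * B.
have hK t : t \in `[0, T] -> forall i : nat, (i < 5)%N ->
    sob 0 (iter i (Zc c) (v t)) K.
  by move=> tT i i5; exact: hK0 (vB t tT).
have p0 : 0 < 2 * pi :> R by exact: pi2_gt0.
pose G (i : nat) t := iter i (Zc c) (v t).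
pose S t := \sum_(i < 5) nsum (fun n => sqmod (G i t n)).
pose E L t := 2 * pi * \sum_(i < 5) energy_pair L (G i t) (G i t).
pose dE L t := 2 * pi * \sum_(i < 5) - (2 * energy_pair L (G i t) (iter i (Zc c) (F t))).
have cG (i : 'I_5) : sobcont (4 - i%:Z) T (G i).
  by apply: (sobcont_iter_Zc cA2 _ _ vB cv) => //; have := ltn_ord i; lia.
have cG0 (i : 'I_5) : sobcont 0 T (G i).
  by apply: sobcontW (cG i); have := ltn_ord i; lia.
have oo_cc t : t \in `]0, T[ -> t \in `[0, T].
  by rewrite !in_itv/= => /andP[a b]; rewrite !ltW.
apply: (@approx_derivative_le R T (C0 + 1) (C0 / eps) (fun t => 2 * pi * S t) E dE) => //.
- by rewrite addr_ge0.
- by rewrite divr_ge0// ltW.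
- apply: within_continuousM; first by apply: within_continuous; exact: cst_continuous.
  apply: within_continuous_sum => i; apply: (sobcont_nsum (K := K) (cG0 i)) => t tT.
  exact: hK.
- move=> L; apply: within_continuousM; first by apply: within_continuous; exact: cst_continuous.
  by apply: within_continuous_sum => i; exact: energy_pair_continuous (cG0 i).
- move=> L t tT; apply/andP; split.
    by rewrite mulr_ge0 ?(ltW p0)// sumr_ge0// => i _; exact: energy_pair_ge0.
  rewrite ler_wpM2l ?(ltW p0)// ler_sum// => i _.
  exact: energy_pair_le_nsum (sob0_sqmod (hK t tT i (ltn_ord i))).
- move=> t tT d d0.
  (* The error is shared among the five powers of Z, after removal of the factor 2 pi. *)
  have d5 : 0 < d / (2 * pi) / 5 by rewrite !divr_gt0.
  have Li (i : 'I_5) : exists L0, forall L, (L0 <= L)%N ->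
      nsum (fun n => sqmod (G i t n)) <= energy_pair L (G i t) (G i t) + d / (2 * pi) / 5.
    exact: energy_pair_cvg (sob0_sqmod (hK t tT i (ltn_ord i))) d5.
  have [L0 hL0] := choice Li.
  exists (\max_(i < 5) L0 i)%N => L hL.
  rewrite /E -[X in _ <= _ + X](divfK (lt0r_neq0 p0)) [d / _ * _]mulrC -mulrDr.
  rewrite ler_wpM2l ?(ltW p0)//.
  have -> : d / (2 * pi) = \sum_(i < 5) (d / (2 * pi) / 5).
    by rewrite sumr_const card_ord -[RHS]mulr_natr divfK.
  rewrite -big_split ler_sum// => i _; apply: hL0.
  by apply: leq_trans hL; exact: leq_bigmax.
- move=> L t tT.
  have dG (i : 'I_5) : is_derive t 1 (fun r => energy_pair L (G i r) (G i r))
      (- (2 * energy_pair L (G i t) (iter i (Zc c) (F t)))).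
    have i4 : (i <= 4)%N by have := ltn_ord i; lia.
    exact: (energy_pair_derive L (iter_Zc_coef_derivable cA2 i4 vB FB D cF) tT).
  have H := is_deriveZ (2 * pi) (is_derive_bigsum (index_enum _) dG).
  exact: (is_derive_eq H).
- move=> L t tT; have tT' := oo_cc t tT.
  have S0 (i : 'I_5) : 0 <= nsum (fun n => sqmod (G i t n)).
    by apply: nsum_ge0 => n; exact: sqmod_ge0.
  have St : 0 <= S t by exact: sumr_ge0.
  have GS (i : nat) : (i < 5)%N -> sob 0 (G i t) (2 * S t).
    move=> i5; apply: sob_L2.
    have h := sum_le_nsum (fun n => sqmod_ge0 (G i t n)) (sob0_sqmod (hK t tT' i i5)).
    apply: (sum_leW _ _ h) => //.
    by rewrite /S (bigD1 (Ordinal i5))//= lerDl sumr_ge0.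
  (* The H^2 bound passed to the rate is the energy at time t rather than [B], so the inequality is
     linear in the energy. *)
  have v4 := hC2 _ _ GS 0%N isT.
  have rate := hC1 _ _ _ _ L (wA t tT') (wR t tT') heps0 v4.
  have -> : dE L t = 2 * pi * (2 * (- (\sum_(i < 5)
      energy_pair L (G i t) (iter i (Zc c) (F t))))).
    rewrite /dE; congr (_ * _); rewrite sumrN -mulr_sumr; ring.
  have -> : (C0 + 1 + C0 / eps / L.+1%:R) * (2 * pi * S t) =
      2 * pi * (2 * ((C1 + C1 / (eps * L.+1%:R)) * (C2 * (2 * S t))) + S t).
    by rewrite /C0 invfM; ring.
  rewrite ler_wpM2l ?(ltW p0)//.
  by apply: le_trans (ler_wpM2l (ler0n _ 2) rate) _; rewrite lerDl.
- move=> t tT; apply: (@Egrav_nsum _ _ _ _ K) => i.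
  exact: hK.
Qed.
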